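(* Let $K\ge 1$, $t>1$, $\lambda_0^1,\dots,\lambda_0^K>0$ with $\sum_k\lambda_0^k=1$, and $\nu_1,\nu_0^1,\dots,\nu_0^K\in\mathcal P_2(\mathbb R^d)$. Fix a random variable $Y\in L^2$ with $Y\sim\nu_1$. Let $(\mathcal P)$ denote the value $$\inf_{\mu\in\mathcal P_2(\mathbb R^d)}\Big\{t\,\tfrac{W_2^2(\mu,\nu_1)}{2}-(t-1)\sum_{k=1}^K\lambda_0^k\tfrac{W_2^2(\mu,\nu_0^k)}{2}\Big\},$$ and let $(\mathcal Q)$ denote both the problem and its value $$\inf\Big\{\tfrac12\Big\|tY-(t-1)\sum_k\lambda_0^kZ^k\Big\|_{L^2}^2\ :\ Z^k\in L^2,\ Z^k_\#P\preceq_C\nu_0^k,\ k=1,\dots,K\Big\}.$$ Then $$(\mathcal P)=-(\mathcal Q)+t\,\frac{M_2(\nu_1)}{2}-(t-1)\sum_k\lambda_0^k\frac{M_2(\nu_0^k)}{2}.$$ Moreover, $X\in L^2$ solves the lifted problem $$\inf_{X\in L^2}\Big\{\tfrac12\|X\|_{L^2}^2-t\langle X,Y\rangle_{L^2}+(t-1)\sum_k\lambda_0^kF_{\nu_0^k}(X)\Big\}$$ if and only if $$X=tY-(t-1)\sum_k\lambda_0^kZ^k,$$ where $Z^k_\#P\preceq_C\nu_0^k$ for all $k=1,\dots,K$ and $(Z^k)_k$ solves $(\mathcal Q)$.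
   Context: $(\Omega,\mathcal F,P)$ is a fixed atomless, separable probability space and $L^2=L^2(\Omega,\mathcal F,P;\mathbb R^d)$ (a separable Hilbert space; every $\mu\in\mathcal P_2(\mathbb R^d)$ is the law of some $X\in L^2$). $X\sim\mu$ means $X_\#P=\mu$. $\mathcal P_2(\mathbb R^d)$ is the set of probability measures on $\mathbb R^d$ with finite second moment, $M_2(\mu)=\int|x|^2\,\mathrm d\mu$, and $W_2$ is the 2-Wasserstein distance. $\mu\preceq_C\nu$ (convex order) means $\int\varphi\,\mathrm d\mu\le\int\varphi\,\mathrm d\nu$ for all convex $\varphi:\mathbb R^d\to\mathbb R$. For $\nu\in\mathcal P_2(\mathbb R^d)$ and $X\in L^2$, $F_\nu(X):=\sup\{\mathbb E[\langle X,Y'\rangle]: Y'\in L^2,\ Y'\sim\nu\}$, which equals the maximum covariance $\sup\{\mathbb E[\langle X',Y'\rangle]: X'\sim X_\#P,\ Y'\sim\nu\}$. *)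

(* Defs.v *)
From HB Require Import structures.
From mathcomp Require Import all_boot all_order all_algebra.
From mathcomp Require Import all_classical all_reals all_analysis.

Set Implicit Arguments.
Unset Strict Implicit.
Unset Printing Implicit Defensive.

Import Order.TTheory GRing.Theory Num.Theory.
Import numFieldNormedType.Exports.

Local Open Scope classical_set_scope.
Local Open Scope ring_scope.

(* 'rV[R]_d carries its Borel sigma-algebra.  The topology of MathComp-Analysis
   on 'rV[R]_d comes from the sup norm, hence is the usual one. *)
HB.instance Definition _ (R : realType) (d : nat) :=
  Measurable.copy 'rV[R]_d (g_sigma_algebraType (@open 'rV[R]_d)).

Section Euclidean.
Context {R : realType} {d : nat}.

Definition edot (x y : 'rV[R]_d) : R := \sum_(i < d) x ord0 i * y ord0 i.

(* Not `|x|, which is the sup norm on 'rV[R]_d. *)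
Definition enorm (x : 'rV[R]_d) : R := Num.sqrt (edot x x).

End Euclidean.

Section ProbabilitySpace.
Context {disp : measure_display} {Omega : measurableType disp} {R : realType}.
Variable P : probability Omega R.
Local Open Scope ereal_scope.

Definition atomless :=
  forall A, measurable A -> 0 < P A ->
    exists B, [/\ measurable B, B `<=` A & 0 < P B < P A].

(* Separability of the measure algebra, i.e. of the pseudometric
   (A, B) |-> P (A symmetric-difference B) on the sigma-algebra. *)
Definition separable_probability :=
  exists D : (set Omega)^nat,
    (forall n, measurable (D n)) /\
    (forall A (e : R), measurable A -> (0 < e)%R ->
       exists n, P ((A `\` D n) `|` (D n `\` A)) < e%:E).

End ProbabilitySpace.

Section Wasserstein.
Context {R : realType} {d : nat}.
Local Open Scope ereal_scope.
Implicit Types mu nu : probability 'rV[R]_d R.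

Definition M2 mu : \bar R := \int[mu]_x (enorm x ^+ 2)%:E.

Definition P2 : set (probability 'rV[R]_d R) := [set mu | M2 mu < +oo].

Definition coupling mu nu : set (probability ('rV[R]_d * 'rV[R]_d)%type R) :=
  [set g | forall A, measurable A ->
             g (A `*` setT) = mu A /\ g (setT `*` A) = nu A].

Definition W2 mu nu : \bar R :=
  sqrte (ereal_inf [set \int[g]_z (enorm (z.1 - z.2) ^+ 2)%:E
                   | g in coupling mu nu]).

(* For mu and nu with finite first moment both integrals are well defined, with
   values in ]-oo, +oo], since a convex function has an affine minorant. *)
Definition convex_order mu nu :=
  forall phi : 'rV[R]_d -> R^o, convex_function setT phi ->
    \int[mu]_x (phi x)%:E <= \int[nu]_x (phi x)%:E.

End Wasserstein.

Section L2.
Context {disp : measure_display} {Omega : measurableType disp} {R : realType}.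
Context {d : nat}.
Variable P : probability Omega R.
Local Open Scope ereal_scope.
Implicit Types X Y : Omega -> 'rV[R]_d.

Definition L2norm X : \bar R := 'N[P]_2%:E[(fun w => (enorm (X w))%:E)].

Definition L2dot X Y : \bar R := 'E_P[(fun w => edot (X w) (Y w))].

(* Elements of L^2 are handled through representatives: equality in L^2 is
   equality almost everywhere. *)
Definition L2 : set {RV P >-> 'rV[R]_d} := [set X | L2norm X < +oo].

(* Measures are only compared on measurable sets, their values on other sets
   being arbitrary. *)
Definition has_law (X : {RV P >-> 'rV[R]_d}) (mu : probability 'rV[R]_d R) :=
  forall A, measurable A -> distribution P X A = mu A.

Definition F (nu : probability 'rV[R]_d R) X : \bar R :=
  ereal_sup [set L2dot X Y' | Y' in [set Y' | L2 Y' /\ has_law Y' nu]].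

End L2.

Definition is_minimizer {T : Type} {R : realType} (A : set T) (f : T -> \bar R)
    (x : T) :=
  A x /\ (forall y, A y -> (f x <= f y)%E).

Section Problems.
Context {disp : measure_display} {Omega : measurableType disp} {R : realType}.
Context {d K : nat}.
Variable P : probability Omega R.
Variables (t : R) (lambda0 : 'I_K -> R).
Local Open Scope ereal_scope.

Definition primal_value (nu1 : probability 'rV[R]_d R)
    (nu0 : 'I_K -> probability 'rV[R]_d R) : \bar R :=
  ereal_inf [set t%:E * (W2 mu nu1 ^+ 2 / 2%:E)
                 - (t - 1)%:E * \sum_(k < K) (lambda0 k)%:E
                                   * (W2 mu (nu0 k) ^+ 2 / 2%:E)
            | mu in P2].

Definition residual (Y : Omega -> 'rV[R]_d) (Z : 'I_K -> Omega -> 'rV[R]_d) :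
    Omega -> 'rV[R]_d :=
  fun w => (t *: Y w - (t - 1) *: \sum_(k < K) lambda0 k *: Z k w)%R.

Definition dual_feasible (nu0 : 'I_K -> probability 'rV[R]_d R) :
    set ('I_K -> {RV P >-> 'rV[R]_d}) :=
  [set Z | forall k, L2 (Z k) /\ convex_order (distribution P (Z k)) (nu0 k)].

Definition dual_objective (Y : Omega -> 'rV[R]_d)
    (Z : 'I_K -> {RV P >-> 'rV[R]_d}) : \bar R :=
  L2norm P (residual Y (fun k => Z k)) ^+ 2 / 2%:E.

Definition dual_value (Y : Omega -> 'rV[R]_d)
    (nu0 : 'I_K -> probability 'rV[R]_d R) : \bar R :=
  ereal_inf [set dual_objective Y Z | Z in dual_feasible nu0].

Definition lifted_objective (Y : Omega -> 'rV[R]_d)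
    (nu0 : 'I_K -> probability 'rV[R]_d R) (X : {RV P >-> 'rV[R]_d}) : \bar R :=
  L2norm P X ^+ 2 / 2%:E - t%:E * L2dot P X Y
  + (t - 1)%:E * \sum_(k < K) (lambda0 k)%:E * F P (nu0 k) X.

End Problems.

(* Main.v *)
(* Let [law_hull nu] be the closed convex hull of the random vectors of law
   [nu], whose support function is [F nu].  It consists of the [Z] whose law is
   below [nu] in convex order (a variant of Strassen's theorem).  The inclusion
   that needs work is obtained, for [X] with finitely many values, from the
   semidiscrete optimal transport problem with entropic smoothing: a stationary
   point of its dual is a softmax density that an atomless space can realize;
   large multiples of [X] make the smoothing error negligible, and quantization
   gives the general case.  The same bound shows that the couplings of [mu] and
   [nu] do not beat the pairs [(X, Y)] on [Omega] with [X] fixed of law [mu], so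
   that [W2 mu nu ^+ 2 = M2 mu + M2 nu - 2 F nu X], and the primal problem is
   the lifted one up to a constant.

   (Q) projects the origin on a convex set of residuals.  If [V] is its
   solution, the variational inequality says that the lifted objective equals
   [- |V|^2 / 2] at [V], whereas its value at any [X] is at least
   [|X|^2 / 2 - <X, V> = |X - V|^2 / 2 - |V|^2 / 2]. *)
Require Import Defs.
From HB Require Import structures.
From mathcomp Require Import all_boot all_order all_algebra.
From mathcomp Require Import all_classical all_reals all_analysis.
From mathcomp Require Import measurable_realfun ring lra.

Set Implicit Arguments.
Unset Strict Implicit.
Unset Printing Implicit Defensive.

Import Order.TTheory GRing.Theory Num.Theory.
Import numFieldNormedType.Exports.

Local Open Scope classical_set_scope.
Local Open Scope ring_scope.

(** * Square-integrable random vectors *)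

(** The obstacle is that [X] is fixed: it may generate the whole sigma-algebra of [Omega], so an
    optimal coupling of its law with [nu] that splits mass need not come from a pair [(X, Y)], and
    suprema such as [F nu X] need not be attained. Hence the error [e] in the statements on [Omega].
    The level sets of a finite-valued approximation of [X], on the contrary, can be split at will.
    Splitting along the cells of the unsmoothed dual would require breaking ties where [nu] charges
    the boundaries of cells; softmax weights share the mass there, and stationarity prescribes their
    integrals exactly. Convex order is handled through finite maxima of affine functions, which are
    integrable under every law with finite second moment and are the functions that the potentials
    of the semidiscrete problem produce. [transport_bound] compares [(X, Y)] with a pair [(U, V)] on
    any probability space, [U] with the law of [X] and [V] below [nu] on such maxima. The pair can
    be [X] with a candidate of the dual, the two projections of a coupling, or a pair on [Omega]
    with the two laws exchanged. *)

Section RowVectors.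
Context {R : realType} {d : nat}.
Implicit Types x y : 'rV[R]_d.

Lemma measurable_open (U : set 'rV[R]_d) : open U -> measurable U.
Proof. by move=> oU; apply: sub_sigma_algebra. Qed.

Lemma measurable_coord (i : 'I_d) :
  measurable_fun setT (fun x : 'rV[R]_d => x ord0 i).
Proof.
apply: (measurability _ (RGenOInfty.measurableE R)) => _ [_ [a ->] <-].
rewrite setTI; apply: measurable_open.
by apply: open_comp (@interval_open _ _ _ _ _) => // x _; exact: coord_continuous.
Qed.

(** An open set is a countable union of open boxes with rational corners, and the preimage of a box
    is a finite intersection of preimages of intervals. *)
Lemma measurable_fun_rV disp (T : measurableType disp) (f : T -> 'rV[R]_d) :
  (forall i, measurable_fun setT (fun w => f w ord0 i)) -> measurable_fun setT f.
Proof.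
move=> mf; apply: (@measurability _ _ _ _ _ _ (@open 'rV[R]_d)) => //.
move=> _ [U oU <-]; rewrite setTI.
pose box (p : 'rV[rat * rat]_d) : set 'rV[R]_d :=
  [set x | forall i, ratr (p ord0 i).1 < x ord0 i < ratr (p ord0 i).2].
(* A box that leaves [U] is replaced by the empty set, so that the union runs over a countable
   type. *)
pose A (p : 'rV[rat * rat]_d) : set T :=
  if `[< box p `<=` U >] then f @^-1` box p else set0.
have -> : f @^-1` U = \bigcup_p A p.
  apply/seteqP; split=> [w Uw|w [p _]]; last first.
    by rewrite /A; case: asboolP => // pU /pU.
  have /= [e e0 eU] := (iffLR (nbhs_ballP _ _) (open_nbhs_nbhs (conj oU Uw))).
  have ex i : exists p : rat * rat,
      f w ord0 i - e < ratr p.1 < f w ord0 i /\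
      f w ord0 i < ratr p.2 < f w ord0 i + e.
    have [|p hp] := @rat_in_itvoo R (f w ord0 i - e) (f w ord0 i).
      by rewrite gtrBl.
    have [|q hq] := @rat_in_itvoo R (f w ord0 i) (f w ord0 i + e).
      by rewrite ltrDl.
    by exists (p, q); move: hp hq; rewrite !in_itv.
  have [g hg] := choice ex.
  exists (\row_i g i) => //; rewrite /A; case: asboolP => [_|].
    by move=> i /=; rewrite mxE; have [/andP[_ ->] /andP[->]] := hg i.
  case=> x bx; apply: eU; split=> // i j; rewrite (ord1 i).
  have := bx j; rewrite mxE; have [/andP[? ?] /andP[? ?]] := hg j => /andP[? ?].
  by rewrite /ball /= ltr_norml; apply/andP; split; lra.
apply: countable_bigcupT_measurable => [|p]; first exact: countableP.
rewrite /A; case: asboolP => // _.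
have -> : f @^-1` box p = \bigcap_(i in setT)
    ((fun w => f w ord0 i) @^-1` `]ratr (p ord0 i).1, ratr (p ord0 i).2[%classic).
  apply/seteqP; split=> w h i; first by move=> _; rewrite /= in_itv /=; exact: h.
  by have := h i I; rewrite /= in_itv.
apply: fin_bigcap_measurable => [|i _]; first exact: finite_finset.
by rewrite -[X in measurable X]setTI; exact: mf.
Qed.

Lemma measurable_fun_coord disp (T : measurableType disp) (f : T -> 'rV[R]_d) i :
  measurable_fun setT f -> measurable_fun setT (fun w => f w ord0 i).
Proof. exact: measurableT_comp (measurable_coord i). Qed.

Lemma measurable_edot disp (T : measurableType disp) (f g : T -> 'rV[R]_d) :
  measurable_fun setT f -> measurable_fun setT g ->
  measurable_fun setT (fun w => edot (f w) (g w)).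
Proof.
move=> mf mg; apply: measurable_sum => i.
by apply: measurable_funM; exact: measurable_fun_coord.
Qed.

Lemma measurable_lincomb disp (T : measurableType disp) (f g : T -> 'rV[R]_d) a b :
  measurable_fun setT f -> measurable_fun setT g ->
  measurable_fun setT (fun w => a *: f w + b *: g w).
Proof.
move=> mf mg; apply: measurable_fun_rV => i.
under eq_fun do rewrite !mxE.
by apply: measurable_funD; apply: measurable_funM => //; exact: measurable_fun_coord.
Qed.

Lemma edotC x y : edot x y = edot y x.
Proof. by apply: eq_bigr => i _; rewrite mulrC. Qed.

Lemma edotDl x y z : edot (x + y) z = edot x z + edot y z.
Proof. by rewrite /edot -big_split; apply: eq_bigr => i _; rewrite mxE mulrDl. Qed.

Lemma edotZl a x y : edot (a *: x) y = a * edot x y.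
Proof. by rewrite /edot mulr_sumr; apply: eq_bigr => i _; rewrite mxE mulrA. Qed.

Lemma edotDr x y z : edot z (x + y) = edot z x + edot z y.
Proof. by rewrite edotC edotDl !(edotC _ z). Qed.

Lemma edotZr a x y : edot x (a *: y) = a * edot x y.
Proof. by rewrite edotC edotZl edotC. Qed.

Lemma edotNl x y : edot (- x) y = - edot x y.
Proof. by rewrite -scaleN1r edotZl mulN1r. Qed.

Lemma edotBl x y z : edot (x - y) z = edot x z - edot y z.
Proof. by rewrite edotDl edotNl. Qed.

Lemma edotBr x y z : edot z (x - y) = edot z x - edot z y.
Proof. by rewrite edotC edotBl !(edotC _ z). Qed.

Lemma edot0l x : edot 0 x = 0.
Proof. by rewrite -[0](scale0r 0) edotZl mul0r. Qed.

Lemma edot_ge0 x : 0 <= edot x x.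
Proof. by apply: sumr_ge0 => i _; rewrite -expr2 sqr_ge0. Qed.

Lemma edot_eq0 x : (edot x x == 0) = (x == 0).
Proof.
apply/idP/eqP => [|->]; last by rewrite edot0l.
rewrite psumr_eq0 => [/allP h|i _]; last by rewrite -expr2 sqr_ge0.
apply/rowP => i; rewrite mxE; have := h i (mem_index_enum i).
by rewrite -expr2 sqrf_eq0 => /eqP.
Qed.

Lemma enorm_sqr x : enorm x ^+ 2 = edot x x.
Proof. by rewrite sqr_sqrtr // edot_ge0. Qed.

Lemma normr_edot_le x y : `|edot x y| <= (edot x x + edot y y) / 2.
Proof.
have := edot_ge0 (x + y); have := edot_ge0 (x - y).
rewrite edotBl !edotBr !edotDl !edotDr (edotC y x) => h1 h2.
by rewrite ler_norml; apply/andP; split; lra.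
Qed.

Lemma edotD_le x y : edot (x + y) (x + y) <= 2 * edot x x + 2 * edot y y.
Proof.
have := edot_ge0 (x - y).
by rewrite edotBl !edotBr !edotDl !edotDr (edotC y x) => h1; lra.
Qed.

End RowVectors.
Lemma integrable_le disp (T : measurableType disp) (R : realType)
    (P : {measure set T -> \bar R}) (f g : T -> R) :
  measurable_fun setT f -> (forall w, `|f w| <= g w) ->
  P.-integrable setT (EFin \o g) -> P.-integrable setT (EFin \o f).
Proof.
move=> mf fg; apply: le_integrable => //; first exact/measurable_EFinP.
by move=> w _ /=; rewrite lee_fin (le_trans (fg w))// ler_norm.
Qed.

Lemma Rintegral_cst1 disp (T : measurableType disp) (R : realType)
    (P : probability T R) (c : R) : \int[P]_w c = c.
Proof.
transitivity (c * fine (P setT)); first exact: Rintegral_cst.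
by rewrite probability_setT mulr1.
Qed.

Section RealIntegrable.
Context {disp : measure_display} {T : measurableType disp} {R : realType}.
Variable P : {measure set T -> \bar R}.
Implicit Types f g : T -> R.

Lemma EFin_integrableD f g :
  P.-integrable setT (EFin \o f) -> P.-integrable setT (EFin \o g) ->
  P.-integrable setT (EFin \o (fun w => f w + g w)).
Proof. by move=> iF iG; exact: (integrableD measurableT iF iG). Qed.

Lemma EFin_integrableZ a f : P.-integrable setT (EFin \o f) ->
  P.-integrable setT (EFin \o (fun w => a * f w)).
Proof. by move=> iF; exact: (integrableZl measurableT a iF). Qed.

Lemma EFin_integrableB f g :
  P.-integrable setT (EFin \o f) -> P.-integrable setT (EFin \o g) ->
  P.-integrable setT (EFin \o (fun w => f w - g w)).
Proof. by move=> iF iG; exact: (integrableB measurableT iF iG). Qed.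

Lemma EFin_integrable_sum (I : Type) (r : seq I) (h : I -> T -> R) :
  (forall i, P.-integrable setT (EFin \o h i)) ->
  P.-integrable setT (EFin \o (fun w => \sum_(i <- r) h i w)).
Proof.
move=> ih; rewrite (_ : _ \o _ = fun w => \sum_(i <- r) (h i w)%:E)%E.
  by apply: integrable_sum => // i _; exact: ih.
by apply/funext => w /=; rewrite sumEFin.
Qed.

Lemma EFin_integrableM (f h : T -> R) : measurable_fun setT h -> (forall w, 0 <= h w <= 1) ->
  P.-integrable setT (EFin \o f) ->
  P.-integrable setT (EFin \o (fun w => h w * f w)).
Proof.
move=> mh h01 intf; apply: (@integrable_le _ _ _ _ _ (fun w => `|f w|)).
- apply: measurable_funM => //; exact/measurable_EFinP/(measurable_int _ intf).
- move=> w; have /andP[h0 h1] := h01 w.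
  by rewrite normrM ger0_norm// ler_piMl.
- exact: integrable_norm.
Qed.

Lemma Rintegral_sum (I : Type) (r : seq I) (h : I -> T -> R) :
  (forall i, P.-integrable setT (EFin \o h i)) ->
  \int[P]_w (\sum_(i <- r) h i w) = \sum_(i <- r) \int[P]_w h i w.
Proof.
move=> ih; elim: r => [|i r IH].
  rewrite big_nil -[RHS](mul0r (fine (P setT))) -Rintegral_cst//.
  by apply: eq_Rintegral => w _; rewrite big_nil.
rewrite big_cons -IH -RintegralD//; last exact: EFin_integrable_sum.
by apply: eq_Rintegral => w _; rewrite big_cons.
Qed.

Lemma EFin_Rintegral f : P.-integrable setT (EFin \o f) ->
  (\int[P]_w f w)%:E = (\int[P]_w (f w)%:E)%E.
Proof. by move=> iF; rewrite /Rintegral fineK//; exact: integrable_fin_num. Qed.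

End RealIntegrable.

Section SquareIntegrable.
Context {disp : measure_display} {T : measurableType disp} {R : realType}.
Context {d : nat} (P : probability T R).
Implicit Types X Y Z : T -> 'rV[R]_d.

(** On bare functions rather than random variables, so that the pointwise operations of the function
    type serve as the vector space structure. *)
Definition sqint X := measurable_fun setT X /\
  P.-integrable setT (EFin \o (fun w => edot (X w) (X w))).

Definition ip X Y : R := \int[P]_w edot (X w) (Y w).

Lemma integrable_edot X Y : sqint X -> sqint Y ->
  P.-integrable setT (EFin \o (fun w => edot (X w) (Y w))).
Proof.
move=> [mX iX] [mY iY].
apply: (@integrable_le _ _ _ _ _ (fun w => edot (X w) (X w) + edot (Y w) (Y w))).
- exact: measurable_edot.
- move=> w; apply: le_trans (normr_edot_le _ _) _.
  have := edot_ge0 (X w); have := edot_ge0 (Y w) => *; lra.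
- exact: EFin_integrableD.
Qed.

Lemma sqintD X Y : sqint X -> sqint Y -> sqint (X + Y).
Proof.
move=> [mX iX] [mY iY].
have mXY : measurable_fun setT (X + Y).
  rewrite (_ : X + Y = fun w => 1 *: X w + 1 *: Y w); first exact: measurable_lincomb.
  by apply/funext => w; rewrite !scale1r.
split => //; apply: (@integrable_le _ _ _ _ _
    (fun w => 2 * edot (X w) (X w) + 2 * edot (Y w) (Y w))).
- exact: measurable_edot.
- by move=> w; rewrite ger0_norm ?edot_ge0// edotD_le.
- by apply: EFin_integrableD; exact: EFin_integrableZ.
Qed.

Lemma sqintZ a X : sqint X -> sqint (a *: X).
Proof.
move=> [mX iX].
have mZ : measurable_fun setT (a *: X).
  rewrite (_ : a *: X = fun w => a *: X w + 0 *: X w); first exact: measurable_lincomb.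
  by apply/funext => w; rewrite scale0r addr0.
split => //; apply: (@integrable_le _ _ _ _ _ (fun w => a ^+ 2 * edot (X w) (X w))).
- exact: measurable_edot.
- move=> w; rewrite ger0_norm ?edot_ge0// [edot _ _]edotZl edotZr mulrA -expr2.
  exact: lexx.
- exact: EFin_integrableZ.
Qed.

Lemma sqintN X : sqint X -> sqint (- X).
Proof. by rewrite -scaleN1r; exact: sqintZ. Qed.

Lemma sqintB X Y : sqint X -> sqint Y -> sqint (X - Y).
Proof. by move=> iX iY; apply: sqintD => //; exact: sqintN. Qed.

Lemma sqint0 : sqint 0.
Proof.
split; first exact: measurable_cst.
under [X in EFin \o X]eq_fun do rewrite edot0l.
exact: integrable0.
Qed.

Lemma sqint_cst (v : 'rV[R]_d) : sqint (cst v).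
Proof.
split; first exact: measurable_cst.
exact: (finite_measure_integrable_cst P (edot v v)).
Qed.

Lemma sqint_sum (I : Type) (r : seq I) (F : I -> T -> 'rV[R]_d) :
  (forall k, sqint (F k)) -> sqint (\sum_(k <- r) F k).
Proof.
by move=> iF; elim/big_rec: _ => [|k a _]; [exact: sqint0|apply: sqintD].
Qed.

Lemma ipC X Y : ip X Y = ip Y X.
Proof. by apply: eq_Rintegral => w _; rewrite edotC. Qed.

Lemma ipDl X Y Z : sqint X -> sqint Y -> sqint Z ->
  ip (X + Y) Z = ip X Z + ip Y Z.
Proof.
move=> iX iY iZ; rewrite /ip -RintegralD//; try exact: integrable_edot.
by apply: eq_Rintegral => w _; rewrite edotDl.
Qed.

Lemma ipZl a X Y : sqint X -> sqint Y -> ip (a *: X) Y = a * ip X Y.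
Proof.
move=> iX iY; rewrite /ip -RintegralZl//; try exact: integrable_edot.
by apply: eq_Rintegral => w _; rewrite edotZl.
Qed.

Lemma ipNl X Y : sqint X -> sqint Y -> ip (- X) Y = - ip X Y.
Proof. by move=> iX iY; rewrite -scaleN1r ipZl// mulN1r. Qed.

Lemma ipBl X Y Z : sqint X -> sqint Y -> sqint Z ->
  ip (X - Y) Z = ip X Z - ip Y Z.
Proof. by move=> iX iY iZ; rewrite ipDl// ?ipNl//; exact: sqintN. Qed.

Lemma ipDr X Y Z : sqint X -> sqint Y -> sqint Z ->
  ip Z (X + Y) = ip Z X + ip Z Y.
Proof. by move=> iX iY iZ; rewrite ipC ipDl// !(ipC _ Z). Qed.

Lemma ipBr X Y Z : sqint X -> sqint Y -> sqint Z ->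
  ip Z (X - Y) = ip Z X - ip Z Y.
Proof. by move=> iX iY iZ; rewrite ipC ipBl// !(ipC _ Z). Qed.

Lemma ipZr a X Y : sqint X -> sqint Y -> ip X (a *: Y) = a * ip X Y.
Proof. by move=> iX iY; rewrite ipC ipZl// ipC. Qed.

Lemma ip0l X : ip 0 X = 0.
Proof.
rewrite /ip; under eq_Rintegral do rewrite edot0l.
by rewrite Rintegral_cst1.
Qed.

Lemma ip_suml (I : Type) (r : seq I) (F : I -> T -> 'rV[R]_d) Y :
  (forall k, sqint (F k)) -> sqint Y ->
  ip (\sum_(k <- r) F k) Y = \sum_(k <- r) ip (F k) Y.
Proof.
move=> iF iY; elim: r => [|k r IH]; first by rewrite !big_nil ip0l.
by rewrite !big_cons ipDl// ?IH//; exact: sqint_sum.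
Qed.

Lemma ip_ge0 X : 0 <= ip X X.
Proof. by apply: Rintegral_ge0 => w _; exact: edot_ge0. Qed.

Lemma ip_sqrB X Y : sqint X -> sqint Y ->
  ip (X - Y) (X - Y) = ip X X - 2 * ip X Y + ip Y Y.
Proof.
move=> iX iY; have iXY := sqintB iX iY.
by rewrite ipBl// !ipBr// (ipC Y X); lra.
Qed.

Lemma ip_sqrD X Y : sqint X -> sqint Y ->
  ip (X + Y) (X + Y) = ip X X + 2 * ip X Y + ip Y Y.
Proof.
move=> iX iY; have iXY := sqintD iX iY.
by rewrite ipDl// !ipDr// (ipC Y X); lra.
Qed.

Lemma ip_le X Y : sqint X -> sqint Y -> 2 * ip X Y <= ip X X + ip Y Y.
Proof.
by move=> iX iY; have := ip_ge0 (X - Y); rewrite ip_sqrB//; lra.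
Qed.

Lemma ip_CauchySchwarz X Y : sqint X -> sqint Y ->
  `|ip X Y| <= Num.sqrt (ip X X) * Num.sqrt (ip Y Y).
Proof.
move=> iX iY; rewrite -sqrtrM ?ip_ge0// -sqrtr_sqr ler_wsqrtr//.
have key c : 0 <= ip X X - 2 * c * ip X Y + c ^+ 2 * ip Y Y.
  have := ip_ge0 (X - c *: Y); have icY := sqintZ c iY.
  by rewrite ip_sqrB// !ipZr// ipZl//; nra.
have [Y0|Y0] := eqVneq (ip Y Y) 0.
  have [->|XY0] := eqVneq (ip X Y) 0; first by rewrite expr0n/= mulr_ge0// ip_ge0.
  (* When [ip Y Y = 0] the quadratic in [c] is affine; at this [c] it equals [-1]. *)
  have := key ((ip X X + 1) / (2 * ip X Y)).
  rewrite Y0 mulr0 addr0.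
  rewrite (_ : 2 * _ * _ = ip X X + 1); last by field.
  by lra.
have Ypos : 0 < ip Y Y by rewrite lt_neqAle eq_sym Y0 ip_ge0.
have := key (ip X Y / ip Y Y).
rewrite (_ : _ - _ + _ = (ip X X * ip Y Y - ip X Y ^+ 2) / ip Y Y); last by field.
by rewrite pmulr_lge0 ?invr_gt0//; lra.
Qed.

End SquareIntegrable.

(** * Completeness of the space of square-integrable vectors *)

Section Completeness.
Context {disp : measure_display} {T : measurableType disp} {R : realType}.
Context {d : nat} (P : probability T R).
Implicit Types X Y Z : T -> 'rV[R]_d.

(** Fatou's lemma for the squared norm. Applied to differences with a convergent subsequence, it
    gives at once the integrability of the limit and a rate. *)
Lemma ip_Fatou (Xs : nat -> T -> 'rV[R]_d) X (c : R) :
  (forall n, sqint P (Xs n)) -> measurable_fun setT X ->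
  {ae P, forall w, forall i, Xs n w ord0 i @[n --> \oo] --> X w ord0 i} ->
  (forall n, ip P (Xs n) (Xs n) <= c) ->
  sqint P X /\ ip P X X <= c.
Proof.
move=> iXs mX XsX le_c.
have mXs n : measurable_fun setT (fun w => (edot (Xs n w) (Xs n w))%:E).
  by apply/measurable_EFinP; apply: measurable_edot; case: (iXs n).
have mXX : measurable_fun setT (fun w => (edot (X w) (X w))%:E).
  by apply/measurable_EFinP; apply: measurable_edot.
have le : (\int[P]_w (edot (X w) (X w))%:E <= c%:E)%E.
  have -> : (\int[P]_w (edot (X w) (X w))%:E =
             \int[P]_w limn_einf (fun n => (edot (Xs n w) (Xs n w))%:E))%E.
    apply: ae_eq_integral => //.
      under eq_fun do rewrite -[limn_einf _]oppeK -limn_esupN.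
      apply: measurableT_comp => //; apply: measurable_fun_limn_esup => n.
      exact: measurableT_comp.
    apply: filterS XsX => w /= cvgX _.
    apply/esym; apply: (fun h => (cvg_limn_einf_sup h).1).
    apply/cvg_EFin; first by near=> n.
    rewrite /edot; apply: (@cvg_big _ _ _ 0 predT _ _ _ (index_enum 'I_d)
      (fun i n => Xs n w ord0 i * Xs n w ord0 i)) => [|i _]; first exact: add_continuous.
    by apply: cvgM; exact: cvgX.
  apply: le_trans (fatou _ _ _ _) _ => // [n w _|]; first by rewrite lee_fin edot_ge0.
  rewrite limn_einf_lim; apply: lime_le; first exact: is_cvg_einfs.
  near=> n; apply: (@le_trans _ _ (\int[P]_w (edot (Xs n w) (Xs n w))%:E)%E).
    by apply: ereal_inf_lbound; exists n => /=.
  by rewrite -EFin_Rintegral ?lee_fin ?le_c//; case: (iXs n).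
have iX : P.-integrable setT (EFin \o (fun w => edot (X w) (X w))).
  apply/integrableP; split => //.
  under eq_integral do rewrite /= ger0_norm ?edot_ge0//.
  exact: le_lt_trans le (ltry _).
by split => //; rewrite -lee_fin EFin_Rintegral.
Unshelve. all: by end_near.
Qed.

Lemma sqint_complete (Xs : nat -> T -> 'rV[R]_d) :
  (forall n, sqint P (Xs n)) ->
  (forall e, 0 < e -> exists N, forall n m, (N <= n)%N -> (N <= m)%N ->
     ip P (Xs n - Xs m) (Xs n - Xs m) <= e) ->
  exists X, sqint P X /\
    forall e, 0 < e -> exists N, forall n, (N <= n)%N ->
      ip P (Xs n - X) (Xs n - X) <= e.
Proof.
move=> iXs cauchy.
(* A subsequence with [ip]-increments at most [4^-j] converges a.e.; its
   pointwise limsup is measurable, hence a usable limit. *)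
pose q : R := 4^-1.
have q0 j : 0 < q ^+ j by rewrite exprn_gt0 // invr_gt0.
have [N hN] := choice (fun j => cauchy _ (q0 j)).
(* Partial sums of [N] are nondecreasing and at least [N j]. *)
pose k j := (\sum_(i < j.+1) N i)%N.
have Nk j : (N j <= k j)%N by rewrite /k big_ord_recr leq_addl.
have kS j : (k j <= k j.+1)%N by rewrite /k [leqRHS]big_ord_recr leq_addr.
have kmono : {homo k : a b / (a <= b)%N} by exact: homo_leq leqnn leq_trans kS.
pose D j := Xs (k j.+1) - Xs (k j).
have iD j : sqint P (D j) by exact: sqintB.
(* By the arithmetic-geometric inequality, [a j w] dominates the absolute values of the coordinates
   of [D j w]. The weight [2 ^+ j] trades the bound [q ^+ j] on squares for a summable bound on
   increments. *)
pose a j w := 2 ^+ j * edot (D j w) (D j w) + 2^-1 ^+ j.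
have p2 j : 0 < 2 ^+ j :> R by rewrite exprn_gt0.
have h2 j : 0 < 2^-1 ^+ j :> R by rewrite exprn_gt0// invr_gt0.
have a0 j w : 0 <= a j w by rewrite addr_ge0// ?mulr_ge0// ?edot_ge0// ltW.
have ia j : P.-integrable setT (EFin \o a j).
  apply: EFin_integrableD; first by apply: EFin_integrableZ; case: (iD j).
  exact: finite_measure_integrable_cst.
have mEa j : measurable_fun setT (EFin \o a j) by exact: measurable_int (ia j).
have Ia j : \int[P]_w a j w <= 2 * 2^-1 ^+ j.
  rewrite RintegralD//; last 2 first.
  - by apply: EFin_integrableZ; case: (iD j).
  - exact: finite_measure_integrable_cst.
  rewrite Rintegral_cst1 RintegralZl//; last by case: (iD j).
  have : 2 ^+ j * ip P (D j) (D j) <= 2 ^+ j * q ^+ j.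
    by rewrite ler_pM2l// hN// (leq_trans (Nk j)).
  rewrite -exprMn (_ : 2 * q = 2^-1); last by rewrite /q; lra.
  rewrite /ip; lra.
have cvga : {ae P, forall w, (\sum_(0 <= j <oo) (a j w)%:E < +oo)%E}.
  have lty : (\int[P]_w \sum_(0 <= j <oo) (a j w)%:E < +oo)%E.
    rewrite integral_nneseries//; last by move=> *; rewrite lee_fin.
    apply: le_lt_trans (ltry (4 : R)).
    (* With the constant [4], the terms [4 / 2 ^ j.+1] are exactly [2 * 2^-1 ^+ j]. *)
    apply: le_trans (epsilon_trick0 predT (ler0n R 4)).
    apply: lee_nneseries => [j _ _|j _].
      by rewrite integral_ge0// => w _; rewrite lee_fin.
    rewrite -EFin_Rintegral// lee_fin (le_trans (Ia j))//.
    by rewrite natrX exprS exprVn le_eqVlt; apply/orP; left; apply/eqP; field; exact: lt0r_neq0.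
  have a_ge0 w : (0 <= \sum_(0 <= j <oo) (a j w)%:E)%E.
    by apply: nneseries_ge0 => *; rewrite lee_fin.
  have : P.-integrable setT (fun w => \sum_(0 <= j <oo) (a j w)%:E)%E.
    apply/integrableP; split.
      apply: (@ge0_emeasurable_sum _ _ _ _ _ predT) => [j w _ _|j _]; last exact: mEa.
      by rewrite lee_fin.
    by under eq_integral do rewrite gee0_abs//.
  move/(integrable_ae measurableT); apply: filterS => w /(_ I).
  by rewrite ge0_fin_numE.
pose X w : 'rV[R]_d := \row_i fine (limn_esup (fun j => (Xs (k j) w ord0 i)%:E)).
have mX : measurable_fun setT X.
  apply: measurable_fun_rV => i; under eq_fun do rewrite mxE.
  apply: measurableT_comp => //; apply: measurable_fun_limn_esup => j.
  by apply/measurable_EFinP/measurable_fun_coord; case: (iXs (k j)).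
have cvgX : {ae P, forall w, forall i, Xs (k j) w ord0 i @[j --> \oo] --> X w ord0 i}.
  apply: filterS cvga => w wa i.
  have : cvgn (series (fun j => D j w ord0 i)).
    apply: normed_cvg; apply: (@series_le_cvg _ _ (fun j => a j w)).
    - by move=> j; exact: normr_ge0.
    - by [].
    - move=> j; rewrite /=.
      rewrite /a.
      have : (D j w ord0 i) ^+ 2 <= edot (D j w) (D j w).
        rewrite /edot (bigD1 i)//= -expr2 lerDl; apply: sumr_ge0 => l _.
        by rewrite -expr2 sqr_ge0.
      rewrite -(ler_pM2l (p2 j)).
      have := sqr_ge0 (`|D j w ord0 i| - 2^-1 ^+ j).
      rewrite -(pmulr_rge0 _ (p2 j)) sqrrB real_normK ?num_real//.
      have -> : 2 ^+ j * (D j w ord0 i ^+ 2 - `|D j w ord0 i| * 2^-1 ^+ j *+ 2 + 2^-1 ^+ j ^+ 2) =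
          2 ^+ j * D j w ord0 i ^+ 2 - 2 * `|D j w ord0 i| + 2^-1 ^+ j.
        by rewrite exprVn; field; exact: lt0r_neq0.
      have := normr_ge0 (D j w ord0 i); lra.
    - by apply: nnseries_is_cvg.
  rewrite (_ : series _ = fun j => Xs (k j) w ord0 i - Xs (k 0%N) w ord0 i); last first.
    rewrite -[RHS](telescopeK (fun j => Xs (k j) w ord0 i)); congr series.
    by apply/funext => j; rewrite /D !mxE.
  move=> c; have {c} : cvgn (fun j => Xs (k j) w ord0 i).
    rewrite (_ : (fun j => _) = (fun j => Xs (k j) w ord0 i - Xs (k 0%N) w ord0 i) +
        cst (Xs (k 0%N) w ord0 i)); first by apply: is_cvgD => //; exact: is_cvg_cst.
    by apply/funext => j /=; rewrite fctE subrK.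
  move=> /cvg_ex[l cl]; suff -> : X w ord0 i = l by [].
  rewrite mxE (_ : limn_esup _ = l%:E)//.
  by apply: (fun h => (cvg_limn_einf_sup h).2); apply/cvg_EFin => //; near=> j.
have main j n : (k j <= n)%N ->
    sqint P (Xs n - X) /\ ip P (Xs n - X) (Xs n - X) <= q ^+ j.
  (* The indices [k (l + j)] stay beyond [N j], so the bound [q ^+ j] holds for all [l] and passes
     to the limit. *)
  move=> kn; apply: (@ip_Fatou (fun l => Xs n - Xs (k (l + j)%N))).
  - by move=> l; exact: sqintB.
  - rewrite (_ : _ - _ = fun w => 1 *: Xs n w + (- 1) *: X w).
      by apply: measurable_lincomb => //; case: (iXs n).
    by apply/funext => w; rewrite scale1r scaleN1r.
  - apply: filterS cvgX => w wX i.
    under eq_fun do rewrite !mxE.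
    rewrite !mxE; apply: cvgB; first exact: cvg_cst.
    by have := wX i; rewrite /X !mxE -(cvg_shiftn j).
  - move=> l; apply: hN; first exact: leq_trans kn.
    exact: leq_trans (kmono _ _ (leq_addl l j)).
exists X; split.
  have [h _] := main 0%N _ (leqnn _).
  by rewrite -[X](subKr (Xs (k 0%N))); apply: sqintB.
move=> e e0; have [M _ hM] := near_infty_natSinv_expn_lt (PosNum e0).
exists (k M) => n kn; apply: le_trans (main _ _ kn).2 _.
apply: le_trans (ltW (hM M (leqnn M))).
rewrite div1r -exprVn; apply: lerXn2r; rewrite ?nnegrE ?invr_ge0// /q; lra.
Unshelve. all: by end_near.
Qed.

End Completeness.

(** * Random vectors on an atomless space *)

Section Atomless.
Context {disp : measure_display} {T : measurableType disp} {R : realType}.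
Variable P : probability T R.
Hypothesis atP : atomless P.
Implicit Types A B C : set T.

Let p A : R := fine (P A).

Let PE A : measurable A -> P A = (p A)%:E.
Proof. by move=> mA; rewrite fineK// fin_num_measure. Qed.

Let p_ge0 A : 0 <= p A.
Proof. by rewrite fine_ge0. Qed.

Let p_le1 A : measurable A -> p A <= 1.
Proof. by move=> mA; rewrite -lee_fin -PE// probability_le1. Qed.

Let pD A B : measurable A -> measurable B -> B `<=` A -> p (A `\` B) = p A - p B.
Proof.
move=> mA mB BA; apply: EFin_inj; rewrite EFinB -!PE//; last exact: measurableD.
rewrite measureD//; last by rewrite -ge0_fin_numE ?fin_num_measure.
by rewrite setIidr.
Qed.

Let pU A B : measurable A -> measurable B -> A `&` B = set0 ->
  p (A `|` B) = p A + p B.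
Proof.
move=> mA mB AB; apply: EFin_inj; rewrite EFinD -!PE//; last exact: measurableU.
by rewrite measureU.
Qed.

Let p_le A B : measurable A -> measurable B -> A `<=` B -> p A <= p B.
Proof.
by move=> mA mB AB; rewrite -lee_fin -!PE// le_measure ?inE.
Qed.

(** The smaller part of a split has at most half the mass, and splitting can be repeated. *)
Lemma atomless_small A (e : R) : measurable A -> 0 < p A -> 0 < e ->
  exists B, [/\ measurable B, B `<=` A & 0 < p B <= e].
Proof.
move=> mA A0 e0.
have half C : measurable C -> 0 < p C ->
    exists B, [/\ measurable B, B `<=` C & 0 < p B <= p C / 2].
  move=> mC C0; have [|B [mB BC]] := atP mC; first by rewrite PE// lte_fin.
  rewrite !PE// !lte_fin => /andP[B0 BltC].
  have [Ble|Bgt] := leP (p B) (p C / 2); first by exists B; split => //; rewrite B0.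
  exists (C `\` B); split; [exact: measurableD|exact: subDsetl|].
  by rewrite pD//; apply/andP; split; lra.
have iter n : exists B, [/\ measurable B, B `<=` A & 0 < p B <= (2 ^+ n)^-1].
  elim: n => [|n [B [mB BA /andP[B0 Bn]]]].
    by exists A; split => //; rewrite A0 expr0 invr1 p_le1.
  have [C [mC CB /andP[C0 Cn]]] := half _ mB B0.
  exists C; split => //; first exact: subset_trans BA.
  rewrite C0 (le_trans Cn)// exprS invfM mulrC ler_pM2l// invr_gt0; lra.
have [n _ /(_ n (leqnn n)) /= hn] := near_infty_natSinv_expn_lt (PosNum e0).
have [B [mB BA /andP[B0 Bn]]] := iter n.
exists B; split => //; rewrite B0 (le_trans Bn)//.
by move: hn; rewrite div1r => /ltW.
Qed.

(** Sierpinski's theorem on the range of an atomless measure. *)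
Lemma atomless_subset A (q : R) : measurable A -> 0 <= q <= p A ->
  exists B, [/\ measurable B, B `<=` A & p B = q].
Proof.
move=> mA /andP[q0 qA].
(* Greedy exhaustion: each step adds an admissible set of at least half the
   supremum of the admissible probabilities. *)
pose adm B C := [/\ measurable C, C `<=` A `\` B & p B + p C <= q].
have greedy B : exists C, measurable B -> p B <= q ->
    adm B C /\ forall C', adm B C' -> p C' <= 2 * p C.
  have [[mB Bq]|nB] := pselect (measurable B /\ p B <= q); last first.
    by exists set0 => mB Bq; case: nB.
  pose S := [set p C | C in adm B].
  have adm0 : adm B set0 by split => //; rewrite /p measure0 addr0.
  have S0 : has_sup S.
    split; first by exists (p set0), set0.
    by exists 1 => _ [C [mC _ _] <-]; exact: p_le1.
  have [s0|s0] := leP (sup S) 0.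
    exists set0 => _ _; split=> // C' aC'.
    apply: le_trans (_ : sup S <= _); first by apply: sup_upper_bound => //; exists C'.
    by rewrite (le_trans s0)// mulr_ge0.
  have [_ [C aC <-] hC] := sup_adherent (divr_gt0 s0 (ltr0n R 2)) S0.
  exists C => _ _; split => // C' aC'.
  apply: le_trans (_ : sup S <= _); first by apply: sup_upper_bound => //; exists C'.
  lra.
have [f hf] := choice greedy.
pose F := fix F n := if n is m.+1 then F m `|` f (F m) else set0.
have FP n : [/\ measurable (F n), F n `<=` A & p (F n) <= q].
  elim: n => [|n [mF FA Fq]]; first by rewrite /= /p measure0; split.
  have [[mC CA Cq] _] := hf _ mF Fq; split => /=.
  - exact: measurableU.
  - by rewrite subUset; split => // w /CA[].
  - rewrite pU//; apply/seteqP; split => // w [Fw /CA[]]//.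
have mF n : measurable (F n) by case: (FP n).
have pF n : p (F n.+1) = p (F n) + p (f (F n)).
  have [_ FA Fq] := FP n; have [[mC CA Cq] _] := hf _ (mF n) Fq.
  by rewrite /= pU//; apply/seteqP; split => // w [Fw /CA[]].
pose B := \bigcup_n F n.
have mB : measurable B by exact: bigcupT_measurable.
have BA : B `<=` A by move=> w [n _]; case: (FP n) => _ FA _ /FA.
have cvgB : P \o F @ \oo --> P B.
  apply: nondecreasing_cvg_mu => //; apply/nondecreasing_seqP => n.
  by apply/subsetPset => w Fw; left.
have Bq : p B <= q.
  rewrite -lee_fin -PE// -(cvg_lim _ cvgB)//; apply: lime_le.
    by apply/cvg_ex; exists (P B).
  by near=> n; rewrite /= PE// lee_fin; case: (FP n).
exists B; split => //; apply/eqP; rewrite eq_le Bq leNgt; apply/negP => ltq.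
(* If the union fell short of [q], a set [C] of small positive mass would be admissible at every
   step, so every step would have added at least [p C / 2], which exceeds the total mass in the
   end. *)
have [|||C [mC CA /andP[C0 Cle]]] := @atomless_small (A `\` B) (q - p B).
- exact: measurableD.
- by rewrite pD//; lra.
- lra.
have Cf n : p C <= 2 * p (f (F n)).
  have [_ FA Fq] := FP n; have [_] := hf _ (mF n) Fq; apply; split => //.
    by move=> w /CA[Aw nB]; split => // Fw; apply: nB; exists n.
  have : p (F n) <= p B by apply: p_le => // w Fw; exists n.
  lra.
have lin n : n%:R * p C <= 2 * p (F n).
  elim: n => [|n IH]; first by rewrite mul0r mulr_ge0.
  by rewrite pF -natr1 mulrDl mul1r mulrDr lerD.
have [n hn] : exists n : nat, 2 < n%:R * p C.
  exists (Num.truncn (2 / p C)).+1.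
  by rewrite -ltr_pdivrMr// truncnS_gt// divr_ge0// ltW.
by have := lin n; have := p_le1 (mF n); lra.
Unshelve. all: by end_near.
Qed.

(** The conditions sit under the existential so that [choice] yields a total selector. *)
Lemma atomless_split A (q : R) : exists B, measurable A -> 0 <= q <= p A ->
  [/\ measurable B, B `<=` A & p B = q].
Proof.
have [[mA qA]|n] := pselect (measurable A /\ 0 <= q <= p A).
  by have [B hB] := atomless_subset mA qA; exists B.
by exists set0 => mA qA; case: n.
Qed.

End Atomless.

(** * Realization of laws through binary codes *)

Section BitSequences.

(* The last bit read comes first. *)
Fixpoint bits_upto (f : nat -> bool) (n : nat) : seq bool :=
  if n is m.+1 then f m :: bits_upto f m else [::].

Definition cylinder (b : seq bool) : set (nat -> bool) :=
  [set f | bits_upto f (size b) = b].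

Lemma cylinder_cons c b :
  cylinder (c :: b) = cylinder b `&` [set f | f (size b) = c].
Proof.
apply/seteqP; split => f; rewrite /cylinder /=; first by case.
by case=> -> ->.
Qed.

Lemma cylinder_nested b b' : (size b <= size b')%N ->
  cylinder b `&` cylinder b' = cylinder b' \/ cylinder b `&` cylinder b' = set0.
Proof.
elim: b' => [|c b' IH]; first by rewrite leqn0 size_eq0 => /eqP ->; left; rewrite setIid.
rewrite leq_eqVlt => /orP[/eqP sb|]; last first.
  rewrite ltnS => /IH; rewrite cylinder_cons setIA => -[->|->]; first by left.
  by right; rewrite set0I.
have [->|bb] := pselect (b = c :: b'); first by left; rewrite setIid.
right; apply/seteqP; split => // f; rewrite /cylinder /= sb => -[h1 h2].
by apply: bb; rewrite -h1 -[RHS]h2.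
Qed.

(** The empty set is included for closure under intersection, which the uniqueness theorem for
    measures requires. *)
Definition cylinders : set (set (nat -> bool)) :=
  [set U | U = set0 \/ exists b, U = cylinder b].

Lemma cylinders_setI : setI_closed cylinders.
Proof.
move=> _ _ [->|[b ->]] [->|[b' ->]]; rewrite ?set0I ?setI0; try by left.
have [/cylinder_nested[]->|/ltnW] := leqP (size b) (size b'); [|by left|].
  by right; exists b'.
by rewrite setIC => /cylinder_nested[]->; [right; exists b|left].
Qed.

Definition bitseqs := g_sigma_algebraType cylinders.

Lemma measurable_fun_bitseqs disp (T : measurableType disp) (f : T -> bitseqs) :
  (forall n, measurable [set w | f w n]) -> measurable_fun setT f.
Proof.
move=> mf; apply: (@measurability _ _ T bitseqs _ _ cylinders) => //.
move=> _ [_ [->|[b ->]] <-]; rewrite setTI ?preimage_set0//.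
elim: b => [|c b IH].
  by rewrite (_ : _ @^-1` _ = setT)//; apply/seteqP; split.
rewrite cylinder_cons preimage_setI; apply: measurableI => //.
case: c; first exact: mf.
rewrite (_ : _ @^-1` _ = ~` [set w | f w (size b)]); first exact: measurableC.
by apply/seteqP; split => w /=; case: (f w (size b)).
Qed.

Lemma measurable_bit (n : nat) : measurable [set f : bitseqs | f n].
Proof.
rewrite (_ : [set f | _] = \bigcup_b (if (size b == n.+1) && head false b
    then cylinder b else set0)).
  apply: countable_bigcupT_measurable => [|b]; first exact: countableP.
  case: ifP => // _; apply: sub_sigma_algebra; right; by exists b.
apply/seteqP; split=> [f /= fn|f [b _]].
  have sp m : size (bits_upto f m) = m by elim: m => //= m ->.
  exists (bits_upto f n.+1) => //; rewrite sp eqxx /= fn /cylinder /=.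
  by rewrite sp fn.
case: ifP => // /andP[/eqP sb hb]; rewrite /cylinder /= sb.
by case: b hb sb => [|c b] //= -> _ [].
Qed.

End BitSequences.

Section TransferBits.
Context {disp : measure_display} {T : measurableType disp} {R : realType}.
Variable P : probability T R.
Hypothesis atP : atomless P.
Context {disp' : measure_display} {E : measurableType disp'}.
Variable k : {measure set E -> \bar R}.

(** A finite measure on bit sequences is determined by its values on cylinders, which form a binary
    tree. At each node atomlessness provides a subset with the mass that [k] prescribes, and the
    path of a point through the nested sets is its value. *)
Lemma transfer_bits (A : set T) (g : E -> bitseqs) :
  measurable A -> k setT = P A -> measurable_fun setT g ->
  exists h : T -> bitseqs, measurable_fun setT h /\
    forall B, measurable B -> P (A `&` h @^-1` B) = k (g @^-1` B).
Proof.
move=> mA kA mg.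
have mcyl b : measurable (g @^-1` cylinder b).
  rewrite -[X in measurable X]setTI; apply: mg => //.
  by apply: sub_sigma_algebra; right; exists b.
have klt B : measurable B -> (k B < +oo)%E.
  move=> mB; apply: (@le_lt_trans _ _ (k setT)); first by rewrite le_measure ?inE.
  by rewrite kA (le_lt_trans (probability_le1 P mA))// ltry.
pose m b := fine (k (g @^-1` cylinder b)).
have kE b : k (g @^-1` cylinder b) = (m b)%:E.
  by rewrite fineK// ge0_fin_numE// klt.
have mD b : m b = m (true :: b) + m (false :: b).
  apply: EFin_inj; rewrite EFinD -!kE -measureU//.
    congr (k _); rewrite -preimage_setU !cylinder_cons -setIUr.
    rewrite (_ : _ `|` _ = setT) ?setIT//.
    by apply/seteqP; split => // f _ /=; case: (f (size b)); [left|right].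
  apply/seteqP; split => // x; rewrite !cylinder_cons.
  by move=> [[_ /= ->] []].
have m0 b : 0 <= m b by rewrite fine_ge0.
have [sel hsel] := choice (fun x : set T * R => atomless_split atP x.1 x.2).
(* [Om b] is split according to the next bit in the proportions given by [k], so
   that [Om b] plays in [A] the role of [g @^-1` cylinder b]. *)
pose Om := fix Om b : set T := if b is c :: b' then
    let S := sel (Om b', m (true :: b')) in if c then S else Om b' `\` S
  else A.
have OmP b : measurable (Om b) /\ P (Om b) = (m b)%:E.
  elim: b => [|c b [mO PO]].
    by split => //=; rewrite -kE -kA; congr (k _); apply/seteqP; split.
  have fO : fine (P (Om b)) = m b by rewrite PO.
  have [||mS SO PS] := hsel (Om b, m (true :: b)) => //=.
    by rewrite fO m0/= [leRHS]mD lerDl.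
  have PS' : P (sel (Om b, m (true :: b))) = (m (true :: b))%:E.
    by rewrite -[X in X%:E]PS fineK// fin_num_measure.
  case: c; split => //=; first exact: measurableD.
  transitivity (P (Om b) - P (sel (Om b, m (true :: b))))%E.
    rewrite measureD//; last exact: le_lt_trans (probability_le1 P mO) (ltry _).
    by rewrite setIidr.
  by rewrite PO PS' -EFinB mD; congr EFin; lra.
have fO b : fine (P (Om b)) = m b by rewrite (OmP b).2.
pose path w := fix path n : seq bool := if n is n'.+1 then
  `[< Om (true :: path n') w >] :: path n' else [::].
pose h (w : T) : bitseqs := fun n => `[< Om (true :: path w n) w >].
have ph w n : bits_upto (h w) n = path w n by elim: n => //= n ->.
have hOm b : A `&` h @^-1` cylinder b = Om b.
  elim: b => [|c b IH]; first by apply/seteqP; split => // w [].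
  rewrite cylinder_cons preimage_setI setIA IH.
  have bE w : Om b w -> path w (size b) = b.
    by rewrite -{1}IH => -[_]; rewrite /cylinder /= ph.
  have [||mS SO PS] := hsel (Om b, m (true :: b)) => //=.
  - by case: (OmP b).
  - by rewrite fO m0 [leRHS]mD lerDl m0.
  apply/seteqP; split=> [w [Ow /=]|w Ow].
    by rewrite /h bE//; case: c => /asboolP.
  have Obw : Om b w by case: c Ow => /= [/SO|[]].
  split => //=; rewrite /h bE//; case: c Ow => /=; first by move/asboolP.
  by case=> _ ?; apply/asboolPn.
have mpre n b : measurable [set w | A w /\ path w n = b].
  have [<-|nb] := eqVneq (size b) n.
    rewrite (_ : [set w | _] = Om b); first by case: (OmP b).
    by rewrite -hOm /cylinder /=; apply/seteqP; split => w /=; rewrite ph.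
  rewrite (_ : [set w | _] = set0)//; apply/seteqP; split => // w [_ pw].
  have sp l : size (path w l) = l by elim: l => //= l ->.
  by move/eqP: nb; rewrite -pw sp.
(* [mpre] describes the paths only inside [A]; outside, a constant value keeps the map
   measurable. *)
pose h' (w : T) : bitseqs := if `[< A w >] then h w else fun=> false.
exists h'.
have mh' : measurable_fun setT h'.
  apply: measurable_fun_bitseqs => n.
  rewrite (_ : [set w | _] = \bigcup_b (if head false b then
      [set w | A w /\ path w n.+1 = b] else set0)).
    apply: countable_bigcupT_measurable => [|b]; first exact: countableP.
    by case: ifP.
  apply/seteqP; split=> [w|w [b _]].
    rewrite /h' /=; case: asboolP => // Aw hw; exists (path w n.+1) => //.
    by have -> : head false (path w n.+1) = true by exact: hw.
  case: ifP => // hb [Aw pw]; rewrite /h' /=; case: asboolP => // _.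
  by rewrite /h; move: hb; rewrite -pw.
split => // B mB.
rewrite setIC.
suff : pushforward (mrestr P mA) h' B = pushforward k g B by [].
have mcyls : cylinders `<=` (@measurable _ bitseqs) by exact: sub_sigma_algebra.
apply: (@measure_unique _ _ bitseqs cylinders (fun=> setT) erefl cylinders_setI) => //.
- by move=> _; right; exists [::]; apply/seteqP; split.
- by apply/seteqP; split => // f _; exists 0%N.
- move=> _ [->|[b ->]]; first by rewrite !measure0.
  transitivity (P (Om b)); last by rewrite (OmP b).2 -kE.
  transitivity (P (h' @^-1` cylinder b `&` A)) => //; rewrite setIC -hOm; congr (P _).
  apply/seteqP; split => w [Aw]; rewrite /h' /=;
    by case: asboolP.
- move=> _; have le1 : (P (setT `&` A) <= 1)%E by rewrite setTI probability_le1.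
  exact: le_lt_trans le1 (ltry 1).
Qed.

End TransferBits.

Section Realization.
Context {R : realType} {d : nat}.

(** The bits are the Dedekind cuts of the coordinates; an [n] that codes no pair gives [false]. *)
Let bit (n : nat) (x : 'rV[R]_d) : bool :=
  if @unpickle ('I_d * rat)%type n is Some (i, q) then ratr q < x ord0 i else false.

(* Coordinate [i] of [x] is the supremum of the rationals [q] with [q < x i]. *)
Let decode_coord (i : 'I_d) (f : bitseqs) : \bar R := esups (fun n =>
  if @unpickle ('I_d * rat)%type n is Some (j, q) then
    if (j == i) && f n then (ratr q)%:E else -oo%E else -oo%E) 0.

Let decode (f : bitseqs) : 'rV[R]_d := \row_i fine (decode_coord i f).

Let encode (x : 'rV[R]_d) : bitseqs := fun n => bit n x.

Let encodeK x : decode (encode x) = x.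
Proof.
apply/rowP => i; rewrite mxE; suff -> : decode_coord i (encode x) = (x ord0 i)%:E by [].
rewrite /decode_coord /esups /sdrop /=; apply/eqP; rewrite eq_le.
apply/andP; split.
  apply: ub_ereal_sup => _ [n _ <-]; rewrite /encode /bit.
  case: unpickle => [[j q]|]; last exact: leNye.
  case: eqP => [->|_] /=; last exact: leNye.
  by case: ifP => [/ltW|_]; [rewrite lee_fin|exact: leNye].
apply/lee_addgt0Pr => e e0; rewrite -leeBlDr//.
have [|q] := @rat_in_itvoo R (x ord0 i - e) (x ord0 i); first lra.
rewrite in_itv/= => /andP[q1 q2].
apply: (@le_trans _ _ (ratr q)%:E); first by rewrite -EFinB lee_fin ltW.
apply: ereal_sup_ubound; exists (pickle (i, q)) => //.
by rewrite pickleK eqxx /encode /bit pickleK q2.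
Qed.

Let measurable_encode : measurable_fun setT encode.
Proof.
apply: measurable_fun_bitseqs => n; rewrite /encode /bit.
case: unpickle => [[i q]|]; last first.
  by rewrite (_ : [set w | _] = set0)//; apply/seteqP; split.
rewrite (_ : [set w | _] = (fun x : 'rV[R]_d => x ord0 i) @^-1` `]ratr q, +oo[%classic).
  by rewrite -[X in measurable X]setTI; exact: measurable_coord.
by apply/seteqP; split => x /=; rewrite in_itv/= andbT.
Qed.

Let measurable_decode : measurable_fun setT decode.
Proof.
apply: measurable_fun_rV => i; rewrite (_ : (fun w => _) = fine \o decode_coord i); last first.
  by apply/funext => f; rewrite mxE.
apply: measurableT_comp => //; apply: measurable_fun_esups => n.
case: unpickle => [[j q]|]; last exact: measurable_cst.
case: eqP => _ /=; last exact: measurable_cst.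
apply: measurable_fun_ifT; try exact: measurable_cst.
apply: (measurable_fun_bool true); rewrite setTI.
exact: measurable_bit.
Qed.

(** The bits of a vector distributed as [k] are realized first, then decoded. The total mass is
    [P A] rather than 1, so that a random vector can be prescribed piece by piece on a partition. *)
Lemma atomless_realization disp (T : measurableType disp) (P : probability T R)
    (k : {measure set 'rV[R]_d -> \bar R}) (A : set T) :
  atomless P -> measurable A -> k setT = P A ->
  exists Y : T -> 'rV[R]_d, measurable_fun setT Y /\
    forall B, measurable B -> P (A `&` Y @^-1` B) = k B.
Proof.
move=> atP mA kA.
have [h [mh hP]] := transfer_bits atP mA kA measurable_encode.
exists (decode \o h); split; first exact: measurableT_comp measurable_decode mh.
move=> B mB; rewrite comp_preimage hP.
  by congr (k _); apply/seteqP; split => x /=; rewrite encodeK.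
by rewrite -[X in measurable X]setTI; exact: measurable_decode.
Qed.

End Realization.

(** * Convex functions and maxima of affine functions *)

Section ConvexFunctions.
Context {R : realType} {d : nat}.
Implicit Types (x y g v : 'rV[R]_d).

Definition convex_on_rV (f : 'rV[R]_d -> R) := forall (a : R) x y,
  0 <= a <= 1 -> f (a *: x + (1 - a) *: y) <= a * f x + (1 - a) * f y.

Lemma convex_functionP (f : 'rV[R]_d -> R^o) :
  convex_function setT f <-> convex_on_rV f.
Proof.
split=> [cf a x y /andP[a0 a1]|cf a x y _ _].
  pose t : {i01 R} := @Itv01 _ a a0 a1.
  by have := cf t x y (mem_set I) (mem_set I).
by apply: cf; rewrite ge0 le1.
Qed.

Variable f : 'rV[R]_d -> R.
Hypothesis cf : convex_on_rV f.

Let e_ (i : 'I_d) : 'rV[R]_d := delta_mx 0 i.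

Let edot_e g i : edot g (e_ i) = g ord0 i.
Proof.
rewrite /edot (bigD1 i)//= mxE !eqxx mulr1 big1 ?addr0// => j /negPf ji.
by rewrite mxE eqxx ji mulr0.
Qed.

Lemma convex_subgradient x : exists g, forall y, f x + edot g (y - x) <= f y.
Proof.
(* Hahn-Banach: the affine minorant is extended one coordinate at a time. *)
suff sub k : (k <= d)%N -> exists g, forall y,
    (forall i : 'I_d, (k <= i)%N -> y ord0 i = x ord0 i) -> f x + edot g (y - x) <= f y.
  have [g hg] := sub d (leqnn d); exists g => y; apply: hg => i.
  by rewrite leqNgt ltn_ord.
elim: k => [_|k IH kd].
  exists 0 => y yx; rewrite edot0l addr0 (_ : y = x)//.
  by apply/rowP => i; exact: yx.
have [g hg] := IH (ltnW kd); pose i0 := Ordinal kd.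
pose V v := forall i : 'I_d, (k <= i)%N -> v ord0 i = x ord0 i.
(* Bounds on the slope along [e_ i0] imposed from the two sides. Convexity puts every [lo] below
   every [hi], so the supremum of the [lo] is an admissible slope. *)
pose lo (p : 'rV[R]_d * R) := (f x + edot g (p.1 - x) - f (p.1 - p.2 *: e_ i0)) / p.2.
pose hi (p : 'rV[R]_d * R) := (f (p.1 + p.2 *: e_ i0) - (f x + edot g (p.1 - x))) / p.2.
pose S := [set lo p | p in [set p | V p.1 /\ 0 < p.2]].
have lohi p q : V p.1 -> 0 < p.2 -> V q.1 -> 0 < q.2 -> lo p <= hi q.
  case: p q => v r [w s] /= Vv r0 Vw s0.
  rewrite /lo /hi /= ler_pdivrMr// mulrAC ler_pdivlMr//.
  have rs0 : 0 < r + s by rewrite addr_gt0.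
  have rs1 : r + s != 0 by rewrite gt_eqF.
  (* The weight for which the two shifts along [e_ i0] cancel. *)
  pose a : R := s / (r + s).
  have a01 : 0 <= a <= 1.
    by rewrite (divr_ge0 (ltW s0) (ltW rs0)) ler_pdivrMr// mul1r lerDr ltW.
  have a1 : 1 - a = r / (r + s) by rewrite /a; field.
  have := cf (v - r *: e_ i0) (w + s *: e_ i0) a01.
  have -> : a *: (v - r *: e_ i0) + (1 - a) *: (w + s *: e_ i0) = a *: v + (1 - a) *: w.
    rewrite scalerBr scalerDr !scalerA a1 (_ : a * r = r / (r + s) * s).
      by rewrite [X in _ + X]addrC addrA subrK.
    by rewrite /a; field.
  have Vz : V (a *: v + (1 - a) *: w).
    by move=> i ki; rewrite !mxE Vv// Vw//; ring.
  have := hg _ Vz.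
  have -> : a *: v + (1 - a) *: w - x = a *: (v - x) + (1 - a) *: (w - x).
    by apply/rowP => i; rewrite !mxE; ring.
  rewrite [edot g (a *: _ + _)]edotDr (edotZr a) (edotZr (1 - a)) => h1 h2.
  have h3 := le_trans h1 h2.
  have : 0 <= (r + s) * (a * f (v - r *: e_ i0) + (1 - a) * f (w + s *: e_ i0) -
     (f x + (a * edot g (v - x) + (1 - a) * edot g (w - x)))).
    by rewrite mulr_ge0 ?(ltW rs0)// subr_ge0.
  rewrite a1 /a.
  have -> : (r + s) * (s / (r + s) * f (v - r *: e_ i0) + r / (r + s) * f (w + s *: e_ i0) -
     (f x + (s / (r + s) * edot g (v - x) + r / (r + s) * edot g (w - x)))) =
     s * f (v - r *: e_ i0) + r * f (w + s *: e_ i0) -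
     ((r + s) * f x + (s * edot g (v - x) + r * edot g (w - x))) by field.
  lra.
have Vx : V x by [].
have hS : has_sup S.
  split; first by exists (lo (x, 1)), (x, 1).
  by exists (hi (x, 1)) => _ [p [Vp p0] <-]; apply: lohi.
pose a := sup S.
exists (g + (a - g ord0 i0) *: e_ i0) => y Vy.
pose s := y ord0 i0 - x ord0 i0; pose v := y - s *: e_ i0.
have Vv : V v.
  move=> i; rewrite leq_eqVlt => /orP[/eqP ki|ki]; rewrite !mxE /=.
    have -> : i = i0 by apply/val_inj.
    by rewrite eqxx mulr1 /s; ring.
  rewrite (_ : (i == i0) = false) ?mulr0 ?subr0 ?Vy//.
  by apply/negbTE/eqP => ii; rewrite ii ltnn in ki.
have yE : y = v + s *: e_ i0 by rewrite subrK.
have dotE : edot (g + (a - g ord0 i0) *: e_ i0) (y - x) = edot g (v - x) + s * a.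
  rewrite edotDl edotZl (edotC (e_ i0)) edot_e !mxE -/s.
  rewrite (_ : y - x = (v - x) + s *: e_ i0); last by rewrite yE addrAC.
  by rewrite edotDr edotZr edot_e; ring.
rewrite dotE; have [s0|s0|s0] := ltgtP s 0.
- have : lo (v, - s) <= a.
    by apply: sup_upper_bound => //; exists (v, - s) => //=; rewrite oppr_gt0.
  by rewrite /lo /= ler_pdivrMr ?oppr_gt0// scaleNr opprK -yE; lra.
- have : a <= hi (v, s).
    by apply: sup_le_ub => [|_ [p [Vp p0] <-]]; [case: hS|exact: lohi].
  by rewrite /hi /= ler_pdivlMr// -yE; lra.
- by rewrite s0 mul0r addr0; have := hg _ Vv; rewrite yE s0 scale0r addr0.
Qed.

(** Coordinate by coordinate: a point is a convex combination of two points on opposite faces, on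
    which one coordinate fewer varies. *)
Lemma convex_bounded_above x (r : R) : 0 <= r ->
  exists M, forall y, (forall i, `|y ord0 i - x ord0 i| <= r) -> f y <= M.
Proof.
move=> r0; suff sub k : (k <= d)%N -> forall x, exists M, forall y,
    (forall i : 'I_d, (i < k)%N -> `|y ord0 i - x ord0 i| <= r) ->
    (forall i : 'I_d, (k <= i)%N -> y ord0 i = x ord0 i) -> f y <= M.
  have [M hM] := sub d (leqnn d) x; exists M => y hy; apply: hM => // i.
  by rewrite leqNgt ltn_ord.
elim: k => [_ {}x|k IH kd {}x].
  exists (f x) => y _ yx; rewrite (_ : y = x)//; apply/rowP => i; exact: yx.
pose i0 := Ordinal kd.
have [M1 hM1] := IH (ltnW kd) (x + r *: e_ i0).
have [M2 hM2] := IH (ltnW kd) (x - r *: e_ i0).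
exists (Num.max M1 M2) => y yr yx.
pose y1 := y + (x ord0 i0 + r - y ord0 i0) *: e_ i0.
pose y2 := y + (x ord0 i0 - r - y ord0 i0) *: e_ i0.
have neq (i : 'I_d) : (i < k)%N -> (i == i0) = false.
  by move=> ik; apply/negbTE/eqP => ii; rewrite ii ltnn in ik.
have neq' (i : 'I_d) : (k <= i)%N -> i != i0 -> (k < i)%N.
  rewrite leq_eqVlt => /orP[/eqP ki|//] /eqP; case.
  exact/val_inj.
have fy1 : f y1 <= M1.
  apply: hM1 => i ik; rewrite !mxE /=.
    by rewrite neq// !mulr0 !addr0 yr// ltnW.
  have [->|ii] := eqVneq i i0; first by rewrite !mulr1; ring.
  by rewrite !mulr0 !addr0 yx// neq'.
have fy2 : f y2 <= M2.
  apply: hM2 => i ik; rewrite !mxE /=.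
    by rewrite neq// !mulr0 subr0 addr0 yr// ltnW.
  have [->|ii] := eqVneq i i0; first by rewrite !mulr1; ring.
  by rewrite !mulr0 subr0 addr0 yx// neq'.
(* The weight [a] used below divides by [2 * r], hence the separate case. *)
have [r1|r1] := eqVneq r 0.
  suff -> : y = y1 by rewrite le_max fy1.
  have := yr i0 (ltnSn k); rewrite r1 normr_le0 subr_eq0 => /eqP h.
  by rewrite /y1 r1 -h addr0 subrr scale0r addr0.
have rp : 0 < r by rewrite lt_neqAle eq_sym r1.
pose a := (y ord0 i0 - x ord0 i0 + r) / (2 * r).
have := yr i0 (ltnSn k); rewrite ler_norml => /andP[h1 h2].
have a01 : 0 <= a <= 1.
  by rewrite divr_ge0//= ?ler_pdivrMr//; lra.
have -> : y = a *: y1 + (1 - a) *: y2.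
  rewrite /y1 /y2 !scalerDr addrACA -!scalerDl scalerA scalerA -scalerDl.
  rewrite [a + _]addrC subrK scale1r [X in X *: e_ _](_ : _ = 0) ?scale0r ?addr0//.
  by rewrite /a; field.
apply: le_trans (cf _ _ a01) _.
apply: (@le_trans _ _ (a * Num.max M1 M2 + (1 - a) * Num.max M1 M2)); last by lra.
have /andP[a0 a1] := a01.
by apply: lerD; apply: ler_wpM2l; rewrite ?subr_ge0// le_max ?fy1 ?fy2 ?orbT.
Qed.

(** Subgradients at rational points suffice: near [x] they are bounded, so the supporting affine
    function at a close rational point loses little at [x]. *)
Lemma convex_countable_affine_sup : exists (g : nat -> 'rV[R]_d) (c : nat -> R),
  (forall n x, edot (g n) x + c n <= f x) /\
  (forall x e, 0 < e -> exists n, f x - e <= edot (g n) x + c n).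
Proof.
have [sg hsg] := choice convex_subgradient.
pose q (n : nat) : 'rV[R]_d := if @unpickle 'rV[rat]_d n is Some u
  then map_mx ratr u else 0.
exists (fun n => sg (q n)), (fun n => f (q n) - edot (sg (q n)) (q n)); split.
  by move=> n x; have := hsg (q n) x; rewrite edotBr; lra.
move=> x e e0.
(* The radius [2] covers unit moves along an axis from a point [z] within 1 of [x]. *)
have [M hM] := @convex_bounded_above x 2 (ler0n _ 2).
pose h := sg x; pose H := \sum_i `|h ord0 i|.
have H0 : 0 <= H by apply: sumr_ge0.
pose C := M - f x + H.
have hdot u v (r : R) : (forall i, `|v ord0 i| <= r) ->
    `|edot u v| <= (\sum_i `|u ord0 i|) * r.
  move=> vr; apply: le_trans (ler_norm_sum _ _ _) _; rewrite mulr_suml.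
  by apply: ler_sum => i _; rewrite normrM ler_wpM2l.
have C0 : 0 <= C.
  have : f x <= M by apply: hM => i; rewrite subrr normr0.
  by rewrite /C; lra.
(* From [x] to [z], [f] drops by at most [H * r]; from [z] back to [x], the affine function drops by
   at most [d%:R * C * r]. The [1] keeps [K] positive. *)
pose K := H + d%:R * C + 1.
have K0 : 0 < K by rewrite ltr_wpDl// addr_ge0// mulr_ge0.
pose r := Num.min 1 (e / K).
have r0 : 0 < r by rewrite lt_min ltr01 divr_gt0.
have [u hu] : exists u : 'I_d -> rat, forall i, `|x ord0 i - ratr (u i)| <= r.
  suff : forall i, exists a : rat, `|x ord0 i - ratr a| <= r.
    by move/choice => [u hu]; exists u.
  move=> i; have [|a] := @rat_in_itvoo R (x ord0 i - r) (x ord0 i + r); first lra.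
  by rewrite in_itv/= => /andP[? ?]; exists a; rewrite ler_norml; apply/andP; split; lra.
exists (pickle (\row_i u i)).
have -> : q (pickle (\row_i u i)) = \row_i ratr (u i).
  by rewrite /q pickleK; apply/rowP => i; rewrite !mxE.
set z := \row_i ratr (u i); pose g := sg z.
have xz i : `|(x - z) ord0 i| <= r by rewrite !mxE.
have r1 : r <= 1 by rewrite ge_min lexx.
have fz : f x - H * r <= f z.
  have := hsg x z; have := hdot h (z - x) r.
  rewrite -/h ler_norml => /(_ _)/andP; case.
    by move=> i; rewrite -opprB mxE normrN.
  by rewrite -/H => *; lra.
have fz' : f x - H <= f z by have : H * r <= H by [rewrite ler_piMr]; lra.
(* The subgradient at [z] is bounded by the values of [f] at [z + e_ i] and
   [z - e_ i], uniformly in [z] near [x]. *)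
have gC i : `|g ord0 i| <= C.
  have zi j s : `|s| <= 1 -> `|(z + s *: e_ i) ord0 j - x ord0 j| <= 2.
    move=> s1; have -> : (z + s *: e_ i) ord0 j - x ord0 j =
        - (x - z) ord0 j + s * (j == i)%:R by rewrite !mxE/=; ring.
    apply: le_trans (ler_normD _ _) _; rewrite normrN.
    have := xz j; suff : `|s * (j == i)%:R| <= 1 by lra.
    by case: eqP => _; rewrite ?mulr1 ?mulr0 ?normr0.
  have up s : `|s| <= 1 -> s * g ord0 i <= C.
    move=> s1; have := hsg z (z + s *: e_ i).
    rewrite -/g addrAC subrr add0r edotZr edot_e.
    have : f (z + s *: e_ i) <= M by apply: hM => j; exact: zi.
    by rewrite /C; lra.
  have := up 1; have := up (-1); rewrite normrN normr1 mul1r mulN1r.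
  by move=> /(_ (lexx _)) ? /(_ (lexx _)) ?; rewrite ler_norml; apply/andP; split; lra.
have := hdot g (x - z) r xz; rewrite ler_norml => /andP[hg _].
have gs : \sum_i `|g ord0 i| <= d%:R * C.
  rewrite mulr_natl -[X in C *+ X]card_ord -sumr_const.
  by apply: ler_sum => i _; exact: gC.
have : (\sum_i `|g ord0 i|) * r <= d%:R * C * r by rewrite ler_wpM2r// ltW.
have : (H + d%:R * C + 1) * r <= e.
  rewrite mulrC -ler_pdivlMr//; rewrite ge_min; apply/orP; right; exact: lexx.
by move: hg; rewrite edotBr -/g; lra.
Qed.

End ConvexFunctions.

(** * Finite maxima of affine functions as tests for the convex order *)

Section MaxAffine.
Context {R : realType} {d : nat}.
Implicit Types (g : nat -> 'rV[R]_d) (c : nat -> R).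

Fixpoint maxaff g c (n : nat) (x : 'rV[R]_d) : R :=
  if n is m.+1 then Num.max (maxaff g c m x) (edot (g n) x + c n)
  else edot (g 0%N) x + c 0%N.

(** A measurable choice of an active piece, ties going to the smallest index. *)
Fixpoint argmaxaff g c (n : nat) (x : 'rV[R]_d) : nat :=
  if n is m.+1 then
    if maxaff g c m x < edot (g n) x + c n then n else argmaxaff g c m x
  else 0%N.

Lemma maxaff_ge g c n m x : (m <= n)%N -> edot (g m) x + c m <= maxaff g c n x.
Proof.
elim: n => [|n IH]; first by rewrite leqn0 => /eqP ->.
by rewrite leq_eqVlt => /orP[/eqP ->|/IH h] /=; rewrite le_max ?lexx ?orbT ?h.
Qed.

Lemma maxaff_le g c n x b : (forall m, edot (g m) x + c m <= b) -> maxaff g c n x <= b.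
Proof. by move=> h; elim: n => [|n IH] /=; rewrite ?ge_max ?IH ?h. Qed.

Lemma maxaff_homo g c x : {homo (fun n => maxaff g c n x) : n m / (n <= m)%N >-> n <= m}.
Proof.
apply: homo_leq => [r|y a b|n]; [exact: lexx|exact: le_trans|].
by rewrite /= le_max lexx.
Qed.

Lemma argmaxaffE g c n x :
  maxaff g c n x = edot (g (argmaxaff g c n x)) x + c (argmaxaff g c n x).
Proof. by elim: n => //= n IH; rewrite maxEle -/(maxaff g c n.+1 x); case: ltgtP IH => // ->. Qed.

Lemma argmaxaff_le g c n x : (argmaxaff g c n x <= n)%N.
Proof. by elim: n => //= n IH; case: ifP => // _; rewrite leqW. Qed.

Lemma measurable_affine disp (T : measurableType disp) (f : T -> 'rV[R]_d)
    (v : 'rV[R]_d) (b : R) : measurable_fun setT f ->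
  measurable_fun setT (fun w => edot v (f w) + b).
Proof.
by move=> mf; apply: measurable_funD => //; apply: measurable_edot.
Qed.

Lemma measurable_maxaff g c n : measurable_fun setT (maxaff g c n).
Proof.
elim: n => [|n IH]; first exact: measurable_affine.
by apply: measurable_maxr => //; exact: measurable_affine.
Qed.

Lemma measurable_argmaxaff g c n m :
  measurable [set x : 'rV[R]_d | argmaxaff g c n x = m].
Proof.
elim: n => [|n IH] /=.
  have [->|m0] := eqVneq m 0%N.
    by rewrite (_ : [set x | _] = setT)//; apply/seteqP; split.
  rewrite (_ : [set x | _] = set0)//; apply/seteqP; split => // x /= h.
  by rewrite -h eqxx in m0.
pose L := [set x : 'rV[R]_d | maxaff g c n x < edot (g n.+1) x + c n.+1].
have mL : measurable L.
  rewrite -[L]setTI; apply: (measurable_fun_ltr (measurable_maxaff g c n) _) => //.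
    exact: measurable_affine.
rewrite (_ : [set x | _] = (L `&` [set x | n.+1 = m]) `|`
    (~` L `&` [set x | argmaxaff g c n x = m])).
  apply: measurableU; apply: measurableI => //; last exact: measurableC.
  by have [->|/eqP nm] := eqVneq n.+1 m; [rewrite (_ : [set x | _] = setT)//|
    rewrite (_ : [set x | _] = set0)//]; apply/seteqP; split => // x /nm.
apply/seteqP; split => x; rewrite /L /=.
  by case: ifP => [h <-|h <-]; [left|right; split => //; rewrite h].
by case=> -[h <-]; [rewrite h|move/negP/negbTE: h => ->].
Qed.

Lemma maxaff_norm_le g c n x :
  `|maxaff g c n x| <= \sum_(i < n.+1) (edot (g i) (g i) + edot x x + `|c i|).
Proof.
have t0 i : 0 <= edot (g i) (g i) + edot x x + `|c i|.
  by rewrite !addr_ge0 ?edot_ge0.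
rewrite argmaxaffE; set m := argmaxaff g c n x.
have mn : (m < n.+1)%N by rewrite ltnS argmaxaff_le.
rewrite (bigD1 (Ordinal mn))//=.
apply: (@le_trans _ _ (edot (g m) (g m) + edot x x + `|c m|)); last first.
  by rewrite lerDl sumr_ge0.
apply: le_trans (ler_normD _ _) _; rewrite lerD2r.
apply: le_trans (normr_edot_le _ _) _.
by have := edot_ge0 (g m); have := edot_ge0 x => *; lra.
Qed.

Lemma maxaff_convex g c n : convex_on_rV (maxaff g c n).
Proof.
move=> a x y /andP[a0 a1]; rewrite argmaxaffE.
set m := argmaxaff _ _ _ _; rewrite edotDr !edotZr.
have mn : (m <= n)%N by exact: argmaxaff_le.
have := maxaff_ge g c x mn; have := maxaff_ge g c y mn => hy hx.
apply: (@le_trans _ _ (a * (edot (g m) x + c m) + (1 - a) * (edot (g m) y + c m))).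
  by lra.
by apply: lerD; apply: ler_wpM2l => //; rewrite subr_ge0.
Qed.

Lemma integrable_maxaff_comp disp (T : measurableType disp) (Q : probability T R)
    (V : T -> 'rV[R]_d) g c n :
  sqint Q V -> Q.-integrable setT (EFin \o (maxaff g c n \o V)).
Proof.
move=> [mV iV]; apply: (@integrable_le _ _ _ _ _
    (fun w => \sum_(i < n.+1) (edot (g i) (g i) + edot (V w) (V w) + `|c i|))).
- exact: measurableT_comp (measurable_maxaff g c n) mV.
- by move=> w; exact: maxaff_norm_le.
- apply: EFin_integrable_sum => i; apply: EFin_integrableD.
    by apply: EFin_integrableD => //; exact: finite_measure_integrable_cst.
  exact: finite_measure_integrable_cst.
Qed.

Lemma integrable_maxaff (mu : probability 'rV[R]_d R) g c n :
  mu.-integrable setT (EFin \o (fun x => edot x x)) ->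
  mu.-integrable setT (EFin \o maxaff g c n).
Proof.
move=> i2; have := @integrable_maxaff_comp _ _ mu id g c n; by apply; split.
Qed.

(** A convex function is an increasing limit of finite maxima of its affine minorants. To have
    nonnegative functions in the monotone convergence theorem, the first minorant [a0], integrable
    under both laws, is subtracted. *)
Lemma convex_order_maxaff (mu nu : probability 'rV[R]_d R) :
  mu.-integrable setT (EFin \o (fun x => edot x x)) ->
  nu.-integrable setT (EFin \o (fun x => edot x x)) ->
  (forall g c n, \int[mu]_x maxaff g c n x <= \int[nu]_x maxaff g c n x) ->
  convex_order mu nu.
Proof.
move=> imu inu le_aff phi /convex_functionP cphi.
have [g [c [le_phi near_phi]]] := convex_countable_affine_sup cphi.
have cvg_phi x : maxaff g c n x @[n --> \oo] --> (phi x : R).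
  apply/cvgrPdist_le => e e0; have [N hN] := near_phi x _ e0.
  near=> n; rewrite ger0_norm ?subr_ge0 ?maxaff_le// lerBlDr -lerBlDl.
  apply: le_trans hN _; apply: maxaff_ge; near: n; exact: nbhs_infty_ge.
have mphi : measurable_fun setT (phi : 'rV[R]_d -> R).
  apply: (@measurable_fun_cvg _ _ _ _ (maxaff g c)) => [n|x _].
    exact: measurable_maxaff.
  exact: cvg_phi.
pose a0 x := maxaff g c 0 x.
have phi_ge x : a0 x <= phi x by exact: maxaff_le.
have mE : measurable_fun setT (fun x => (phi x)%:E) by exact/measurable_EFinP.
(* The negative part of [phi] is integrable thanks to [a0], so [phi] fails to be integrable under
   [nu] only if its integral is [+oo]. *)
have [nuphi|] := boolP (nu.-integrable setT (fun x => (phi x)%:E)); last first.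
  move=> ninu; suff -> : (\int[nu]_x (phi x)%:E = +oo)%E by exact: leey.
  have neg_lty : (\int[nu]_x ((fun x => (phi x)%:E)^\- x) < +oo)%E.
    have /integrableP[_] := integrable_maxaff g c 0 inu.
    apply: le_lt_trans; apply: ge0_le_integral => //.
    - exact: measurable_funeneg.
    - by apply/measurable_EFinP/measurableT_comp => //; exact: measurable_maxaff.
    - move=> x _; rewrite funenegE -EFinN -EFin_max lee_fin ge_max normr_ge0 andbT.
      apply: (@le_trans _ _ (- a0 x)); first by rewrite lerN2.
      by rewrite -normrN ler_norm.
  have pos_y : (\int[nu]_x ((fun x => (phi x)%:E)^\+ x) = +oo)%E.
    apply/eqP; rewrite -leye_eq leNgt; apply: contra ninu => pos_lty.
    apply/integrableP; split => //.
    rewrite -[fun x => _]/(abse \o (fun x => (phi x)%:E)) fune_abse.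
    rewrite ge0_integralD//; first by rewrite lte_add_pinfty.
      exact: measurable_funepos.
    exact: measurable_funeneg.
  rewrite integralE pos_y addye// -ltNye lteNr; exact: neg_lty.
pose K := \int[nu]_x phi x - \int[mu]_x a0 x.
have pos n x : 0 <= maxaff g c n x - a0 x by rewrite subr_ge0 maxaff_homo.
have imn n : mu.-integrable setT (EFin \o (fun x => maxaff g c n x - a0 x)).
  by apply: EFin_integrableB; exact: integrable_maxaff.
have intK : (\int[mu]_x (phi x - a0 x)%:E <= K%:E)%E.
  have cvgE x : (maxaff g c n x - a0 x)%:E @[n --> \oo] --> (phi x - a0 x)%:E.
    by apply: cvg_EFin; [near=> n|apply: cvgB; [exact: cvg_phi|exact: cvg_cst]].
  rewrite (_ : (\int[mu]_x _)%E =
      \int[mu]_x (limn (fun n => (maxaff g c n x - a0 x)%:E)))%E; last first.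
    by apply: eq_integral => x _; apply/esym/cvg_lim.
  rewrite monotone_convergence//.
  - apply: lime_le.
      apply: ereal_nondecreasing_is_cvgn => n m nm.
      apply: ge0_le_integral => //.
      + by move=> x _; rewrite lee_fin.
      + by case/integrableP: (imn n).
      + by case/integrableP: (imn m).
      + by move=> x _; rewrite lee_fin lerD2r maxaff_homo.
    near=> n; rewrite -EFin_Rintegral// lee_fin RintegralB//; try exact: integrable_maxaff.
    rewrite lerD2r; apply: le_trans (le_aff _ _ _) _.
    apply: le_Rintegral => //; first exact: integrable_maxaff.
    by move=> x _; exact: maxaff_le.
  - by move=> n; case/integrableP: (imn n).
  - by move=> n x _; rewrite lee_fin.
  - by move=> x _ n m nm; rewrite lee_fin lerD2r maxaff_homo.
have idif : mu.-integrable setT (EFin \o (fun x => phi x - a0 x)).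
  apply/integrableP; split.
    by apply/measurable_EFinP/measurable_funB => //; exact: measurable_maxaff.
  under eq_integral do rewrite /= ger0_norm ?subr_ge0//.
  exact: le_lt_trans intK (ltry _).
have imuphi : mu.-integrable setT (EFin \o (phi : 'rV[R]_d -> R)).
  rewrite (_ : phi = fun x => (phi x - a0 x) + a0 x).
    by apply: EFin_integrableD => //; exact: integrable_maxaff.
  by apply/funext => x; rewrite subrK.
rewrite -!EFin_Rintegral// lee_fin.
move: intK; rewrite -EFin_Rintegral// lee_fin RintegralB//; last exact: integrable_maxaff.
by rewrite /K lerD2r.
Unshelve. all: by end_near.
Qed.

End MaxAffine.

(** * Semidiscrete transport with entropic smoothing *)

Section LogSumExp.
Context {R : realType} {d n : nat}.
Variable x : nat -> 'rV[R]_d.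
Implicit Types (c : 'rV[R]_n.+1) (y : 'rV[R]_d).

Local Notation a c y i := (edot (x (nat_of_ord i)) y + c ord0 i).

Definition logsumexp c y : R := ln (\sum_(i < n.+1) expR (edot (x i) y + c ord0 i)).

Definition softmax c (i : 'I_n.+1) y : R := expR (edot (x i) y + c ord0 i - logsumexp c y).

Let sum_gt0 c y : 0 < \sum_i expR (a c y i).
Proof.
rewrite big_ord_recl ltr_pwDl ?expR_gt0//.
by apply: sumr_ge0 => i _; exact: expR_ge0.
Qed.

Lemma expR_logsumexp c y : expR (logsumexp c y) = \sum_i expR (a c y i).
Proof. by rewrite lnK// posrE sum_gt0. Qed.

Lemma softmax_sum c y : \sum_i softmax c i y = 1.
Proof.
rewrite /softmax; under eq_bigr do rewrite expRD expRN.
by rewrite -mulr_suml -expR_logsumexp divff// gt_eqF// expR_gt0.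
Qed.

Lemma softmax_ge0 c i y : 0 <= softmax c i y.
Proof. exact: expR_ge0. Qed.

Lemma softmax_le1 c i y : softmax c i y <= 1.
Proof.
rewrite -(softmax_sum c y) (bigD1 i)//= lerDl.
by apply: sumr_ge0 => j _; exact: softmax_ge0.
Qed.

Lemma le_logsumexp c y i : a c y i <= logsumexp c y.
Proof.
rewrite -ler_expR expR_logsumexp (bigD1 i)//= lerDl.
by apply: sumr_ge0 => j _; exact: expR_ge0.
Qed.

Lemma logsumexp_lipschitz c c' y (r : R) : (forall i, c ord0 i <= c' ord0 i + r) ->
  logsumexp c y <= logsumexp c' y + r.
Proof.
move=> cc; rewrite -ler_expR expRD !expR_logsumexp mulr_suml.
by apply: ler_sum => i _; rewrite -expRD ler_expR -addrA lerD2l.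
Qed.

(** The number of terms costs [ln n.+1], bounded by [n]; this serves to make [logsumexp]
    integrable. *)
Lemma logsumexp_le c y (b : R) : (forall i, a c y i <= b) -> logsumexp c y <= b + n%:R.
Proof.
move=> ab; rewrite -ler_expR expRD expR_logsumexp.
apply: (@le_trans _ _ (\sum_(i < n.+1) expR b)).
  by apply: ler_sum => i _; rewrite ler_expR.
rewrite sumr_const card_ord -[leLHS]mulr_natr ler_wpM2l ?expR_ge0//.
by rewrite -natr1 addrC expR_ge1Dx.
Qed.

(** [maxaff x _ n] reads only the indices up to [n], where [inord] keeps the value. *)
Local Notation cext c := (fun k : nat => c ord0 (inord k)).

Lemma maxaff_le_logsumexp c y : maxaff x (cext c) n y <= logsumexp c y.
Proof.
rewrite argmaxaffE; set m := argmaxaff _ _ _ _.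
have mn : (m < n.+1)%N by rewrite ltnS argmaxaff_le.
by have := le_logsumexp c y (inord m); rewrite inordK.
Qed.

Lemma logsumexp_le_maxaff c y : logsumexp c y <= maxaff x (cext c) n y + n%:R.
Proof.
apply: logsumexp_le => i; have := @maxaff_ge _ _ x (cext c) n i y.
by rewrite inord_val; apply; rewrite -ltnS.
Qed.

(* [u <= exp u] with [u = logsumexp - a i] bounds each term of the entropy
   of the weights by 1. *)
Lemma logsumexp_softmax c y :
  logsumexp c y <= \sum_i softmax c i y * a c y i + n.+1%:R.
Proof.
rewrite -[leLHS]mul1r -[X in X * logsumexp _ _](softmax_sum c y) mulr_suml.
have -> : n.+1%:R = \sum_(i < n.+1) 1 :> R by rewrite sumr_const card_ord.
rewrite -lerBlDl -sumrB.
apply: ler_sum => i _; rewrite -mulrBr /softmax.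
rewrite -(opprB (logsumexp c y)) expRN mulrC ler_pdivrMr ?expR_gt0// mul1r.
by apply: le_trans (expR_ge1Dx _); rewrite lerDr.
Qed.

Lemma measurable_logsumexp c : measurable_fun setT (logsumexp c).
Proof.
apply: (measurableT_comp (@measurable_ln R)); apply: measurable_sum => i.
by apply: measurableT_comp => //; exact: measurable_affine.
Qed.

Lemma measurable_softmax c i : measurable_fun setT (softmax c i).
Proof.
apply: measurableT_comp => //; apply: measurable_funB; last exact: measurable_logsumexp.
exact: measurable_affine.
Qed.

(** The shift multiplies one exponential by [expR s], and [ln (1 + u) <= u]. Being global, this
    bound integrates directly and replaces differentiation under the integral. *)
Lemma logsumexp_shift c j (s : R) y :
  logsumexp (c + s *: delta_mx 0 j) y <= logsumexp c y + softmax c j y * (expR s - 1).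
Proof.
set c' := c + _.
have sumE : \sum_i expR (a c' y i) =
    expR (logsumexp c y) * (1 + softmax c j y * (expR s - 1)).
  have -> : expR (logsumexp c y) * (1 + softmax c j y * (expR s - 1)) =
      expR (logsumexp c y) + expR (a c y j) * (expR s - 1).
    by rewrite /softmax expRD expRN; field; rewrite gt_eqF// expR_gt0.
  rewrite expR_logsumexp (bigD1 j)//= [in RHS](bigD1 j)//=.
  rewrite /c' !mxE !eqxx mulr1 addrA (expRD (_ + _) s).
  under eq_bigr => i /negPf ij do rewrite !mxE ij andbF mulr0 addr0.
  by ring.
have pos : 0 < 1 + softmax c j y * (expR s - 1).
  by rewrite -(pmulr_rgt0 _ (expR_gt0 (logsumexp c y))) -sumE.
rewrite /logsumexp -/(logsumexp c y) sumE lnM ?posrE ?expR_gt0// expRK lerD2l.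
by apply: le_ln1Dx; lra.
Qed.

Variable nu : probability 'rV[R]_d R.
Hypothesis nu2 : nu.-integrable setT (EFin \o (fun y => edot y y)).

Lemma integrable_logsumexp c : nu.-integrable setT (EFin \o logsumexp c).
Proof.
apply: (@integrable_le _ _ _ _ _ (fun y => `|maxaff x (cext c) n y| + n%:R)).
- exact: measurable_logsumexp.
- move=> y; rewrite ler_norml; apply/andP; split.
    have := maxaff_le_logsumexp c y; have := ler_norm (- maxaff x (cext c) n y).
    by rewrite normrN; have := ler0n R n; lra.
  have := logsumexp_le_maxaff c y; have := ler_norm (maxaff x (cext c) n y); lra.
- apply: EFin_integrableD; last exact: finite_measure_integrable_cst.
  by apply: integrable_norm; exact: integrable_maxaff.
Qed.

Lemma integrable_softmax c i : nu.-integrable setT (EFin \o softmax c i).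
Proof.
apply: (@integrable_le _ _ _ _ _ (cst 1)).
- exact: measurable_softmax.
- by move=> y; rewrite ger0_norm ?softmax_ge0// softmax_le1.
- exact: finite_measure_integrable_cst.
Qed.

Lemma integrable_affine (v : 'rV[R]_d) (b : R) :
  nu.-integrable setT (EFin \o (fun y => edot v y + b)).
Proof. exact: (integrable_maxaff (fun=> v) (fun=> b) 0 nu2). Qed.

Variable p : 'I_n.+1 -> R.
Hypothesis p_gt0 : forall i, 0 < p i.
Hypothesis p_sum : \sum_i p i = 1.

(** The dual functional of entropic transport between [nu] and the weights [p] on the points [x i];
    its partial derivatives are the integrals of [softmax c i] minus [p i]. *)
Let G c : R := \int[nu]_y logsumexp c y - \sum_i p i * c ord0 i.

Let G_lipschitz c c' (r : R) : (forall i, `|c ord0 i - c' ord0 i| <= r) ->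
  G c <= G c' + r + r.
Proof.
move=> cc.
have cr1 i : c ord0 i <= c' ord0 i + r.
  by rewrite -lerBlDl; exact: le_trans (ler_norm _) (cc i).
have cr2 i : c' ord0 i <= c ord0 i + r.
  by rewrite -lerBlDl; apply: le_trans (ler_norm _) _; rewrite distrC.
have h1 : \int[nu]_y logsumexp c y <= \int[nu]_y logsumexp c' y + r.
  rewrite -[X in _ + X](Rintegral_cst1 nu) -RintegralD//; last 2 first.
  - exact: integrable_logsumexp.
  - exact: finite_measure_integrable_cst.
  apply: le_Rintegral => //; first exact: integrable_logsumexp.
    apply: EFin_integrableD; first exact: integrable_logsumexp.
    exact: finite_measure_integrable_cst.
  by move=> y _; exact: logsumexp_lipschitz.
have h2 : \sum_i p i * c' ord0 i <= \sum_i p i * c ord0 i + r.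
  rewrite -[X in _ + X]mul1r -p_sum mulr_suml -big_split /=.
  apply: ler_sum => i _; by rewrite -mulrDr (ler_wpM2l (ltW (p_gt0 i))).
rewrite /G; move: h1 h2.
move: (\int[nu]_y logsumexp c y) (\int[nu]_y logsumexp c' y).
by move: (\sum_i p i * c ord0 i) (\sum_i p i * c' ord0 i) => s s' u u' *; lra.
Qed.

Let G_continuous : continuous G.
Proof.
move=> c; apply/(@cvgrPdist_le _ _ _ _ (nbhs_filter c)) => e e0.
have e2 : 0 < e / 2 by rewrite divr_gt0.
apply: filterS (nbhsx_ballx c _ e2) => c' [_ cc'].
have cc i : `|c ord0 i - c' ord0 i| <= e / 2 by exact: ltW (cc' ord0 i).
have := @G_lipschitz c c' (e / 2) cc; have := @G_lipschitz c' c (e / 2).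
have {}cc' i : `|c' ord0 i - c ord0 i| <= e / 2 by rewrite distrC.
by move=> /(_ cc') h1 h2; rewrite ler_norml; apply/andP; split; lra.
Qed.

Let G_shift c (s : R) : G (c + const_mx s) = G c.
Proof.
rewrite /G (_ : \int[nu]_y _ = \int[nu]_y (logsumexp c y + s)).
  rewrite RintegralD//; [|exact: integrable_logsumexp|exact: finite_measure_integrable_cst].
  rewrite Rintegral_cst1; under [X in _ - X]eq_bigr do rewrite !mxE mulrDr.
  by rewrite big_split/= -mulr_suml p_sum mul1r; lra.
apply: eq_Rintegral => y _; apply/eqP; rewrite eq_le; apply/andP; split.
  by apply: logsumexp_lipschitz => i; rewrite !mxE.
rewrite -lerBrDr; apply: logsumexp_lipschitz => i; rewrite !mxE; lra.
Qed.

Let C : R := \sum_(i < n.+1) `|\int[nu]_y edot (x i) y|.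

(** Coercivity up to shifts: the single exponential of index [j] already bounds [logsumexp] from
    below. *)
Let G_ge c j : c ord0 j - \sum_i p i * c ord0 i - C <= G c.
Proof.
have : \int[nu]_y (edot (x j) y + c ord0 j) <= \int[nu]_y logsumexp c y.
  apply: le_Rintegral => //; [exact: integrable_affine|exact: integrable_logsumexp|].
  by move=> y _; exact: le_logsumexp.
have iaff : nu.-integrable setT (EFin \o (fun y => edot (x j) y)).
  have := integrable_affine (x j) 0; congr integrable.
  by apply/funext => y /=; rewrite addr0.
rewrite RintegralD//; last exact: finite_measure_integrable_cst.
rewrite Rintegral_cst1.
have : `|\int[nu]_y edot (x j) y| <= C by rewrite /C (bigD1 j)//= lerDl sumr_ge0.
rewrite ler_norml => /andP[? _] ?; rewrite /G; lra.
Qed.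

(** The equations are the stationarity conditions of [G], which has a minimum. *)
Lemma softmax_weights_exist : exists c, forall i, \int[nu]_y softmax c i y = p i.
Proof.
(* Every summand is nonnegative, so [p i * B >= G 0 + C] for each [i]; this is what makes [G] at
   least [G 0] when the largest coordinate is [0] and another one is below [- B]. *)
pose B := \sum_i (G 0 + C) / p i.
have GC0 : 0 <= G 0 + C.
  have := G_ge 0 ord0; rewrite mxE big1 => [|i _]; last by rewrite mxE mulr0.
  by lra.
have B0 : 0 <= B by apply: sumr_ge0 => i _; rewrite divr_ge0// ltW.
pose K := [set c : 'rV[R]_n.+1 | forall i, `[- B, 0]%classic (c ord0 i)].
have K0 : K 0 by move=> i; rewrite /= in_itv/= mxE lexx oppr_le0 B0.
have [|||c cK cmin] := @EVT_min_rV R n.+1 G K.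
- by exists 0.
- by apply: (@rV_compact _ _ (fun=> `[- B, 0]%classic)) => i; exact: segment_compact.
- exact: continuous_subspaceT.
(* [G] is invariant under shifts, which reduces [c'] to a nonpositive vector with
   a zero entry; out of [K] it is then at least [G 0]. *)
have Gmin c' : G c <= G c'.
  have [j _ jmax] : extremum_spec (>=%O) xpredT (fun i => c' ord0 i)
      [arg max_(i > ord0) c' ord0 i]%O.
    exact: arg_maxP.
  rewrite -(G_shift c' (- c' ord0 j)); set c'' := c' + _.
  have c''j : c'' ord0 j = 0 by rewrite !mxE subrr.
  have c''0 i : c'' ord0 i <= 0 by rewrite !mxE subr_le0; exact: jmax.
  have [/forallP Kc|] := boolP [forall i, - B <= c'' ord0 i].
    by apply: cmin; rewrite inE => i; rewrite /= in_itv/= Kc c''0.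
  rewrite negb_forall => /existsP[i]; rewrite -ltNge => ciB.
  apply: le_trans (_ : G 0 <= _); first by apply: cmin; rewrite inE.
  have := G_ge c'' j; rewrite c''j sub0r; apply: le_trans.
  have : G 0 + C <= p i * B.
    rewrite mulrC -ler_pdivrMr// /B (bigD1 i)//= lerDl.
    by apply: sumr_ge0 => l _; rewrite divr_ge0// ltW.
  have : \sum_i p i * c'' ord0 i <= p i * c'' ord0 i.
    rewrite (bigD1 i)//= gerDl; apply: sumr_le0 => l _.
    by rewrite mulr_ge0_le0// ltW.
  have : p i * c'' ord0 i <= p i * (- B) by rewrite ler_pM2l// ltW.
  lra.
exists c => j; set m := \int[nu]_y softmax c j y.
(* Minimality along one axis, through [logsumexp_shift]. The right-hand side vanishes at [s = 0]
   with derivative [m - p j]. *)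
have stat s : 0 <= m * (expR s - 1) - p j * s.
  have := Gmin (c + s *: delta_mx 0 j); rewrite /G.
  have -> : \sum_i p i * (c + s *: delta_mx 0 j) ord0 i = \sum_i p i * c ord0 i + p j * s.
    under eq_bigr do rewrite !mxE mulrDr.
    rewrite big_split/=; congr (_ + _); rewrite (bigD1 j)//= eqxx mulr1 big1 ?addr0//.
    by move=> i /negPf ->; rewrite mulr0 mulr0.
  have : \int[nu]_y logsumexp (c + s *: delta_mx 0 j) y <=
      \int[nu]_y (logsumexp c y + softmax c j y * (expR s - 1)).
    apply: le_Rintegral => //; first exact: integrable_logsumexp.
      apply: EFin_integrableD; first exact: integrable_logsumexp.
      under [X in EFin \o X]eq_fun do rewrite mulrC.
      by apply: EFin_integrableZ; exact: integrable_softmax.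
    by move=> y _; exact: logsumexp_shift.
  rewrite RintegralD//; last 2 first.
  - exact: integrable_logsumexp.
  - under [X in EFin \o X]eq_fun do rewrite mulrC.
    by apply: EFin_integrableZ; exact: integrable_softmax.
  rewrite RintegralZr//; last exact: integrable_softmax.
  rewrite -/m; move: (Rintegral _ _ _) (Rintegral _ _ _) (\sum_i _) (m * _) (p j * s).
  by move=> *; lra.
have m0 : 0 <= m by apply: Rintegral_ge0 => y _; exact: softmax_ge0.
have pj := p_gt0 j.
(* [exp (-s) <= 1 / (1 + s)] turns stationarity into [s (p (1 + s) - m) >= 0]. *)
have key s : -1 < s -> 0 <= s * (p j * (1 + s) - m).
  move=> s1; have := stat (- s); have s1' : 0 < 1 + s by lra.
  have : expR (- s) <= (1 + s)^-1.
    by rewrite expRN lef_pV2 ?posrE ?expR_gt0// expR_ge1Dx.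
  move=> h1 h2.
  have : m * expR (- s) <= m * (1 + s)^-1 by rewrite ler_wpM2l.
  move=> h3.
  have : 0 <= (1 + s) * (m * ((1 + s)^-1 - 1) - p j * - s) by rewrite (mulr_ge0 (ltW s1'))//; lra.
  have -> : (1 + s) * (m * ((1 + s)^-1 - 1) - p j * - s) = s * (p j * (1 + s) - m).
    by field; rewrite gt_eqF.
  by [].
apply/eqP; rewrite eq_le; apply/andP; split; rewrite leNgt; apply/negP => h.
(* At this [s] the factor [p j * (1 + s) - m] of [key] is half of [p j - m], of sign opposite to
   [s]. *)
- have s0 : 0 < (m - p j) / (2 * p j) by rewrite divr_gt0; lra.
  have := key ((m - p j) / (2 * p j)); rewrite pmulr_rge0//.
  rewrite (_ : p j * _ - m = (p j - m) / 2); last by field; rewrite gt_eqF.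
  by move=> /(_ _) ?; lra.
- have s0 : 0 < (p j - m) / (2 * p j) by rewrite divr_gt0; lra.
  have := key (- ((p j - m) / (2 * p j))); rewrite mulNr oppr_ge0 pmulr_rle0//.
  rewrite (_ : p j * _ - m = (p j - m) / 2); last by field; rewrite gt_eqF.
  have : (p j - m) / (2 * p j) < 1 by rewrite ltr_pdivrMr; lra.
  by move=> ? /(_ _) ?; lra.
Qed.

End LogSumExp.

(** * Bounded densities and their transfer to an atomless space *)

Section DensityMeasure.
Context {disp : measure_display} {T : measurableType disp} {R : realType}.
Variables (nu : probability T R) (w : T -> R).

(* The two proofs are arguments so that the measure instances can be inferred. *)
Definition density_measure (w01 : forall y, 0 <= w y <= 1)
    (mw : measurable_fun setT w) (A : set T) : \bar R :=
  (\int[nu]_(y in A) (w y)%:E)%E.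

Hypotheses (w01 : forall y, 0 <= w y <= 1) (mw : measurable_fun setT w).

Local Notation k := (density_measure w01 mw).

Let w0 y : (0 <= (w y)%:E)%E.
Proof. by rewrite lee_fin; case/andP: (w01 y). Qed.

Let mwE : measurable_fun setT (EFin \o w).
Proof. exact/measurable_EFinP. Qed.

Let k0 : k set0 = 0%E.
Proof. by rewrite /density_measure integral_set0. Qed.

Let k_ge0 A : (0 <= k A)%E.
Proof. by apply: integral_ge0 => y _. Qed.

Let k_sigma : semi_sigma_additive k.
Proof.
move=> F mF tF mUF; rewrite /density_measure ge0_integral_bigcup//; last first.
  exact: measurable_funTS.
apply: is_cvg_ereal_nneg_natsum_cond => n _ _.
by apply: integral_ge0 => y _.
Qed.

HB.instance Definition _ := isMeasure.Build _ _ _ k k0 k_ge0 k_sigma.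

Let k_le A : measurable A -> (k A <= nu A)%E.
Proof.
move=> mA; rewrite -[leRHS]mul1e -integral_cst//.
apply: ge0_le_integral => //; first exact: measurable_funTS.
by move=> y _; rewrite lee_fin; case/andP: (w01 y).
Qed.

Let k_fin : fin_num_fun k.
Proof.
move=> A mA; rewrite ge0_fin_numE//.
exact: le_lt_trans (k_le mA) (le_lt_trans (probability_le1 nu mA) (ltry 1)).
Qed.

HB.instance Definition _ := Measure_isFinite.Build _ _ _ k k_fin.

Let k_dom : k `<< nu.
Proof.
apply/null_content_dominatesP => A mA nuA0.
by apply/eqP; rewrite eq_le k_ge0 andbT -nuA0 k_le.
Qed.

(** The Radon-Nikodym derivative of [k] is almost everywhere [w], both having the same integrals
    over measurable sets, so the change of variables applies with [w]. *)
Lemma integrable_density_measure (f : T -> \bar R) :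
  nu.-integrable setT f -> k.-integrable setT f.
Proof.
move=> intf; have mf := measurable_int _ intf.
apply/integrableP; split => //.
rewrite -(Radon_Nikodym_SigmaFinite.change_of_variables k_dom)//; last first.
  exact: measurableT_comp.
have -> : (\int[nu]_x (`|f x| * Radon_Nikodym_SigmaFinite.f k nu x) =
           \int[nu]_x (`|f x| * (w x)%:E))%E.
  apply: ae_eq_integral => //.
  - apply: emeasurable_funM; first exact: measurableT_comp.
    by apply: measurable_int (Radon_Nikodym_SigmaFinite.f_integrable _).
  - by apply: emeasurable_funM => //; exact: measurableT_comp.
  - apply: ae_eqe_mul2l; apply: integral_ae_eq => //.
      exact: Radon_Nikodym_SigmaFinite.f_integrable.
    by move=> E _ mE; rewrite -Radon_Nikodym_SigmaFinite.f_integral.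
case/integrableP: intf => _; apply: le_lt_trans; apply: ge0_le_integral => //.
- by move=> y _; rewrite mule_ge0.
- by apply: emeasurable_funM => //; exact: measurableT_comp.
- exact: measurableT_comp.
- move=> y _; rewrite -[leRHS]mule1; apply: lee_wpmul2l => //.
  by rewrite lee_fin; case/andP: (w01 y).
Qed.

Lemma integral_density_measure (f : T -> \bar R) : nu.-integrable setT f ->
  (\int[k]_y f y = \int[nu]_y (f y * (w y)%:E))%E.
Proof.
move=> intf; have mf := measurable_int _ intf.
have kf := integrable_density_measure intf.
rewrite -(Radon_Nikodym_change_of_variables k_dom)//.
apply: ae_eq_integral => //.
- exact: emeasurable_funM.
- exact: emeasurable_funM.
- apply: ae_eqe_mul2l; apply: integral_ae_eq => //.
    exact: Radon_Nikodym_integrable.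
  by move=> E _ mE; rewrite -Radon_Nikodym_integral.
Qed.

End DensityMeasure.

Section TransferWeights.
Context {R : realType} {d : nat}.
Context {disp : measure_display} {T : measurableType disp}.
Variables (P : probability T R) (nu : probability 'rV[R]_d R).
Hypothesis atP : atomless P.

Lemma law_integrable disp' (S : measurableType disp') (Q : probability S R)
    (mu : probability 'rV[R]_d R) (Y : S -> 'rV[R]_d) (f : 'rV[R]_d -> R) :
  measurable_fun setT Y -> (forall B, measurable B -> Q (Y @^-1` B) = mu B) ->
  mu.-integrable setT (EFin \o f) -> Q.-integrable setT (EFin \o (f \o Y)).
Proof.
move=> mY lawY intf; have mf := measurable_int _ intf.
apply/integrableP; split; first exact: measurableT_comp mf mY.
have /integrableP[_] := intf.
rewrite -(@eq_measure_integral _ _ _ _ mu (pushforward Q Y)); last first.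
  by move=> A mA _; exact: lawY.
by rewrite ge0_integral_pushforward// ?preimage_setT//; exact: measurableT_comp.
Qed.

Lemma law_Rintegral disp' (S : measurableType disp') (Q : probability S R)
    (mu : probability 'rV[R]_d R) (Y : S -> 'rV[R]_d) (f : 'rV[R]_d -> R) :
  measurable_fun setT Y -> (forall B, measurable B -> Q (Y @^-1` B) = mu B) ->
  mu.-integrable setT (EFin \o f) -> \int[Q]_w f (Y w) = \int[mu]_y f y.
Proof.
move=> mY lawY intf; have mf := measurable_int _ intf.
rewrite /Rintegral; congr fine.
rewrite -(@eq_measure_integral _ _ _ _ mu (pushforward Q Y)); last first.
  by move=> A mA _; exact: lawY.
by rewrite integral_pushforward//; exact: law_integrable mY lawY intf.
Qed.

(** Both sides integrate [f] against one measure: the image under [Y] of [P] restricted to [A],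
    which has density [w] with respect to [nu]. *)
Lemma Rintegral_partial_law (A : set T) (w : 'rV[R]_d -> R) (Y : T -> 'rV[R]_d)
    (f : 'rV[R]_d -> R) :
  measurable A -> measurable_fun setT w -> (forall y, 0 <= w y <= 1) ->
  measurable_fun setT Y ->
  (forall B, measurable B -> P (A `&` Y @^-1` B) = (\int[nu]_(y in B) (w y)%:E)%E) ->
  nu.-integrable setT (EFin \o f) -> P.-integrable setT (EFin \o (f \o Y)) ->
  \int[P]_v (\1_A v * f (Y v)) = \int[nu]_y (f y * w y).
Proof.
move=> mA mw w01 mY YP intf intfY.
have i01 v : 0 <= (\1_A v : R) <= 1.
  by rewrite indicE; case: (v \in A); rewrite ?lexx ?ler01.
have mi : measurable_fun setT (\1_A : T -> R) by exact: measurable_indic.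
rewrite /Rintegral; congr fine.
transitivity (\int[density_measure P i01 mi]_v (f (Y v))%:E)%E.
  rewrite integral_density_measure//.
  by apply: eq_integral => v _; rewrite -EFinM mulrC.
transitivity (\int[density_measure nu w01 mw]_y (f y)%:E)%E; last first.
  by rewrite integral_density_measure//.
have mf := measurable_int _ intf.
rewrite (@eq_measure_integral _ _ _ _ (pushforward (density_measure P i01 mi) Y)).
  by rewrite integral_pushforward//; exact: integrable_density_measure.
move=> B mB _; rewrite /= /density_measure -YP// /pushforward.
rewrite [RHS]integral_indic//.
by rewrite -[X in measurable X]setTI; exact: mY.
Qed.

Lemma transfer_density (A : set T) (w : 'rV[R]_d -> R) :
  measurable A -> measurable_fun setT w -> (forall y, 0 <= w y <= 1) ->
  \int[nu]_y w y = fine (P A) ->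
  exists Y : T -> 'rV[R]_d, measurable_fun setT Y /\
    forall B, measurable B -> P (A `&` Y @^-1` B) = (\int[nu]_(y in B) (w y)%:E)%E.
Proof.
move=> mA mw w01 wA.
have iw : nu.-integrable setT (EFin \o w).
  apply: (@integrable_le _ _ _ _ _ (cst 1)) => //.
    by move=> y; rewrite ger0_norm; case/andP: (w01 y).
  exact: finite_measure_integrable_cst.
have kA : density_measure nu w01 mw setT = P A.
  by rewrite /density_measure -EFin_Rintegral// wA fineK// fin_num_measure.
have [Y [mY YP]] := atomless_realization atP mA kA.
by exists Y.
Qed.

Lemma sum_indic_preimage (U : Type) (I : finType) (f : I -> R) (g : U -> I) (u : U) :
  f (g u) = \sum_i f i * \1_[set u | g u = i] u.
Proof.
rewrite (bigD1 (g u))//= indicE mem_set// mulr1 big1 ?addr0// => i /eqP iv.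
by rewrite indicE memNset ?mulr0// => iv'; case: iv.
Qed.

Lemma measurable_finite_comp dU dW (U : measurableType dU) (W : measurableType dW)
    (I : finType) (g : U -> I) (f : I -> W) :
  (forall i, measurable [set u | g u = i]) -> measurable_fun setT (f \o g).
Proof.
move=> mg _ B mB; rewrite setTI.
rewrite (_ : _ @^-1` B = \bigcup_i (if `[< B (f i) >] then [set u | g u = i] else set0)).
  apply: countable_bigcupT_measurable => [|i]; first exact: countableP.
  by case: asboolP.
apply/seteqP; split => [u Bu|u [i _]]; first by exists (g u) => //; case: asboolP.
by case: asboolP => // Bi /= gi; rewrite /preimage /= gi.
Qed.

Section FiniteValued.
Context {disp1 : measure_display} {U : measurableType disp1} (M : probability U R).
Context {I : finType} (f : I -> R) {g : U -> I}.
Hypothesis mg : forall i, measurable [set u | g u = i].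

Let fgE : f \o g = fun u => \sum_i f i * \1_[set u | g u = i] u.
Proof. by apply/funext => u; exact: sum_indic_preimage. Qed.

Let indint i : M.-integrable setT (EFin \o \1_[set u | g u = i]).
Proof. exact: integrable_indic. Qed.

Lemma integrable_finite_valued : M.-integrable setT (EFin \o (f \o g)).
Proof.
rewrite fgE; apply: EFin_integrable_sum => i; apply: EFin_integrableZ.
exact: indint.
Qed.

Lemma Rintegral_finite_valued :
  \int[M]_u f (g u) = \sum_i f i * fine (M [set u | g u = i]).
Proof.
transitivity (\int[M]_u \sum_i f i * \1_[set u | g u = i] u).
  by apply: eq_Rintegral => u _; exact: sum_indic_preimage.
rewrite Rintegral_sum; last by move=> i; apply: EFin_integrableZ; exact: indint.
apply: eq_bigr => i _; rewrite RintegralZl//.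
by rewrite /Rintegral integral_indic// setIT.
Qed.

End FiniteValued.

(** On the cell of index [i], [Y] is distributed with density [w i], whose mass is that of the cell.
    These measures add up to [nu], and [w i] becomes the conditional probability of the index given
    [Y]. *)
Lemma transfer_weights n (idx : T -> 'I_n.+1) (w : 'I_n.+1 -> 'rV[R]_d -> R) :
  (forall i, measurable [set v | idx v = i]) ->
  (forall i, measurable_fun setT (w i)) -> (forall i y, 0 <= w i y) ->
  (forall y, \sum_i w i y = 1) ->
  (forall i, \int[nu]_y w i y = fine (P [set v | idx v = i])) ->
  exists Y : T -> 'rV[R]_d, [/\ measurable_fun setT Y,
    forall B, measurable B -> P (Y @^-1` B) = nu B &
    forall i (f : 'rV[R]_d -> R), nu.-integrable setT (EFin \o f) ->
      \int[P]_v (\1_[set v | idx v = i] v * f (Y v)) = \int[nu]_y (f y * w i y)].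
Proof.
move=> mA mw w0 w1 wA.
have w01 i y : 0 <= w i y <= 1.
  rewrite w0 -(w1 y) (bigD1 i)//= lerDl.
  by apply: sumr_ge0 => j _.
have [Z hZ] := choice (fun i => transfer_density (mA i) (mw i) (w01 i) (wA i)).
pose Y v := Z (idx v) v.
have preZ i B : [set v | idx v = i] `&` Y @^-1` B = [set v | idx v = i] `&` Z i @^-1` B.
  by apply/seteqP; split => v [<-].
have mZ i B : measurable B -> measurable ([set v | idx v = i] `&` Z i @^-1` B).
  move=> mB; apply: measurableI => //; rewrite -[X in measurable X]setTI.
  by case: (hZ i) => mZi _; exact: mZi.
have preY B : Y @^-1` B = \bigcup_i ([set v | idx v = i] `&` Y @^-1` B).
  apply/seteqP; split=> [v Bv|v [i _ [_]]//].
  by exists (idx v).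
have mY : measurable_fun setT Y.
  move=> _ B mB; rewrite setTI preY.
  apply: countable_bigcupT_measurable => [|i]; first exact: countableP.
  by rewrite preZ; exact: mZ.
have partY i B : measurable B ->
    P ([set v | idx v = i] `&` Y @^-1` B) = (\int[nu]_(y in B) (w i y)%:E)%E.
  by move=> mB; rewrite preZ; case: (hZ i) => _ ->.
have lawY B : measurable B -> P (Y @^-1` B) = nu B.
  move=> mB; have mYB : measurable (Y @^-1` B).
    by rewrite -[X in measurable X]setTI; exact: mY.
  rewrite -[LHS]mul1e -integral_cst// -[RHS]mul1e -integral_cst//.
  transitivity (\sum_i \int[P]_(v in Y @^-1` B) (\1_[set v | idx v = i] v)%:E)%E.
    rewrite -ge0_integral_sum//; last first.
      by move=> i; apply/measurable_EFinP; exact: measurable_indic.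
    apply: eq_integral => v _; rewrite sumEFin.
    by under eq_bigr do rewrite -[\1_ _ _]mul1r; rewrite -(sum_indic_preimage (fun=> 1)).
  transitivity (\sum_i \int[nu]_(y in B) (w i y)%:E)%E.
    by apply: eq_bigr => i _; rewrite integral_indic//; exact: partY.
  rewrite -ge0_integral_sum//.
  - by apply: eq_integral => y _; rewrite sumEFin w1.
  - by move=> i; apply/measurable_EFinP; exact: measurable_funTS.
  - by move=> i y _; rewrite lee_fin.
exists Y; split => // i f intf.
apply: Rintegral_partial_law => //; first exact: partY.
exact: law_integrable mY lawY intf.
Qed.

(** The potentials [c] come from the smoothed dual. On [Q] they give an upper bound, an affine piece
    being below the maximum; on [P] the softmax weights reach the integral of [logsumexp] up to
    their entropy. The terms in [c] cancel because the two indices have the same law. *)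
Lemma semidiscrete_bound disp' (S : measurableType disp') (Q : probability S R) n
    (x : nat -> 'rV[R]_d) (idx : T -> 'I_n.+1) (jdx : S -> 'I_n.+1) (V : S -> 'rV[R]_d) :
  nu.-integrable setT (EFin \o (fun y => edot y y)) -> sqint Q V ->
  (forall i, measurable [set v | idx v = i]) ->
  (forall i, measurable [set v | jdx v = i]) ->
  (forall i, Q [set v | jdx v = i] = P [set v | idx v = i]) ->
  (forall i, 0 < P [set v | idx v = i])%E ->
  (forall c, \int[Q]_v maxaff x c n (V v) <= \int[nu]_y maxaff x c n y) ->
  exists Y : T -> 'rV[R]_d, [/\ measurable_fun setT Y,
    forall B, measurable B -> P (Y @^-1` B) = nu B &
    \int[Q]_v edot (x (jdx v)) (V v) <= \int[P]_v edot (x (idx v)) (Y v) + n.+1%:R].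
Proof.
move=> nu2 sqV mA mA' AA' A0 leV; pose p i := fine (P [set v | idx v = i]).
have pE i : P [set v | idx v = i] = (p i)%:E by rewrite fineK// fin_num_measure.
have p0 i : 0 < p i by rewrite -lte_fin -pE.
have p1 : \sum_i p i = 1.
  rewrite -(Rintegral_cst1 P 1) (Rintegral_finite_valued P (fun=> 1) mA).
  by apply: eq_bigr => i _; rewrite mul1r.
have [c hc] := softmax_weights_exist x nu2 p0 p1.
have [Y [mY lawY intY]] := transfer_weights mA (measurable_softmax x c)
  (softmax_ge0 x c) (softmax_sum x c) hc.
exists Y; split => //.
pose C := \sum_i p i * c ord0 i.
have intc dd (U : measurableType dd) (M : probability U R) (g : U -> 'I_n.+1) :
    (forall i, measurable [set u | g u = i]) ->
    (forall i, M [set u | g u = i] = P [set v | idx v = i]) ->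
    M.-integrable setT (EFin \o (fun u => c ord0 (g u))) /\
    \int[M]_u c ord0 (g u) = C.
  move=> mg gA; split.
    exact: (integrable_finite_valued M (fun i => c ord0 i) mg).
  rewrite (Rintegral_finite_valued M (fun i => c ord0 i) mg).
  by apply: eq_bigr => i _; rewrite gA mulrC.
have intx dd (U : measurableType dd) (M : probability U R) (g : U -> 'I_n.+1)
    (W : U -> 'rV[R]_d) : sqint M W -> (forall i, measurable [set u | g u = i]) ->
    M.-integrable setT (EFin \o (fun u => edot (x (g u)) (W u))) /\
    \int[M]_u edot (x (g u)) (W u) =
    \sum_i \int[M]_u (\1_[set u | g u = i] u * edot (x i) (W u)).
  move=> sqW mg.
  have E u : edot (x (g u)) (W u) = \sum_i \1_[set u | g u = i] u * edot (x i) (W u).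
    rewrite (sum_indic_preimage (fun i : 'I_n.+1 => edot (x i) (W u)) g u).
    by apply: eq_bigr => i _; rewrite mulrC.
  have it i : M.-integrable setT
      (EFin \o (fun u => \1_[set u | g u = i] u * edot (x i) (W u))).
    apply: EFin_integrableM; first exact: measurable_indic.
      by move=> u; rewrite indicE; case: (_ \in _); rewrite ?lexx ?ler01.
    exact: integrable_edot (sqint_cst _ _) sqW.
  split; last first.
    by rewrite -Rintegral_sum//; apply: eq_Rintegral => u _; exact: E.
  under [X in EFin \o X]eq_fun do rewrite E.
  exact: EFin_integrable_sum.
have sqY : sqint P Y by split => //; exact: law_integrable mY lawY nu2.
have [ixV _] := intx _ _ Q jdx V sqV mA'.
have [ixY xY] := intx _ _ P idx Y sqY mA.
have [icV cV] := intc _ _ Q jdx mA' AA'.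
pose cc := fun k : nat => c ord0 (inord k).
have step1 : \int[Q]_v edot (x (jdx v)) (V v) + C <= \int[nu]_y logsumexp x c y.
  rewrite -cV -RintegralD//.
  apply: (@le_trans _ _ (\int[nu]_y maxaff x cc n y)); last first.
    apply: le_Rintegral => //; [exact: integrable_maxaff|exact: integrable_logsumexp|].
    by move=> y _; exact: maxaff_le_logsumexp.
  apply: le_trans (leV cc); apply: le_Rintegral => //.
  - exact: EFin_integrableD.
  - exact: integrable_maxaff_comp.
  - move=> v _; have := @maxaff_ge _ _ x cc n (jdx v) (V v).
    by rewrite /cc inord_val; apply; rewrite -ltnS.
have step2 : \int[nu]_y logsumexp x c y <= \int[P]_v edot (x (idx v)) (Y v) + C + n.+1%:R.
  have iterm i : nu.-integrable setT
      (EFin \o (fun y => softmax x c i y * (edot (x i) y + c ord0 i))).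
    apply: EFin_integrableM; first exact: measurable_softmax.
      by move=> y; rewrite softmax_ge0 softmax_le1.
    exact: integrable_affine.
  apply: (@le_trans _ _ (\int[nu]_y
      (\sum_i softmax x c i y * (edot (x i) y + c ord0 i) + n.+1%:R))).
    apply: le_Rintegral => //; first exact: integrable_logsumexp.
      apply: EFin_integrableD; last exact: finite_measure_integrable_cst.
      exact: EFin_integrable_sum.
    by move=> y _; exact: logsumexp_softmax.
  rewrite RintegralD//; last 2 first.
  - exact: EFin_integrable_sum.
  - exact: finite_measure_integrable_cst.
  rewrite Rintegral_cst1 lerD2r Rintegral_sum// xY /C -big_split/=.
  apply: ler_sum => i _; rewrite le_eqVlt; apply/orP; left; apply/eqP.
  have iaff : nu.-integrable setT (EFin \o (fun y => edot (x i) y)).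
    have := integrable_affine nu2 (x i) 0; congr integrable.
    by apply/funext => y /=; rewrite addr0.
  rewrite (intY i (fun y => edot (x i) y))//.
  rewrite -hc -RintegralZr; last 2 first.
  - by [].
  - exact: integrable_softmax.
  rewrite -RintegralD//; last 2 first.
  - under [X in EFin \o X]eq_fun do rewrite mulrC.
    apply: EFin_integrableM => //; first exact: measurable_softmax.
    by move=> y; rewrite softmax_ge0 softmax_le1.
  - under [X in EFin \o X]eq_fun do rewrite mulrC.
    by apply: EFin_integrableZ; exact: integrable_softmax.
  by apply: eq_Rintegral => y _; ring.
lra.
Qed.

End TransferWeights.

(** * Transport bound *)

Section Quantization.
Context {R : realType} {d : nat}.

(** With [M = m.+1], the interval from [- M] to [M] is cut into [2 * M ^ 2] pieces of length
    [1 / M]. One extra index collects everything else; [grid_point] sends it to [0]. *)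
Definition grid_index (m : nat) (r : R) : nat :=
  if (- m.+1%:R <= r < m.+1%:R) then Num.truncn ((r + m.+1%:R) * m.+1%:R)
  else (2 * m.+1 ^ 2)%N.

Definition grid_point (m k : nat) : R :=
  if (k < 2 * m.+1 ^ 2)%N then k%:R / m.+1%:R - m.+1%:R else 0.

Lemma grid_index_le m r : (grid_index m r < (2 * m.+1 ^ 2).+1)%N.
Proof.
rewrite /grid_index; case: ifP => // /andP[r1 r2].
rewrite ltnS -(ler_nat R).
have x0 : 0 <= (r + m.+1%:R) * m.+1%:R by rewrite mulr_ge0//; lra.
have /andP[xk _] := truncn_itv x0; apply: le_trans xk _.
rewrite natrM natrX expr2 mulrA ler_wpM2r//; lra.
Qed.

Lemma measurable_grid_index m k : measurable [set r | grid_index m r = k].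
Proof.
pose I : set R := [set` `[- m.+1%:R, m.+1%:R[].
pose J : set R := [set r | k%:R <= (r + m.+1%:R) * m.+1%:R < k.+1%:R].
have mJ : measurable J.
  rewrite (_ : J = (fun r : R => (r + m.+1%:R) * m.+1%:R) @^-1` [set` `[k%:R, k.+1%:R[]).
    rewrite -[X in measurable X]setTI.
    have : measurable_fun setT (fun r : R => (r + m.+1%:R) * m.+1%:R).
      by apply: measurable_funM => //; apply: measurable_funD.
    by apply.
  by apply/seteqP; split => r; rewrite /J /= in_itv.
rewrite (_ : [set r | _] = (I `&` J) `|` (~` I `&` [set r | (2 * m.+1 ^ 2)%N = k])).
  apply: measurableU; apply: measurableI => //.
  - exact: measurable_itv.
  - by apply: measurableC; exact: measurable_itv.
  by have [->|/eqP nm] := eqVneq (2 * m.+1 ^ 2)%N k; [rewrite (_ : [set x | _] = setT)//|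
    rewrite (_ : [set x | _] = set0)//]; apply/seteqP; split => // x /nm.
have truncE r : I r -> (Num.truncn ((r + m.+1%:R) * m.+1%:R) == k) = `[< J r >].
  rewrite /I /= in_itv/= => /andP[r1 r2].
  have x0 : 0 <= (r + m.+1%:R) * m.+1%:R by rewrite mulr_ge0//; lra.
  by rewrite truncn_eq//; apply/idP/asboolP.
apply/seteqP; split => r /=; rewrite /grid_index.
  case: ifP => h; last by right; split => //; rewrite /I /= in_itv/= h.
  have Ir : I r by rewrite /I /= in_itv.
  by move=> /eqP; rewrite truncE// => /asboolP; left.
case=> -[h hr].
  by move: (h); rewrite /I /= in_itv/= => ->; apply/eqP; rewrite truncE//; exact/asboolP.
by case: ifP => // h'; case: h; rewrite /I /= in_itv.
Qed.

Lemma grid_point_near m r : - m.+1%:R <= r < m.+1%:R ->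
  `|r - grid_point m (grid_index m r)| <= m.+1%:R^-1.
Proof.
move=> rI; have := rI; move=> /andP[r1 r2].
have N0 : 0 < m.+1%:R :> R by rewrite ltr0n.
have x0 : 0 <= (r + m.+1%:R) * m.+1%:R by rewrite mulr_ge0//; lra.
rewrite /grid_index rI; set k := Num.truncn _.
have /andP[k1 k2] : k%:R <= (r + m.+1%:R) * m.+1%:R < k.+1%:R by rewrite -truncn_eq.
have kN : (k < 2 * m.+1 ^ 2)%N.
  rewrite -(ltr_nat R); apply: le_lt_trans k1 _.
  by rewrite natrM natrX expr2 mulrA ltr_pM2r//; lra.
rewrite /grid_point kN.
have -> : r - (k%:R / m.+1%:R - m.+1%:R) = ((r + m.+1%:R) * m.+1%:R - k%:R) / m.+1%:R.
  by field; rewrite gt_eqF.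
rewrite normrM ger0_norm; last lra.
rewrite gtr0_norm ?invr_gt0// -[leRHS]mul1r ler_pM2r ?invr_gt0//.
by move: k2; rewrite -natr1; lra.
Qed.

(** Uniform in [m], for dominated convergence; outside the grid the error is [r] itself. *)
Lemma grid_point_dom m r : `|r - grid_point m (grid_index m r)| <= 1 + `|r|.
Proof.
have [rI|rI] := boolP (- m.+1%:R <= r < m.+1%:R).
  apply: le_trans (grid_point_near rI) _.
  have : m.+1%:R^-1 <= 1 :> R by rewrite invf_le1 ?ltr0n// ler1n.
  by move=> h; apply: le_trans h _; rewrite lerDl.
rewrite /grid_index (negbTE rI) /grid_point ltnn subr0; lra.
Qed.

Definition grid_code (m : nat) (y : 'rV[R]_d) : {ffun 'I_d -> 'I_(2 * m.+1 ^ 2).+1} :=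
  [ffun i => Ordinal (grid_index_le m (y ord0 i))].

Definition grid_decode (m : nat) (f : {ffun 'I_d -> 'I_(2 * m.+1 ^ 2).+1}) : 'rV[R]_d :=
  \row_i grid_point m (f i).

Lemma measurable_grid_code m f : measurable [set y | grid_code m y = f].
Proof.
rewrite (_ : [set y | _] = \bigcap_(i in [set: 'I_d])
    ((fun y : 'rV[R]_d => y ord0 i) @^-1` [set r | grid_index m r = f i])).
  apply: fin_bigcap_measurable => [|i _]; first exact: finite_finset.
  rewrite -[X in measurable X]setTI.
  by apply: measurable_coord => //; exact: measurable_grid_index.
apply/seteqP; split => y /=.
  by move=> <- i _ /=; rewrite ffunE.
by move=> h; apply/ffunP => i; rewrite ffunE; apply/val_inj/(h i I).
Qed.

Lemma grid_error_dom m y :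
  edot (y - grid_decode (grid_code m y)) (y - grid_decode (grid_code m y)) <=
  2 * d%:R + 2 * edot y y.
Proof.
apply: (@le_trans _ _ (\sum_(i < d) (2 + 2 * (y ord0 i * y ord0 i)))).
  apply: ler_sum => i _; rewrite -expr2 !mxE ffunE /= -[leLHS]real_normK ?num_real//.
  apply: le_trans (_ : (1 + `|y ord0 i|) ^+ 2 <= _).
    by rewrite lerXn2r ?nnegrE ?addr_ge0//; exact: grid_point_dom.
  have := sqr_ge0 (1 - `|y ord0 i|); rewrite sqrrB sqrrD !expr1n real_normK ?num_real//.
  by rewrite expr2; lra.
by rewrite big_split/= sumr_const card_ord -mulr_sumr lerD2r mulr_natr.
Qed.

Lemma grid_error_cvg y :
  edot (y - grid_decode (grid_code m y)) (y - grid_decode (grid_code m y)) @[m --> \oo] --> 0.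
Proof.
have -> : 0 = \sum_(i < d) 0 :> R by rewrite big1.
rewrite /edot; apply: (@cvg_big _ _ _ 0 predT _ _ _ (index_enum 'I_d)
  (fun i m => (y - grid_decode (grid_code m y)) ord0 i * (y - grid_decode (grid_code m y)) ord0 i))
  => [|i _]; first exact: add_continuous.
rewrite -[X in _ --> X](mul0r 0); suff cv :
    (y - grid_decode (grid_code m y)) ord0 i @[m --> \oo] --> 0 by apply: cvgM.
have [N hN] : exists N : nat, `|y ord0 i| < N.+1%:R.
  by exists (Num.truncn `|y ord0 i|); exact: truncnS_gt.
apply/cvgrPdist_le => e e0; near=> m.
rewrite sub0r normrN !mxE ffunE /=.
have me : m.+1%:R^-1 <= e :> R.
  apply: ltW; near: m; exact: (near_infty_natSinv_lt (PosNum e0)).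
apply: le_trans (grid_point_near _) me.
have : `|y ord0 i| < m.+1%:R.
  apply: lt_le_trans hN _; rewrite ler_nat; near: m; exact: nbhs_infty_ge N.
by rewrite ltr_norml => /andP[/ltW -> ->].
Unshelve. all: by end_near.
Qed.

Lemma measurable_edot_sub disp (T : measurableType disp) (g h : T -> 'rV[R]_d) :
  measurable_fun setT g -> measurable_fun setT h ->
  measurable_fun setT (fun w => edot (g w - h w) (g w - h w)).
Proof.
move=> mg mh; have mgh : measurable_fun setT (fun w => g w - h w).
  rewrite (_ : (fun w => _) = fun w => 1 *: g w + (-1) *: h w).
    exact: measurable_lincomb.
  by apply/funext => w; rewrite scale1r scaleN1r.
exact: measurable_edot.
Qed.

Lemma grid_error_small (mu : probability 'rV[R]_d R) (e : R) :
  mu.-integrable setT (EFin \o (fun y => edot y y)) -> 0 < e ->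
  exists m, \int[mu]_y
    edot (y - grid_decode (grid_code m y)) (y - grid_decode (grid_code m y)) <= e.
Proof.
move=> mu2 e0.
pose f m y := edot (y - grid_decode (grid_code m y)) (y - grid_decode (grid_code m y)).
have mdec m : measurable_fun setT (fun y => grid_decode (grid_code m y)).
  apply: (measurable_finite_comp (g := @grid_code m)); exact: measurable_grid_code.
have mf m : measurable_fun setT (f m).
  exact: measurable_edot_sub.
have ig : mu.-integrable setT (EFin \o (fun y => 2 * d%:R + 2 * edot y y)).
  apply: EFin_integrableD; first exact: finite_measure_integrable_cst.
  exact: EFin_integrableZ.
have iF m : mu.-integrable setT (EFin \o f m).
  apply: integrable_le ig => // y.
  by rewrite ger0_norm ?edot_ge0//; exact: grid_error_dom.
have [||_ _] := @dominated_convergence _ _ _ mu setT measurableT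
  (fun m => EFin \o f m) (cst 0%E) (EFin \o (fun y => 2 * d%:R + 2 * edot y y))
  (fun m => measurable_int _ (iF m)) (measurable_cst _) _ ig _.
- by apply/aeW => y _; apply/cvg_EFin; [near=> m|exact: grid_error_cvg].
- apply/aeW => y m _; rewrite /= lee_fin ger0_norm ?edot_ge0//.
  exact: grid_error_dom.
rewrite integral0 => /fine_cvgP[_ /cvgrPdist_le/(_ _ e0)[m _ hm]]; exists m.
have := hm m (leqnn m); rewrite /= sub0r normrN.
by apply: le_trans; exact: ler_norm.
Unshelve. all: by end_near.
Qed.

(** Null cells are dropped because [softmax_weights_exist] assumes positive weights; at least one
    cell remains. *)
Lemma quantization (mu : probability 'rV[R]_d R) (e : R) :
  mu.-integrable setT (EFin \o (fun y => edot y y)) -> 0 < e ->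
  exists n (x : nat -> 'rV[R]_d) (s : 'rV[R]_d -> 'I_n.+1),
    [/\ forall i, measurable [set y | s y = i],
      forall i, (0 < mu [set y | s y = i])%E &
      \int[mu]_y edot (y - x (s y)) (y - x (s y)) <= e].
Proof.
move=> mu2 e0; have [m hm] := grid_error_small mu2 e0.
pose I := {ffun 'I_d -> 'I_(2 * m.+1 ^ 2).+1}.
pose code : 'rV[R]_d -> I := @grid_code m.
pose l := [seq c <- enum I | (0 < mu [set y | code y = c])%E].
have lP c : (c \in l) = (0 < mu [set y | code y = c])%E by rewrite mem_filter mem_enum andbT.
have ael : \forall y \ae mu, code y \in l.
  have : \forall y \ae mu, forall c, c \notin l -> code y <> c.
    apply: filter_forall => c; have [cl|cl] := boolP (c \in l); first exact: aeW.
    exists [set y | code y = c]; split; first exact: measurable_grid_code.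
      move: cl; rewrite lP -leNgt => h; apply/eqP; rewrite eq_le h; exact: measure_ge0.
    by move=> y /= h; apply: contrapT => h'; apply: h.
  apply: filterS => y h; apply: contrapT => /negP /h; exact.
have : l != [::].
  apply/eqP => l0; case: ael => N [mN N0 sub].
  have NT : N = setT by apply/seteqP; split => // y _; apply: sub => /=; rewrite l0.
  by move: N0; rewrite NT probability_setT => /eqP; rewrite onee_eq0.
case lE : l => [//|c0 l'] _; pose n := size l'.
have szl : size l = n.+1 by rewrite lE.
(* Null cells go to index [0], which moves the decoded point only on a null set. *)
pose tau (c : I) : 'I_n.+1 := inord (if c \in l then index c l else 0).
exists n, (fun j => grid_decode (nth c0 l j)), (tau \o code).
have mtau i : measurable [set y | (tau \o code) y = i].
  rewrite (_ : [set y | _] = \bigcup_c (if tau c == i then [set y | code y = c] else set0)).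
    apply: countable_bigcupT_measurable => [|c]; first exact: countableP.
    by case: eqP => // _; exact: measurable_grid_code.
  apply/seteqP; split => [y /= yi|y [c _]]; first by exists (code y) => //; rewrite yi eqxx.
  by case: eqP => // ci /= yc; rewrite /= yc.
split => //.
- move=> i; have il : nth c0 l i \in l by rewrite mem_nth// szl.
  have := il; rewrite lP => /lt_le_trans; apply.
  apply: le_measure; rewrite ?inE; [exact: measurable_grid_code|exact: mtau|].
  move=> y /= yi; apply/val_inj; rewrite /tau yi il index_uniq ?szl//=.
    by rewrite inordK.
  by rewrite filter_uniq// enum_uniq.
- apply: le_trans hm; rewrite le_eqVlt; apply/orP; left; apply/eqP.
  rewrite /Rintegral; congr fine; apply: ae_eq_integral => //.
  - apply/measurable_EFinP; apply: measurable_edot_sub; first exact: measurable_id.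
    exact: (@measurable_finite_comp _ _ _ _ _ (tau \o code)
      (fun i : 'I_n.+1 => grid_decode (nth c0 l i))).
  - apply/measurable_EFinP; apply: measurable_edot_sub; first exact: measurable_id.
    by apply: (measurable_finite_comp (g := code)); exact: measurable_grid_code.
  - apply: filterS ael => y yl _; suff -> : nth c0 l ((tau \o code) y) = code y by [].
    by rewrite /= /tau yl inordK ?nth_index// -szl index_mem.
Qed.

End Quantization.

Section LawSqint.
Context {disp : measure_display} {T : measurableType disp} {R : realType} {d : nat}.
Variables (P : probability T R) (mu : probability 'rV[R]_d R) (X : T -> 'rV[R]_d).
Hypotheses (mX : measurable_fun setT X)
  (lawX : forall B, measurable B -> P (X @^-1` B) = mu B)
  (mu2 : mu.-integrable setT (EFin \o (fun y => edot y y))).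

Lemma law_sqint : sqint P X.
Proof. by split => //; exact: law_integrable mX lawX mu2. Qed.

Lemma law_ip : ip P X X = \int[mu]_y edot y y.
Proof. exact: (law_Rintegral mX lawX mu2). Qed.

End LawSqint.

Section TransportBound.
Context {R : realType} {d : nat}.
Context {disp : measure_display} {T : measurableType disp}.
Variables (P : probability T R) (mu nu : probability 'rV[R]_d R).
Hypotheses (atP : atomless P)
  (mu2 : mu.-integrable setT (EFin \o (fun y => edot y y)))
  (nu2 : nu.-integrable setT (EFin \o (fun y => edot y y))).
Context {disp' : measure_display} {S : measurableType disp'}.
Variable Q : probability S R.

(** [X] and [U] are rounded by the same map [q], the rounded vectors are compared by
    [semidiscrete_bound], and Cauchy-Schwarz pays for the rounding on each side. *)
Lemma transport_bound (X : T -> 'rV[R]_d) (U V : S -> 'rV[R]_d) (e : R) :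
  measurable_fun setT X -> (forall B, measurable B -> P (X @^-1` B) = mu B) ->
  measurable_fun setT U -> (forall B, measurable B -> Q (U @^-1` B) = mu B) ->
  sqint Q V ->
  (forall g c n, \int[Q]_v maxaff g c n (V v) <= \int[nu]_y maxaff g c n y) ->
  0 < e ->
  exists Y : T -> 'rV[R]_d, [/\ measurable_fun setT Y,
    forall B, measurable B -> P (Y @^-1` B) = nu B & ip Q U V <= ip P X Y + e].
Proof.
move=> mX lawX mU lawU sqV leV e0.
have sqX := law_sqint mX lawX mu2; have sqU := law_sqint mU lawU mu2.
pose b := Num.sqrt (\int[nu]_y edot y y); pose bV := Num.sqrt (ip Q V V).
have b0 : 0 <= b by exact: sqrtr_ge0.
have bV0 : 0 <= bV by exact: sqrtr_ge0.
(* Rounding costs [r * b] on [P] and [r * bV] on [Q], together at most [e / 2]; smoothing takes the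
   other half. The [1] keeps [M] positive. *)
pose M := b + bV + 1; have M0 : 0 < M by rewrite /M; lra.
pose r := e / (2 * M); have r0 : 0 < r by rewrite divr_gt0//; lra.
have [n [x [s [ms s0 err]]]] := quantization mu2 (exprn_gt0 2 r0).
pose q y := x (s y).
have mq : measurable_fun setT q.
  exact: (@measurable_finite_comp _ _ _ _ _ s (fun i : 'I_n.+1 => x i)).
have preS dd (W : measurableType dd) (Z : W -> 'rV[R]_d) i :
    measurable_fun setT Z -> measurable [set v | (s \o Z) v = i].
  move=> mZ; rewrite (_ : [set v | _] = Z @^-1` [set y | s y = i])//.
  by rewrite -[X in measurable X]setTI; exact: mZ.
have sqq dd (W : measurableType dd) (N : probability W R) (Z : W -> 'rV[R]_d) :
    measurable_fun setT Z -> sqint N (q \o Z).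
  move=> mZ; split; first exact: measurableT_comp mq mZ.
  have mi i : measurable [set v | (s \o Z) v = i] by exact: preS.
  exact: (integrable_finite_valued N (fun i : 'I_n.+1 => edot (x i) (x i)) mi).
have errE dd (W : measurableType dd) (N : probability W R) (Z : W -> 'rV[R]_d) :
    measurable_fun setT Z -> (forall B, measurable B -> N (Z @^-1` B) = mu B) ->
    Num.sqrt (ip N (Z - (q \o Z)) (Z - (q \o Z))) <= r.
  move=> mZ lawZ; rewrite -[leRHS](ger0_norm (ltW r0)) -sqrtr_sqr ler_wsqrtr//.
  apply: le_trans err; rewrite le_eqVlt; apply/orP; left; apply/eqP.
  apply: (law_Rintegral (f := fun y => edot (y - q y) (y - q y)) mZ lawZ).
  have [] // := @sqintB _ _ _ _ mu id (q \o id).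
  by apply: sqq; exact: measurable_id.
(* The error [n.+1] of [semidiscrete_bound] does not depend on the points [x j], so it is
   absorbed by scaling them. *)
pose k : R := 2 * n.+1%:R / e.
have k0 : 0 < k by rewrite divr_gt0// mulr_gt0// ltr0n.
have [|||||Y [mY lawY leY]] := @semidiscrete_bound _ _ _ _ P nu atP _ _ Q n
    (fun j => k *: x j) (s \o X) (s \o U) V nu2 sqV.
- by move=> i; exact: preS.
- by move=> i; exact: preS.
- by move=> i; transitivity (mu [set y | s y = i]); [exact: lawU|apply/esym; exact: lawX].
- by move=> i; have := s0 i; rewrite -lawX.
- by move=> c; exact: leV.
exists Y; split => //.
have sqY := law_sqint mY lawY nu2.
have ipY := law_ip mY lawY nu2.
have scale dd (W : measurableType dd) (N : probability W R) (Z Z' : W -> 'rV[R]_d) :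
    measurable_fun setT Z -> sqint N Z' ->
    \int[N]_v edot (k *: x (s (Z v))) (Z' v) = k * ip N (q \o Z) Z'.
  move=> mZ sqZ'; rewrite -ipZl//; exact: sqq.
have {leY} : ip Q (q \o U) V <= ip P (q \o X) Y + e / 2.
  move: leY; rewrite /= !scale// => leY.
  rewrite -(ler_pM2l k0) mulrDr; apply: le_trans leY _; rewrite lerD2l.
  by rewrite /k le_eqVlt; apply/orP; left; apply/eqP; field; rewrite gt_eqF.
have split dd (W : measurableType dd) (N : probability W R) (Z Z' : W -> 'rV[R]_d) :
    measurable_fun setT Z -> (forall B, measurable B -> N (Z @^-1` B) = mu B) ->
    sqint N Z' ->
    `|ip N Z Z' - ip N (q \o Z) Z'| <= r * Num.sqrt (ip N Z' Z').
  move=> mZ lawZ sqZ'; have sqZ := law_sqint mZ lawZ mu2.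
  have sqqZ := sqq _ _ N Z mZ.
  rewrite -ipBl//; apply: le_trans (ip_CauchySchwarz _ _) _ => //.
    exact: sqintB.
  by rewrite ler_wpM2r ?sqrtr_ge0//; exact: errE.
have := split _ _ Q U V mU lawU sqV; have := split _ _ P X Y mX lawX sqY.
rewrite ipY -/b -/bV => /ler_normlP[hX _] /ler_normlP[_ hU].
have rM : r * (b + bV) <= e / 2.
  have -> : e / 2 = r * M by rewrite /r; field; rewrite gt_eqF.
  by rewrite ler_wpM2l ?ltW// /M; lra.
by move=> h; lra.
Qed.

End TransportBound.

(** * Nearest residual *)

Section L2Norm.
Context {disp : measure_display} {T : measurableType disp} {R : realType}.
Context {d : nat} (P : probability T R).
Implicit Types X Y Z : T -> 'rV[R]_d.

Definition nrm X : R := Num.sqrt (ip P X X).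

Lemma nrm_ge0 X : 0 <= nrm X. Proof. exact: sqrtr_ge0. Qed.

Lemma nrm_sqr X : nrm X ^+ 2 = ip P X X. Proof. by rewrite sqr_sqrtr ?ip_ge0. Qed.

Lemma ip_le_nrm X Y : sqint P X -> sqint P Y -> ip P X Y <= nrm X * nrm Y.
Proof. by move=> *; apply: le_trans (ler_norm _) _; exact: ip_CauchySchwarz. Qed.

Lemma nrmD X Y : sqint P X -> sqint P Y -> nrm (X + Y) <= nrm X + nrm Y.
Proof.
move=> sX sY; rewrite -(@ler_pXn2r _ 2)// ?nnegrE ?addr_ge0 ?nrm_ge0//.
rewrite nrm_sqr ip_sqrD// sqrrD !nrm_sqr; have := ip_le_nrm sX sY; lra.
Qed.

Lemma nrmZ a X : sqint P X -> nrm (a *: X) = `|a| * nrm X.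
Proof.
move=> sX; rewrite /nrm ipZl ?ipZr//; last exact: sqintZ.
by rewrite mulrA -expr2 sqrtrM ?sqr_ge0// sqrtr_sqr.
Qed.

Lemma nrm_sum (I : Type) (r : seq I) (F : I -> T -> 'rV[R]_d) :
  (forall k, sqint P (F k)) -> nrm (\sum_(k <- r) F k) <= \sum_(k <- r) nrm (F k).
Proof.
move=> sF; elim: r => [|k r IH]; first by rewrite !big_nil /nrm ip0l sqrtr0.
rewrite !big_cons; apply: le_trans (nrmD _ _) _ => //; first exact: sqint_sum.
by rewrite lerD2l.
Qed.

(** The weights are written [a] and [1 - a], as in the convexity of the feasible sets. *)
Lemma ip_midpoint X Y : sqint P X -> sqint P Y ->
  4 * ip P (2^-1 *: X + (1 - 2^-1) *: Y) (2^-1 *: X + (1 - 2^-1) *: Y) =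
  ip P X X + 2 * ip P X Y + ip P Y Y.
Proof.
move=> sX sY; have -> : 1 - 2^-1 = 2^-1 :> R by lra.
have sXY := sqintD sX sY; rewrite -scalerDr ipZl ?ipZr//; last exact: sqintZ.
by rewrite ip_sqrD//; field.
Qed.

(** The squared norm does not decrease when leaving [X] towards [Y], so its derivative there is
    nonnegative. *)
Lemma ip_variational X Y : sqint P X -> sqint P Y ->
  (forall s, 0 <= s <= 1 ->
    ip P X X <= ip P (s *: Y + (1 - s) *: X) (s *: Y + (1 - s) *: X)) ->
  ip P X X <= ip P X Y.
Proof.
move=> sX sY minX; pose D := Y - X; have sD : sqint P D by exact: sqintB.
have key s : 0 <= s <= 1 -> 0 <= s * (2 * ip P X D + s * ip P D D).
  move=> s01; have := minX s s01.
  have -> : s *: Y + (1 - s) *: X = X + s *: D.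
    by rewrite /D scalerBr scalerBl scale1r addrCA.
  have ssD := sqintZ s sD.
  by rewrite (ip_sqrD sX ssD) (ipZr s sX sD) (ipZl s sD ssD) (ipZr s sD sD); lra.
rewrite leNgt; apply/negP => lt.
have h0 : ip P X D < 0 by rewrite (ipBr sY sX sX); lra.
have DD := ip_ge0 P D.
(* So small that [s * ip P D D] cannot compensate [2 * ip P X D]; the [1] in the denominator
   prevents a division by zero. *)
pose s := Num.min 1 (- ip P X D / (ip P D D + 1)).
have s0 : 0 < s by rewrite lt_min ltr01 divr_gt0//; lra.
have s1 : s <= 1 by rewrite ge_min lexx.
have := key s; rewrite s1 (ltW s0) => /(_ isT); rewrite pmulr_rge0//.
have : s * (ip P D D + 1) <= - ip P X D.
  by rewrite -ler_pdivlMr; [rewrite ge_min lexx orbT|lra].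
lra.
Qed.

End L2Norm.

Section NearestResidual.
Context {disp : measure_display} {T : measurableType disp} {R : realType}.
Context {d K : nat} (P : probability T R).
Local Notation rvec := (T -> 'rV[R]_d).
Variables (C : 'I_K -> set rvec) (B : R).
Hypotheses (C_sqint : forall k Z, C k Z -> sqint P Z)
  (C_nonempty : forall k, C k !=set0)
  (C_convex : forall k a Z W, 0 <= a <= 1 -> C k Z -> C k W -> C k (a *: Z + (1 - a) *: W))
  (C_closed : forall k (Zs : nat -> rvec) Z, (forall n, C k (Zs n)) -> sqint P Z ->
    (forall e, 0 < e -> exists n, ip P (Zs n - Z) (Zs n - Z) <= e) -> C k Z)
  (C_bounded : forall k Z, C k Z -> ip P Z Z <= B).
Variables (Y : rvec) (b : 'I_K -> R).
Hypothesis sqY : sqint P Y.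

Local Notation feasible Z := (forall k, C k (Z k)).

Definition affine_residual (Z : 'I_K -> rvec) : rvec := Y - \sum_k b k *: Z k.

Local Notation res := affine_residual.

Lemma affine_residual_sqint Z : (forall k, sqint P (Z k)) -> sqint P (res Z).
Proof. by move=> sZ; apply: sqintB => //; apply: sqint_sum => k; exact: sqintZ. Qed.

Lemma affine_residual_combination a Z W :
  res (fun k => a *: Z k + (1 - a) *: W k) = a *: res Z + (1 - a) *: res W.
Proof.
rewrite /res.
have -> : \sum_k b k *: (a *: Z k + (1 - a) *: W k) =
    a *: (\sum_k b k *: Z k) + (1 - a) *: (\sum_k b k *: W k).
  rewrite !scaler_sumr -big_split; apply: eq_bigr => k _ /=.
  by rewrite scalerDr !scalerA ![b k * _]mulrC.
by rewrite !scalerBr addrACA -scalerDl [a + _]addrC subrK scale1r opprD.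
Qed.

Local Notation J Z := (ip P (res Z) (res Z)).

Lemma feasible_combination a Z W : 0 <= a <= 1 -> feasible Z -> feasible W ->
  feasible (fun k => a *: Z k + (1 - a) *: W k).
Proof. by move=> a01 fZ fW k; exact: C_convex. Qed.

Lemma nearest_residual_variational Z : feasible Z -> (forall W, feasible W -> J Z <= J W) ->
  forall W, feasible W -> ip P (res Z) (res Z) <= ip P (res Z) (res W).
Proof.
move=> fZ minZ W fW.
apply: ip_variational => [||s s01].
- by apply: affine_residual_sqint => k; exact: C_sqint (fZ k).
- by apply: affine_residual_sqint => k; exact: C_sqint (fW k).
- rewrite -affine_residual_combination; apply: minZ => k.
  exact: feasible_combination.
Qed.

Lemma nearest_residual_exists :
  exists Z, feasible Z /\ forall W, feasible W -> J Z <= J W.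
Proof.
have [Z0 fZ0] : exists Z : 'I_K -> rvec, feasible Z.
  have /choice[Z hZ] : forall k, exists Z, C k Z by move=> k; exact: C_nonempty.
  by exists Z.
pose SJ := [set J Z | Z in [set Z : 'I_K -> rvec | feasible Z]].
have hasJ : has_inf SJ.
  by split; [exists (J Z0), Z0|exists 0 => _ [Z _ <-]; exact: ip_ge0].
pose I := inf SJ.
have leI Z : feasible Z -> I <= J Z.
  by move=> fZ; apply: ge_inf; [case: hasJ|exists Z].
have I0 : 0 <= I by apply: lb_le_inf; [case: hasJ|move=> _ [Z _ <-]; exact: ip_ge0].
(* The residual determines only a combination of the [Z k]; taking nearly minimal
   norms among nearly optimal families makes each [Z k] converge. *)
pose N (Z : 'I_K -> rvec) := \sum_k ip P (Z k) (Z k).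
pose ep (n : nat) : R := n.+1%:R^-1.
have ep0 n : 0 < ep n by rewrite invr_gt0 ltr0n.
pose D n := [set Z : 'I_K -> rvec | feasible Z /\ J Z <= I + ep n].
pose SN n := [set N Z | Z in D n].
have hasN n : has_inf (SN n).
  split; last first.
    by exists 0 => _ [Z _ <-]; apply: sumr_ge0 => k _; exact: ip_ge0.
  have [_ [Z fZ <-] lt] := inf_adherent (ep0 n) hasJ.
  by exists (N Z), Z => //; split => //; exact: ltW.
pose m n := inf (SN n).
have [z hz] : exists z : nat -> 'I_K -> rvec, forall n, D n (z n) /\ N (z n) <= m n + ep n.
  have /choice[z hz] : forall n, exists Z, D n Z /\ N Z <= m n + ep n.
    move=> n; have [_ [Z DZ <-] lt] := inf_adherent (ep0 n) (hasN n).
    by exists Z; split => //; exact: ltW.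
  by exists z.
have ep_le n l : (n <= l)%N -> ep l <= ep n.
  by move=> nl; rewrite lef_pV2 ?posrE ?ltr0n// ler_nat.
have D_le n l : (n <= l)%N -> D l `<=` D n.
  by move=> nl Z [fZ JZ]; split => //; apply: le_trans JZ _; rewrite lerD2l ep_le.
have m_le n l : (n <= l)%N -> m n <= m l.
  move=> nl; apply: lb_le_inf; first by case: (hasN l).
  by move=> _ [Z DZ <-]; apply: ge_inf; [case: (hasN n)|exists Z => //; exact: D_le DZ].
have m_bd n : m n <= K%:R * B.
  have [[fZ _] _] := hz n.
  apply: (@le_trans _ _ (N (z n))).
    by apply: ge_inf; [case: (hasN n)|exists (z n) => //; case: (hz n)].
  rewrite mulr_natl -[X in _ *+ X]card_ord -sumr_const.
  by apply: ler_sum => k _; exact: C_bounded (fZ k).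
pose M := sup (range m).
have hasM : has_sup (range m).
  by split; [exists (m 0%N), 0%N|exists (K%:R * B) => _ [n _ <-]].
have mM n : m n <= M by apply: sup_upper_bound => //; exists n.
have sz n k : sqint P (z n k) by have [[fZ _] _] := hz n; exact: C_sqint (fZ k).
have half01 : 0 <= (2^-1 : R) <= 1 by apply/andP; split; lra.
(* Parallelogram identity for [N]: the midpoint of [z n] and [z l] stays in [D n] by convexity of
   the squared norm, so its value of [N] is at least [m n]. *)
have close n l : (n <= l)%N ->
    \sum_k ip P (z n k - z l k) (z n k - z l k) <= 2 * (m n + ep n) + 2 * (m l + ep n) - 4 * m n.
  move=> nl; have [[fn Jn] Nn] := hz n; have [Dl Nl] := hz l.
  have [fl Jl] := D_le _ _ nl _ Dl.
  pose w k := 2^-1 *: z n k + (1 - 2^-1) *: z l k.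
  have fw : feasible w by exact: feasible_combination.
  have Jw : J w <= I + ep n.
    rewrite /w affine_residual_combination.
    have s1 := affine_residual_sqint (fun k => sz n k).
    have s2 := affine_residual_sqint (fun k => sz l k).
    have := ip_midpoint s1 s2; have := ip_le s1 s2.
    by move: (ip P _ _) (ip P _ _) (ip P _ _) (ip P _ _) Jn Jl => *; lra.
  have mw : m n <= N w by apply: ge_inf; [case: (hasN n)|exists w].
  have par : \sum_k ip P (z n k - z l k) (z n k - z l k) = 2 * N (z n) + 2 * N (z l) - 4 * N w.
    rewrite /N !mulr_sumr -big_split -sumrB; apply: eq_bigr => k _ /=.
    have s1 := sz n k; have s2 := sz l k.
    rewrite (ip_midpoint s1 s2) (ip_sqrB s1 s2).
    by move: (ip P _ _) (ip P _ _) (ip P _ _) => u v w'; ring.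
  rewrite par; apply: lerB; last by rewrite ler_pM2l.
  by apply: lerD; rewrite ler_pM2l//; apply: le_trans Nl _; rewrite lerD2l; exact: ep_le.
have cauchy k e : 0 < e -> exists N0, forall n l, (N0 <= n)%N -> (N0 <= l)%N ->
    ip P (z n k - z l k) (z n k - z l k) <= e.
  (* [close] leaves [2 * (m l - m n) + 4 * ep n], hence the sixths. *)
  move=> e0; have e6 : 0 < e / 6 by rewrite divr_gt0.
  have [_ [n1 _ <-] hn1] := sup_adherent e6 hasM.
  have [n2 _ hn2] := near_infty_natSinv_lt (PosNum e6).
  pose N0 := maxn n1 n2.
  have main n l : (N0 <= n)%N -> (n <= l)%N -> ip P (z n k - z l k) (z n k - z l k) <= e.
    move=> n0 nl; apply: le_trans (_ : \sum_k ip P (z n k - z l k) (z n k - z l k) <= _).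
      by rewrite (bigD1 k)//= lerDl; apply: sumr_ge0 => j _; exact: ip_ge0.
    apply: le_trans (close _ _ nl) _.
    have h1 : m n1 <= m n by apply: m_le; rewrite (leq_trans _ n0)// leq_maxl.
    have h2 : ep n < e / 6 by apply: hn2 => /=; rewrite (leq_trans _ n0)// leq_maxr.
    have := mM l; rewrite -/M in hn1; lra.
  exists N0 => n l n0 l0; have [nl|/ltnW ln] := leqP n l; first exact: main.
  rewrite (_ : ip P _ _ = ip P (z l k - z n k) (z l k - z n k)); first exact: main.
  have s1 := sz n k; have s2 := sz l k.
  by rewrite !ip_sqrB// (ipC _ (z l k)); ring.
have /choice[Z hZ] k := sqint_complete (fun n => sz n k) (cauchy k).
have fZ : feasible Z.
  move=> k; apply: (C_closed (Zs := fun n => z n k)).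
  - by move=> n; have [[fz _] _] := hz n; exact: fz.
  - by case: (hZ k).
  - move=> e e0; case: (hZ k) => _ /(_ e e0)[n0 hn0].
    by exists n0; exact: hn0.
exists Z; split; [exact: fZ|move=> W fW; apply: le_trans (leI _ fW)].
pose a := nrm P (res Z).
have a0 : 0 <= a by exact: nrm_ge0.
rewrite -nrm_sqr -/a.
(* For large [n], [res (z n)] has norm at most [Num.sqrt (I + e)], and [res Z] is within [e] of it:
   an error [e / L] on each [Z k] adds up to at most [e]. *)
have approx e : 0 < e -> a <= Num.sqrt (I + e) + e.
  move=> e0; pose L := \sum_k `|b k| + 1.
  have L0 : 0 < L by rewrite ltr_wpDl// sumr_ge0.
  have eL : 0 < e / L by rewrite divr_gt0.
  have /choice[n1 hn1] : forall k, exists n0, forall n, (n0 <= n)%N -> nrm P (z n k - Z k) <= e / L.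
    move=> k; case: (hZ k) => _ /(_ _ (exprn_gt0 2 eL))[n0 hn0].
    exists n0 => n /hn0 h; rewrite -(@ler_pXn2r _ 2)// ?nnegrE ?nrm_ge0 ?(ltW eL)//.
    by rewrite nrm_sqr.
  have [n2 _ hn2] := near_infty_natSinv_lt (PosNum e0).
  pose n := (\sum_k n1 k + n2)%N.
  have sR := affine_residual_sqint (fun k => sz n k).
  have sd k : sqint P (b k *: (z n k - Z k)).
    by apply: sqintZ; apply: sqintB => //; case: (hZ k).
  have -> : a = nrm P (res (z n) + \sum_k b k *: (z n k - Z k)).
    rewrite /a; congr nrm; rewrite /res -addrA; congr (_ + _).
    under [X in _ + X]eq_bigr do rewrite scalerBr.
    by rewrite sumrB addrA addNr add0r.
  apply: le_trans (nrmD _ _) _ => //; first exact: sqint_sum.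
  apply: lerD.
    rewrite ler_wsqrtr//; have [[_ Jn] _] := hz n.
    apply: le_trans Jn _; rewrite lerD2l ltW//; apply: hn2 => /=.
    by rewrite leq_addl.
  apply: le_trans (nrm_sum _ _) _ => //.
  apply: le_trans (_ : \sum_k `|b k| * (e / L) <= _).
    apply: ler_sum => k _; rewrite nrmZ; last by apply: sqintB => //; case: (hZ k).
    rewrite ler_wpM2l// hn1// (leq_trans _ (leq_addr _ _))//.
    by rewrite (bigD1 k)//= leq_addr.
  rewrite -mulr_suml mulrA ler_pdivrMr// mulrC ler_pM2l//.
  by rewrite /L lerDl.
(* Squaring [a - e <= Num.sqrt (I + e)] requires [e <= a]; otherwise [a * a <= e * a] is enough. *)
have sqle e : 0 < e -> a ^+ 2 <= I + e * (1 + 2 * a).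
  move=> e0; have := approx e e0; rewrite -lerBlDr => h.
  have [ae|ae] := leP e a.
    have := @lerXn2r R 2 (a - e) (Num.sqrt (I + e)).
    rewrite !nnegrE subr_ge0 sqrtr_ge0 ae => /(_ isT isT h).
    rewrite sqr_sqrtr; last by rewrite addr_ge0// ltW.
    by rewrite sqrrB; have := sqr_ge0 e; lra.
  have : a * a <= e * a by rewrite ler_wpM2r// ltW.
  have : 0 <= e * a by rewrite mulr_ge0// ltW.
  by rewrite expr2 mulrDr mulr1 mulrCA; lra.
apply/ler_addgt0Pr => e e0.
have c0 : 0 < 1 + 2 * a by lra.
have := sqle (e / (1 + 2 * a)); rewrite divfK ?gt_eqF//; apply.
by rewrite divr_gt0.
Qed.

End NearestResidual.

(** * Convex order and the hull of a law *)

Section SupportHull.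
Context {disp : measure_display} {T : measurableType disp} {R : realType} {d : nat}.
Variables (P : probability T R) (nu : probability 'rV[R]_d R).
Hypotheses (atP : atomless P)
  (nu2 : nu.-integrable setT (EFin \o (fun y => edot y y))).
Implicit Types X Y Z : T -> 'rV[R]_d.

Definition follows Y := measurable_fun setT Y /\
  forall B, measurable B -> P (Y @^-1` B) = nu B.

(* The closed convex hull of the random vectors of law [nu], described by its
   supporting half-spaces. *)
Definition law_hull Z := sqint P Z /\ forall X, sqint P X -> forall e, 0 < e ->
  exists2 Y, follows Y & ip P X Z <= ip P X Y + e.

Lemma follows_sqint Y : follows Y -> sqint P Y.
Proof. by case=> mY lawY; exact: law_sqint mY lawY nu2. Qed.

Lemma follows_ip Y : follows Y -> ip P Y Y = \int[nu]_y edot y y.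
Proof. by case=> mY lawY; exact: law_ip mY lawY nu2. Qed.

Lemma follows_exists : exists Y, follows Y.
Proof.
have nuT : nu setT = P setT by rewrite !probability_setT.
have [Y [mY YP]] := atomless_realization atP measurableT nuT.
by exists Y; split => // B mB; rewrite -YP// setTI.
Qed.

Lemma follows_law_hull Y : follows Y -> law_hull Y.
Proof.
move=> fY; split; first exact: follows_sqint.
by move=> X sX e e0; exists Y => //; rewrite lerDl ltW.
Qed.

(** For a fixed [X], the better of the two approximants serves for the whole segment. *)
Lemma law_hull_convex a Z W : 0 <= a <= 1 -> law_hull Z -> law_hull W ->
  law_hull (a *: Z + (1 - a) *: W).
Proof.
move=> /andP[a0 a1] [sZ hZ] [sW hW].
split; first by apply: sqintD; exact: sqintZ.
move=> X sX e e0; have [Y1 f1 h1] := hZ X sX e e0; have [Y2 f2 h2] := hW X sX e e0.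
rewrite ipDr//; [|exact: sqintZ|exact: sqintZ]; rewrite !ipZr//.
have key c : ip P X Y1 <= c -> ip P X Y2 <= c ->
    a * ip P X Z + (1 - a) * ip P X W <= c + e.
  move=> c1 c2; apply: (@le_trans _ _ (a * (c + e) + (1 - a) * (c + e))); last lra.
  by apply: lerD; apply: ler_wpM2l; rewrite ?subr_ge0//; lra.
by have [h|/ltW h] := leP (ip P X Y1) (ip P X Y2); [exists Y2|exists Y1] => //; exact: key.
Qed.

Lemma law_hull_closed (Zs : nat -> T -> 'rV[R]_d) Z :
  (forall n, law_hull (Zs n)) -> sqint P Z ->
  (forall e, 0 < e -> exists n, ip P (Zs n - Z) (Zs n - Z) <= e) -> law_hull Z.
Proof.
move=> hZs sZ cvgZ; split => // X sX e e0.
have e2 : 0 < e / 2 by rewrite divr_gt0.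
pose c := nrm P X + 1; have c0 : 0 < c by rewrite ltr_wpDl// nrm_ge0.
have r0 : 0 < e / 2 / c by rewrite divr_gt0.
have [n hn] := cvgZ _ (exprn_gt0 2 r0).
have [sn /(_ X sX _ e2)[Y fY hY]] := hZs n.
exists Y => //.
have sD := sqintB sn sZ.
have nD : nrm P (Zs n - Z) <= e / 2 / c.
  by rewrite -(@ler_pXn2r _ 2)// ?nnegrE ?nrm_ge0 ?(ltW r0)// nrm_sqr.
have : - ip P X (Zs n - Z) <= e / 2.
  apply: le_trans (ler_norm _) _; rewrite normrN.
  apply: le_trans (ip_CauchySchwarz sX sD) _.
  apply: (@le_trans _ _ (c * (e / 2 / c))).
    by apply: ler_pM; rewrite ?sqrtr_ge0// lerDl.
  by rewrite mulrC divfK// gt_eqF.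
by rewrite (ipBr sn sZ sX); lra.
Qed.

(** [Z] is tested against itself, and the norm of [Y] is fixed by its law. *)
Lemma law_hull_bounded Z : law_hull Z -> ip P Z Z <= \int[nu]_y edot y y.
Proof.
move=> [sZ hZ]; apply/ler_addgt0Pr => e e0.
have [Y fY hY] := hZ Z sZ _ (divr_gt0 e0 (ltr0n R 2)).
have := ip_le sZ (follows_sqint fY); rewrite (follows_ip fY); lra.
Qed.

Lemma law_hull_maxaff Z g c n : law_hull Z ->
  \int[P]_w maxaff g c n (Z w) <= \int[nu]_y maxaff g c n y.
Proof.
move=> [sZ hZ]; have [mZ _] := sZ.
pose am w : 'I_n.+1 := inord (argmaxaff g c n (Z w)).
have amE w : nat_of_ord (am w) = argmaxaff g c n (Z w).
  by rewrite inordK// ltnS argmaxaff_le.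
have mam i : measurable [set w | am w = i].
  rewrite (_ : [set w | _] = Z @^-1` [set x | argmaxaff g c n x = i]).
    by rewrite -[X in measurable X]setTI; apply: mZ => //; exact: measurable_argmaxaff.
  apply/seteqP; split => w /= h; first by rewrite -h amE.
  by apply/val_inj => /=; rewrite -h; exact: amE.
(* Tested against the slope of the affine piece active at [Z]. *)
pose X w := g (am w).
have sX : sqint P X.
  split; first exact: (@measurable_finite_comp _ _ _ _ _ am (fun i : 'I_n.+1 => g i)).
  exact: (integrable_finite_valued P (fun i : 'I_n.+1 => edot (g i) (g i)) mam).
have ic := integrable_finite_valued P (fun i : 'I_n.+1 => c i) mam.
apply/ler_addgt0Pr => e e0.
have [Y fY hY] := hZ X sX e e0; have sY := follows_sqint fY.
have -> : \int[P]_w maxaff g c n (Z w) = ip P X Z + \int[P]_w c (am w).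
  rewrite -RintegralD//; last exact: integrable_edot.
  by apply: eq_Rintegral => w _; rewrite argmaxaffE /X amE.
apply: (@le_trans _ _ (ip P X Y + \int[P]_w c (am w) + e)); first lra.
rewrite lerD2r -RintegralD//; last exact: integrable_edot.
have [mY lawY] := fY.
rewrite -(law_Rintegral mY lawY (integrable_maxaff g c n nu2)).
apply: le_Rintegral => //.
- by apply: EFin_integrableD => //; exact: integrable_edot.
- exact: integrable_maxaff_comp.
- by move=> w _; apply: maxaff_ge; rewrite -ltnS ltn_ord.
Qed.

End SupportHull.

Section HullConvexOrder.
Context {disp : measure_display} {T : measurableType disp} {R : realType} {d : nat}.
Variables (P : probability T R) (nu : probability 'rV[R]_d R).
Hypotheses (atP : atomless P)
  (nu2 : nu.-integrable setT (EFin \o (fun y => edot y y))).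

Lemma distribution_integrable2 (Z : {RV P >-> 'rV[R]_d}) : sqint P Z ->
  (distribution P Z).-integrable setT (EFin \o (fun y => edot y y)).
Proof.
move=> [mZ iZ]; apply/integrableP; split.
  by apply/measurable_EFinP; apply: measurable_edot; exact: measurable_id.
rewrite ge0_integral_pushforward//; last first.
  apply/measurable_EFinP/measurableT_comp => //.
  by apply: measurable_edot; exact: measurable_id.
by rewrite preimage_setT; case/integrableP: iZ.
Qed.

(** Both properties reduce to maxima of affine functions. For the converse direction,
    [transport_bound] is used on one space with [U := X] and [V := Z]. *)
Lemma law_hullP (Z : {RV P >-> 'rV[R]_d}) : sqint P Z ->
  law_hull P nu Z <-> convex_order (distribution P Z) nu.
Proof.
move=> sZ; have Z2 := distribution_integrable2 sZ; have [mZ _] := sZ.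
have lawZ g c n : \int[P]_w maxaff g c n (Z w) = \int[distribution P Z]_y maxaff g c n y.
  by apply: law_Rintegral => //; exact: integrable_maxaff.
split=> [hZ|cZ].
  by apply: convex_order_maxaff => // g c n; rewrite -lawZ; exact: law_hull_maxaff.
split => // X sX e e0; have [mX _] := sX.
pose X' : {RV P >-> 'rV[R]_d} := mfun_Sub (mem_set mX).
have mu2 : (distribution P X').-integrable setT (EFin \o (fun y => edot y y)).
  exact: distribution_integrable2.
have [|||Y [mY lawY hY]] := @transport_bound _ _ _ _ P (distribution P X') nu atP mu2 nu2
  _ _ P X X Z e mX _ mX _ sZ _ e0.
- by [].
- by [].
- move=> g c n; rewrite lawZ.
  have /(cZ _) : convex_function setT (maxaff g c n : 'rV[R]_d -> R^o).
    by apply/convex_functionP; exact: maxaff_convex.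
  by rewrite -!EFin_Rintegral ?lee_fin//; exact: integrable_maxaff.
by exists Y.
Qed.

End HullConvexOrder.

(** * Wasserstein distance and maximum covariance *)

Section L2Bridge.
Context {disp : measure_display} {T : measurableType disp} {R : realType} {d : nat}.
Variable P : probability T R.
Implicit Types X Y Z : T -> 'rV[R]_d.

Definition RV_of X (mX : measurable_fun setT X) : {RV P >-> 'rV[R]_d} :=
  mfun_Sub (mem_set mX).

Lemma L2norm_sqr X : (L2norm P X ^+ 2 = \int[P]_w (edot (X w) (X w))%:E)%E.
Proof.
have -> : (L2norm P X ^+ 2 = L2norm P X `^ 2)%E.
  have : (0 <= L2norm P X)%E by exact: Lnorm_ge0.
  case: (L2norm P X) => [r r0||//]; last by rewrite poweRyr// ?mulyy.
  by rewrite poweR_EFin powR_mulrn// EFin_expe.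
rewrite /L2norm powR_Lnorm//; apply: eq_integral => w _.
rewrite abse_EFin poweR_EFin ger0_norm ?sqrtr_ge0// powR_mulrn ?sqrtr_ge0//.
by rewrite enorm_sqr.
Qed.

Lemma L2norm_sqrE X : sqint P X -> (L2norm P X ^+ 2 = (ip P X X)%:E)%E.
Proof. by move=> [_ iX]; rewrite L2norm_sqr /ip EFin_Rintegral. Qed.

Lemma L2P (X : {RV P >-> 'rV[R]_d}) : L2 X <-> sqint P X.
Proof.
have mE : measurable_fun setT (fun w => edot (X w) (X w)) by exact: measurable_edot.
have intE : (\int[P]_w `|(edot (X w) (X w))%:E| = L2norm P X ^+ 2)%E.
  rewrite L2norm_sqr; apply: eq_integral => w _.
  by rewrite gee0_abs// lee_fin edot_ge0.
have N0 : (0 <= L2norm P X)%E by exact: Lnorm_ge0.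
split=> [h|[_ /integrableP[_]]].
  split=> //; apply/integrableP; split; first exact/measurable_EFinP.
  rewrite /= intE; move: N0 h; rewrite /L2 /=; case: (L2norm P X) => // r _ _.
  by rewrite -EFinM ltry.
rewrite /= intE /L2 /=; move: N0; case: (L2norm P X) => [r _ _||//]; first exact: ltry.
by rewrite mulyy.
Qed.

Lemma L2dotE X Y : sqint P X -> sqint P Y -> L2dot P X Y = (ip P X Y)%:E.
Proof. by move=> sX sY; rewrite /L2dot unlock /ip EFin_Rintegral//; exact: integrable_edot. Qed.

Lemma ip_eq0_ae X : sqint P X -> ip P X X <= 0 -> {ae P, forall w, X w = 0}.
Proof.
move=> [mX iX] X0.
have := (ae_eq_integral_abs P measurableT (measurable_int P iX)).1.
case=> [|N [mN N0 sN]].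
  under eq_integral do rewrite gee0_abs /= ?lee_fin ?edot_ge0//.
  rewrite -EFin_Rintegral//; congr EFin; apply/eqP; rewrite eq_le X0.
  exact: ip_ge0.
exists N; split => // w /= h; apply: sN => /= /(_ I) [].
by move=> h0; apply: h; apply/eqP; rewrite -edot_eq0 h0.
Qed.

End L2Bridge.

Section MaximumCovariance.
Context {disp : measure_display} {T : measurableType disp} {R : realType} {d : nat}.
Variable P : probability T R.
Hypothesis atP : atomless P.
Implicit Types (X Y Z : T -> 'rV[R]_d) (mu nu : probability 'rV[R]_d R).

Lemma P2P mu : P2 mu <-> mu.-integrable setT (EFin \o (fun y => edot y y)).
Proof.
have -> : (P2 mu) = (\int[mu]_y `|(EFin \o (fun y => edot y y)) y| < +oo)%E.
  rewrite /P2 /= /M2; congr (_ < _)%E; apply: eq_integral => y _.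
  by rewrite enorm_sqr /= ger0_norm// edot_ge0.
split=> [h|/integrableP[]//]; apply/integrableP; split => //.
by apply/measurable_EFinP; apply: measurable_edot; exact: measurable_id.
Qed.

Lemma M2E mu : P2 mu -> M2 mu = (\int[mu]_y edot y y)%:E.
Proof.
move/P2P => mu2; rewrite EFin_Rintegral// /M2.
by apply: eq_integral => y _; rewrite enorm_sqr.
Qed.

Definition supcov nu X : R := sup [set ip P X Y | Y in follows P nu].

Lemma supcov_has_sup nu X : P2 nu -> sqint P X ->
  has_sup [set ip P X Y | Y in follows P nu].
Proof.
move=> /P2P nu2 sX; split.
  by have [Y fY] := follows_exists nu atP; exists (ip P X Y), Y.
exists ((ip P X X + \int[nu]_y edot y y) / 2) => _ [Y fY <-].
have := ip_le sX (follows_sqint nu2 fY); rewrite (follows_ip nu2 fY).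
move: (ip P X X) (ip P X Y) => a b; lra.
Qed.

Lemma supcov_ge nu X Y : P2 nu -> sqint P X -> follows P nu Y -> ip P X Y <= supcov nu X.
Proof.
move=> nu2 sX fY; apply: ub_le_sup; first by case: (supcov_has_sup nu2 sX).
by exists Y.
Qed.

Lemma supcov_adherent nu X e : P2 nu -> sqint P X -> 0 < e ->
  exists2 Y, follows P nu Y & supcov nu X < ip P X Y + e.
Proof.
move=> nu2 sX e0; have [_ [Y fY <-] h] := sup_adherent e0 (supcov_has_sup nu2 sX).
by exists Y => //; rewrite -ltrBlDr.
Qed.

Lemma law_hull_le_supcov nu X Z : P2 nu -> sqint P X -> law_hull P nu Z ->
  ip P X Z <= supcov nu X.
Proof.
move=> nu2 sX [sZ hZ]; apply/ler_addgt0Pr => e e0.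
have [Y fY hY] := hZ X sX e e0.
by apply: le_trans hY _; rewrite lerD2r; exact: supcov_ge.
Qed.

Lemma F_supcov nu X : P2 nu -> sqint P X -> F P nu X = (supcov nu X)%:E.
Proof.
move=> nu2 sX; have [S0 Sb] := supcov_has_sup nu2 sX.
rewrite /supcov -ereal_sup_EFin// /F; congr ereal_sup; apply/seteqP; split.
  move=> _ [Y [/L2P sY lawY] <-]; exists (ip P X Y); last by rewrite L2dotE.
  by exists Y.
move=> _ [_ [Y fY <-] <-].
have sY := follows_sqint ((P2P _).1 nu2) fY; have [mY lawY] := fY.
exists (RV_of P mY); last by rewrite L2dotE.
by split => //; exact/L2P.
Qed.

(** [transport_bound] turns a pair [(X, Y')] with [Y'] of law [nu] into a pair [(X', Y)] with [X']
    of law [mu], at a loss of at most [e]. Hence the maximum covariance depends only on the two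
    laws. *)
Lemma supcov_le mu nu X Y : P2 mu -> P2 nu -> follows P mu X -> follows P nu Y ->
  supcov nu X <= supcov mu Y.
Proof.
move=> mu2 nu2 fX fY.
have mu2' := (P2P _).1 mu2; have nu2' := (P2P _).1 nu2.
have sX := follows_sqint mu2' fX; have sY := follows_sqint nu2' fY.
apply: sup_le_ub; first by case: (supcov_has_sup nu2 sX).
move=> _ [Y' fY' <-]; apply/ler_addgt0Pr => e e0.
have [[mX lawX] [mY lawY] [mY' lawY']] := And3 fX fY fY'.
have [|X' [mX' lawX' hX']] := @transport_bound _ _ _ _ P nu mu atP nu2' mu2'
    _ _ P Y Y' X e mY lawY mY' lawY' sX _ e0.
  move=> g c n; rewrite (law_Rintegral mX lawX) //; exact: integrable_maxaff.
rewrite ipC; apply: le_trans hX' _; rewrite lerD2r.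
exact: supcov_ge.
Qed.

Lemma supcovC mu nu X Y : P2 mu -> P2 nu -> follows P mu X -> follows P nu Y ->
  supcov nu X = supcov mu Y.
Proof. by move=> *; apply/eqP; rewrite eq_le !supcov_le. Qed.

Lemma W2_sqr_le mu nu X Y : follows P mu X -> follows P nu Y ->
  sqint P X -> sqint P Y -> (W2 mu nu ^+ 2 <= (ip P (X - Y) (X - Y))%:E)%E.
Proof.
move=> [mX lawX] [mY lawY] sX sY; have sXY := sqintB sX sY.
rewrite sqr_sqrte; last first.
  by apply: le_ereal_inf_tmp => _ [g _ <-]; apply: integral_ge0 => z _; rewrite lee_fin sqr_ge0.
have mXY := measurable_fun_pair mX mY.
pose XY : {RV P >-> ('rV[R]_d * 'rV[R]_d)%type} := mfun_Sub (mem_set mXY).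
have mq : measurable_fun setT
    (fun z : 'rV[R]_d * 'rV[R]_d => edot (z.1 - z.2) (z.1 - z.2)).
  have mB : measurable_fun setT (fun z : 'rV[R]_d * 'rV[R]_d => z.1 - z.2).
    rewrite (_ : (fun z => _) = fun z : 'rV[R]_d * 'rV[R]_d => 1 *: z.1 + (-1) *: z.2).
      by apply: measurable_lincomb; [exact: measurable_fst|exact: measurable_snd].
    by apply/funext => z; rewrite scale1r scaleN1r.
  exact: measurable_edot.
apply: ereal_inf_lbound; exists (distribution P XY : probability _ R).
  move=> A mA; rewrite -lawX// -lawY//; split; congr (P _).
    by apply/seteqP; split => w //= [].
  by apply/seteqP; split => w //= [].
rewrite /ip EFin_Rintegral; last by case: sXY.
transitivity (\int[distribution P XY]_z (edot (z.1 - z.2) (z.1 - z.2))%:E)%E.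
  by apply: eq_integral => z _; rewrite enorm_sqr.
rewrite ge0_integral_pushforward//; last 2 first.
  exact/measurable_EFinP.
  by move=> z _; rewrite lee_fin edot_ge0.
Qed.

(** [transport_bound] is applied on the product space, with the coupling as probability and the
    projections as [U] and [V]. *)
Lemma W2_sqr_ge mu nu X : P2 mu -> P2 nu -> follows P mu X ->
  ((\int[mu]_y edot y y + \int[nu]_y edot y y - 2 * supcov nu X)%:E <= W2 mu nu ^+ 2)%E.
Proof.
move=> mu2 nu2 [mX lawX]; have mu2' := (P2P _).1 mu2; have nu2' := (P2P _).1 nu2.
have sX := law_sqint mX lawX mu2'.
rewrite sqr_sqrte; last first.
  by apply: le_ereal_inf_tmp => _ [g _ <-]; apply: integral_ge0 => z _; rewrite lee_fin sqr_ge0.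
apply: le_ereal_inf_tmp => _ [g cg <-].
pose U := @fst 'rV[R]_d 'rV[R]_d; pose V := @snd 'rV[R]_d 'rV[R]_d.
have mU : measurable_fun setT U by exact: measurable_fst.
have mV : measurable_fun setT V by exact: measurable_snd.
have lawU B : measurable B -> g (U @^-1` B) = mu B.
  by move=> mB; rewrite -(cg B mB).1; congr (g _); apply/seteqP; split => z //= [].
have lawV B : measurable B -> g (V @^-1` B) = nu B.
  by move=> mB; rewrite -(cg B mB).2; congr (g _); apply/seteqP; split => z //= [].
have sU := law_sqint mU lawU mu2'; have sV := law_sqint mV lawV nu2'.
have -> : (\int[g]_z (enorm (z.1 - z.2) ^+ 2)%:E = (ip g (U - V) (U - V))%:E)%E.
  rewrite /ip EFin_Rintegral; last by case: (sqintB sU sV).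
  by apply: eq_integral => z _; rewrite enorm_sqr.
rewrite lee_fin ip_sqrB// (law_ip mU lawU mu2') (law_ip mV lawV nu2').
apply/ler_addgt0Pr => e e0.
have [|Y [mY lawY hY]] := @transport_bound _ _ _ _ P mu nu atP mu2' nu2'
    _ _ g X U V (e / 2) mX lawX mU lawU sV _ (divr_gt0 e0 (ltr0n R 2)).
  move=> h c n; rewrite (law_Rintegral mV lawV) //; exact: integrable_maxaff.
have := supcov_ge nu2 sX (conj mY lawY); move: hY.
move: (ip g U V) (ip P X Y) (supcov nu X) (Rintegral _ _ _) (Rintegral _ _ _) => *; lra.
Qed.

Lemma W2_sqr mu nu X : P2 mu -> P2 nu -> follows P mu X ->
  (W2 mu nu ^+ 2 = (\int[mu]_y edot y y + \int[nu]_y edot y y - 2 * supcov nu X)%:E)%E.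
Proof.
move=> mu2 nu2 fX; apply/eqP; rewrite eq_le W2_sqr_ge// andbT.
have mu2' := (P2P _).1 mu2; have nu2' := (P2P _).1 nu2.
have sX := follows_sqint mu2' fX.
apply/lee_addgt0Pr => e e0.
have [Y fY hY] := supcov_adherent nu2 sX (divr_gt0 e0 (ltr0n R 2)).
have sY := follows_sqint nu2' fY.
apply: le_trans (W2_sqr_le fX fY sX sY) _.
rewrite -EFinD lee_fin ip_sqrB// (follows_ip mu2' fX) (follows_ip nu2' fY).
move: hY; move: (ip P X Y) (supcov nu X) (Rintegral _ _ _) (Rintegral _ _ _) => *; lra.
Qed.

End MaximumCovariance.

(** * The lifted problem and its dual *)

Section LiftedProblem.
Context {disp : measure_display} {T : measurableType disp} {R : realType} {d K : nat}.
Variable P : probability T R.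
Hypothesis atP : atomless P.
Local Notation rvec := (T -> 'rV[R]_d).
Variables (t : R) (lambda0 : 'I_K -> R).
Hypotheses (t1 : 1 < t) (l0 : forall k, 0 < lambda0 k) (l1 : \sum_k lambda0 k = 1).
Variables (nu1 : probability 'rV[R]_d R) (nu0 : 'I_K -> probability 'rV[R]_d R).
Hypotheses (P1 : P2 nu1) (P0 : forall k, P2 (nu0 k)).
Variable Y : rvec.
Hypothesis fY : follows P nu1 Y.

Let sY : sqint P Y. Proof. by apply: follows_sqint fY; exact/P2P. Qed.

Local Notation hull Z := (forall k, law_hull P (nu0 k) (Z k)).
Local Notation res := (residual t lambda0 Y).

Definition lifted (X : rvec) : R := ip P X X / 2 - t * ip P X Y +
  (t - 1) * \sum_k lambda0 k * supcov P (nu0 k) X.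

Lemma residualE Z : res Z = affine_residual (t *: Y) (fun k => (t - 1) * lambda0 k) Z.
Proof.
apply/funext => w; rewrite /residual /affine_residual; congr (_ - _).
rewrite fct_sumE scaler_sumr; apply: eq_bigr => k _; rewrite scalerA.
by [].
Qed.

Lemma residual_sqint Z : (forall k, sqint P (Z k)) -> sqint P (res Z).
Proof. by move=> sZ; rewrite residualE; apply: affine_residual_sqint => //; exact: sqintZ. Qed.

Lemma ip_residual X Z : sqint P X -> (forall k, sqint P (Z k)) ->
  ip P X (res Z) = t * ip P X Y - (t - 1) * \sum_k lambda0 k * ip P X (Z k).
Proof.
move=> sX sZ; rewrite residualE /affine_residual.
have sbZ k : sqint P (((t - 1) * lambda0 k) *: Z k) by exact: sqintZ.
rewrite (ipBr (sqintZ t sY) (sqint_sum _ sbZ) sX) ipZr//; congr (_ - _).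
rewrite ipC ip_suml// mulr_sumr; apply: eq_bigr => k _.
by rewrite ipZl// ipC mulrA.
Qed.

(** Weak duality: [supcov] dominates the scalar products with elements of the hull. *)
Lemma lifted_ge X Z : sqint P X -> hull Z -> ip P X X / 2 - ip P X (res Z) <= lifted X.
Proof.
move=> sX hZ; rewrite ip_residual// => [|k]; last by case: (hZ k).
rewrite /lifted opprB addrCA -addrA [leRHS]addrC addrC -addrA.
have : \sum_k lambda0 k * ip P X (Z k) <= \sum_k lambda0 k * supcov P (nu0 k) X.
  by apply: ler_sum => k _; rewrite ler_pM2l//; exact: law_hull_le_supcov.
have t0 : 0 <= t - 1 by have := t1; lra.
move/(ler_wpM2l t0); move: (_ * \sum_k _) (_ * \sum_k _) (ip P X X) (t * _) => *; lra.
Qed.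

Lemma nearest_residual : exists Z, hull Z /\
  forall W, hull W -> ip P (res Z) (res Z) <= ip P (res W) (res W).
Proof.
pose B := \sum_k \int[nu0 k]_y edot y y.
have [||||||Z [hZ minZ]] := @nearest_residual_exists _ _ _ d K P
  (fun k => law_hull P (nu0 k)) B _ _ _ _ _ (t *: Y) (fun k => (t - 1) * lambda0 k) _.
- by move=> k Z [].
- move=> k; have [Z fZ] := follows_exists (nu0 k) atP.
  by exists Z; apply: follows_law_hull => //; exact/P2P.
- by move=> k a Z W; apply: law_hull_convex.
- by move=> k Zs Z; apply: law_hull_closed; exact/P2P.
- move=> k Z hZ; apply: le_trans (law_hull_bounded _ hZ) _; first exact/P2P.
  rewrite /B (bigD1 k)//= lerDl sumr_ge0// => i _.
  by apply: Rintegral_ge0 => y _; exact: edot_ge0.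
- exact: sqintZ.
exists Z; split; [exact: hZ|by move=> W hW; rewrite !residualE; exact: minZ].
Qed.

Lemma lifted_nearest Z : hull Z ->
  (forall W, hull W -> ip P (res Z) (res Z) <= ip P (res W) (res W)) ->
  lifted (res Z) = - (ip P (res Z) (res Z) / 2).
Proof.
move=> hZ minZ; have sZ k : sqint P (Z k) by case: (hZ k).
have sX := residual_sqint sZ.
apply/eqP; rewrite eq_le; apply/andP; split; last first.
  have := lifted_ge sX hZ; move: (ip P _ _) (lifted _) => *; lra.
have t0 : 0 < t - 1 by have := t1; lra.
apply/ler_addgt0Pr => e e0; pose e' := e / (t - 1).
have e'0 : 0 < e' by rewrite divr_gt0.
(* The suprema need not be attained; nearly optimal [W k] are feasible competitors for the
   variational inequality. Since the [lambda0 k] sum to 1, their errors add up to [e'], which the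
   factor [t - 1] turns into [e]. *)
have /choice[W hW] : forall k, exists W, follows P (nu0 k) W /\
    supcov P (nu0 k) (res Z) < ip P (res Z) W + e'.
  by move=> k; have [W fW leW] := supcov_adherent atP (P0 k) sX e'0; exists W.
have hW' k : law_hull P (nu0 k) (W k).
  by apply: follows_law_hull; [exact/P2P|exact: (hW k).1].
have sW k : sqint P (W k) by case: (hW' k).
have : ip P (res Z) (res Z) <= ip P (res Z) (res W).
  rewrite !residualE.
  apply: (@nearest_residual_variational _ _ _ d K P (fun k => law_hull P (nu0 k))).
  - by move=> k V [].
  - by move=> k a V V'; apply: law_hull_convex.
  - exact: sqintZ.
  - exact: hZ.
  - by move=> V hV; rewrite -!residualE; exact: minZ.
  - exact: hW'.
rewrite (ip_residual sX sW).
have : \sum_k lambda0 k * supcov P (nu0 k) (res Z) <=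
    \sum_k lambda0 k * ip P (res Z) (W k) + e'.
  apply: (@le_trans _ _ (\sum_k lambda0 k * (ip P (res Z) (W k) + e'))).
    by apply: ler_sum => k _; rewrite ler_pM2l//; exact: ltW (hW k).2.
  under eq_bigr do rewrite mulrDr.
  by rewrite big_split /= -mulr_suml l1 mul1r.
move/(ler_wpM2l (ltW t0)); rewrite mulrDr [_ * e']mulrC divfK ?gt_eqF//.
rewrite /lifted.
move: (_ * \sum_k _) (_ * \sum_k _) (ip P (res Z) (res Z)) (t * _) => *; lra.
Qed.

Definition lifted_shift : R := t * (\int[nu1]_y edot y y / 2) -
  (t - 1) * \sum_k lambda0 k * (\int[nu0 k]_y edot y y / 2).

(** As the [lambda0 k] sum to 1, the second moment of [mu] has total weight [t - (t - 1) = 1], which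
    leaves [ip P X X / 2]. *)
Lemma primal_objective_follows mu X : P2 mu -> follows P mu X ->
  (t%:E * (W2 mu nu1 ^+ 2 / 2%:E) -
    (t - 1)%:E * \sum_(k < K) (lambda0 k)%:E * (W2 mu (nu0 k) ^+ 2 / 2%:E))%E =
  (ip P X X / 2 - t * supcov P nu1 X +
    (t - 1) * \sum_k lambda0 k * supcov P (nu0 k) X + lifted_shift)%:E.
Proof.
move=> mu2 fX; have mu2' := (P2P _).1 mu2.
rewrite (W2_sqr atP mu2 P1 fX).
have -> : (\sum_(k < K) (lambda0 k)%:E * (W2 mu (nu0 k) ^+ 2 / 2%:E) =
    (\sum_k lambda0 k * ((\int[mu]_y edot y y + \int[nu0 k]_y edot y y -
      2 * supcov P (nu0 k) X) / 2))%:E)%E.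
  rewrite -sumEFin; apply: eq_bigr => k _.
  by rewrite (W2_sqr atP mu2 (P0 k) fX) inver pnatr_eq0.
rewrite inver pnatr_eq0 /= -!EFinM -EFinB; congr EFin.
rewrite /lifted_shift -(follows_ip mu2' fX).
have -> : \sum_k lambda0 k * ((ip P X X + \int[nu0 k]_y edot y y -
      2 * supcov P (nu0 k) X) / 2) = ip P X X / 2 +
    \sum_k lambda0 k * (\int[nu0 k]_y edot y y / 2) -
    \sum_k lambda0 k * supcov P (nu0 k) X.
  rewrite -[X in _ = X + _ - _]mul1r -[X in _ = X * _ + _ - _]l1 mulr_suml -big_split -sumrB /=.
  by apply: eq_bigr => k _; field.
by field.
Qed.

(** The primal objective contains [supcov P nu1 X] where the lifted one contains [ip P X Y], which
    is smaller. The law of the residual therefore gives the upper bound; for the lower bound [X] has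
    to be nearly optimal against the given [Y]. *)
Lemma primal_value_lifted_min Z : hull Z ->
  (forall W, hull W -> ip P (res Z) (res Z) <= ip P (res W) (res W)) ->
  primal_value t lambda0 nu1 nu0 = (lifted_shift - ip P (res Z) (res Z) / 2)%:E.
Proof.
move=> hZ minZ; have sZ k : sqint P (Z k) by case: (hZ k).
have sX := residual_sqint sZ; have t0 : 0 < t by have := t1; lra.
apply/eqP; rewrite eq_le; apply/andP; split.
  have [mX _] := sX.
  pose mu : probability _ R := distribution P (RV_of P mX).
  have fX : follows P mu (res Z) by [].
  have mu2 : P2 mu by apply/P2P; exact: distribution_integrable2.
  apply: ge_ereal_inf; eexists; first by exists mu; [exact: mu2|].
  rewrite (primal_objective_follows mu2 fX) lee_fin.
  have /(ler_wpM2l (ltW t0)) := supcov_ge atP P1 sX fY.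
  have := lifted_nearest hZ minZ; rewrite /lifted.
  move: (ip P (res Z) (res Z)) (t * _) (t * _) (_ * \sum_k _) lifted_shift => *; lra.
apply: le_ereal_inf_tmp => _ [mu mu2 <-].
apply/lee_addgt0Pr => e e0.
(* [Y] is kept and [X] is chosen; [supcovC] identifies this supremum with [supcov P nu1 X]. *)
have [X fX hX] := supcov_adherent atP mu2 sY (divr_gt0 e0 t0).
have mu2' := (P2P _).1 mu2; have sX' := follows_sqint mu2' fX.
rewrite (primal_objective_follows mu2 fX) -EFinD lee_fin.
move: hX; rewrite (supcovC atP P1 mu2 fY fX) -(ltr_pM2l t0) mulrDr [t * (e / t)]mulrC.
rewrite divfK ?gt_eqF// ipC.
have := lifted_ge sX' hZ; rewrite /lifted.
have := ip_le sX' sX.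
move: (ip P (res Z) (res Z)) (ip P X X) (t * _) (t * _) (ip P X (res Z)) (_ * \sum_k _).
move: lifted_shift => *; lra.
Qed.

Lemma dual_feasibleP (Z : 'I_K -> {RV P >-> 'rV[R]_d}) : dual_feasible nu0 Z <-> hull Z.
Proof.
split=> [fZ k|hZ k].
  have [/L2P sZ cZ] := fZ k.
  by apply/(law_hullP atP _ sZ).2 => //; exact/P2P.
have [sZ _] := hZ k; split; first exact/L2P.
by apply: (law_hullP atP _ sZ).1 => //; exact/P2P.
Qed.

Lemma dual_objectiveE (Z : 'I_K -> {RV P >-> 'rV[R]_d}) : dual_feasible nu0 Z ->
  dual_objective t lambda0 Y Z = (ip P (res (fun k => Z k)) (res (fun k => Z k)) / 2)%:E.
Proof.
move=> /dual_feasibleP hZ; rewrite /dual_objective L2norm_sqrE.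
  by rewrite inver pnatr_eq0.
by apply: residual_sqint => k; case: (hZ k).
Qed.

Lemma lifted_objectiveE (X : {RV P >-> 'rV[R]_d}) : L2 X ->
  lifted_objective t lambda0 Y nu0 X = (lifted X)%:E.
Proof.
move=> /L2P sX; rewrite /lifted_objective L2norm_sqrE// L2dotE//.
rewrite inver pnatr_eq0 /=.
under eq_bigr do rewrite (F_supcov atP (P0 _) sX).
by rewrite sumEFin.
Qed.

Lemma dual_minimizerP (Z : 'I_K -> {RV P >-> 'rV[R]_d}) :
  is_minimizer (dual_feasible nu0) (dual_objective t lambda0 Y) Z <->
  hull Z /\ forall W, hull W ->
    ip P (res (fun k => Z k)) (res (fun k => Z k)) <= ip P (res W) (res W).
Proof.
split=> [[fZ minZ]|[hZ minZ]].
  split=> [|W hW]; first exact/dual_feasibleP.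
  have mW k : measurable_fun setT (W k) by case: (hW k) => -[].
  have fW : dual_feasible nu0 (fun k => RV_of P (mW k)) by exact/dual_feasibleP.
  have := minZ _ fW; rewrite (dual_objectiveE fZ) (dual_objectiveE fW) lee_fin.
  by rewrite ler_pM2r.
have fZ : dual_feasible nu0 Z by exact/dual_feasibleP.
split; [exact: fZ|move=> W fW].
rewrite (dual_objectiveE fZ) (dual_objectiveE fW) lee_fin ler_pM2r; last by [].
by apply: minZ; exact/dual_feasibleP.
Qed.

Lemma dual_value_minimizer (Z : 'I_K -> {RV P >-> 'rV[R]_d}) :
  is_minimizer (dual_feasible nu0) (dual_objective t lambda0 Y) Z ->
  dual_value P t lambda0 Y nu0 = dual_objective t lambda0 Y Z.
Proof.
move=> [fZ minZ]; apply/eqP; rewrite eq_le; apply/andP; split.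
  by apply: ereal_inf_lbound; exists Z.
by apply: le_ereal_inf_tmp => _ [W fW <-]; exact: minZ.
Qed.

Lemma dual_minimizer_exists : exists Z : 'I_K -> {RV P >-> 'rV[R]_d},
  is_minimizer (dual_feasible nu0) (dual_objective t lambda0 Y) Z.
Proof.
have [Z [hZ minZ]] := nearest_residual.
have mZ k : measurable_fun setT (Z k) by case: (hZ k) => -[].
by exists (fun k => RV_of P (mZ k)); exact/dual_minimizerP.
Qed.

Lemma lifted_minimizerP (X : {RV P >-> 'rV[R]_d}) : L2 X ->
  is_minimizer (@L2 _ _ _ d P) (lifted_objective t lambda0 Y nu0) X <->
  exists Z : 'I_K -> {RV P >-> 'rV[R]_d},
    is_minimizer (dual_feasible nu0) (dual_objective t lambda0 Y) Z /\
    (X : T -> 'rV[R]_d) = res (fun k => Z k) %[ae P].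
Proof.
move=> LX; have /L2P sX := LX; split=> [[_ minX]|[Z [minZ XZ]]].
  have [Z minZ] := dual_minimizer_exists; exists Z; split => //.
  have [hZ mZ] := (dual_minimizerP Z).1 minZ.
  have sV := residual_sqint (fun k => (hZ k).1).
  have [mV _] := sV; have LV : L2 (RV_of P mV) by exact/L2P.
  have := minX _ LV; rewrite (lifted_objectiveE LX) (lifted_objectiveE LV) lee_fin.
  rewrite (lifted_nearest hZ mZ) => leX.
  have /(ip_eq0_ae (sqintB sX sV)) : ip P ((X : T -> 'rV[R]_d) - res (fun k => Z k))
      ((X : T -> 'rV[R]_d) - res (fun k => Z k)) <= 0.
    rewrite ip_sqrB//; have := lifted_ge sX hZ; move: leX.
    move: (ip P _ _) (ip P _ _) (ip P _ _) (lifted _) => *; lra.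
  by apply: filterS => w /eqP h _; apply/eqP; rewrite -subr_eq0.
have [hZ mZ] := (dual_minimizerP Z).1 minZ.
have sV := residual_sqint (fun k => (hZ k).1).
split => // X' LX'; have /L2P sX' := LX'.
rewrite !lifted_objectiveE// lee_fin.
(* [X] is the residual only almost everywhere, but [lifted] depends only on the class in L^2. *)
suff -> : lifted X = lifted (res (fun k => Z k)).
  rewrite (lifted_nearest hZ mZ); apply: le_trans (lifted_ge sX' hZ).
  have := ip_le sX' sV.
  move: (ip P _ _) (ip P _ _) (ip P _ _) => *; lra.
have [[mX _] [mV _]] := (sX, sV).
have aeip W : sqint P W -> ip P X W = ip P (res (fun k => Z k)) W.
  move=> [mW _]; rewrite /ip /Rintegral; congr fine; apply: ae_eq_integral => //.
  - by apply/measurable_EFinP; exact: measurable_edot.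
  - by apply/measurable_EFinP; exact: measurable_edot.
  - by apply: filterS XZ => w h _ /=; rewrite h.
rewrite /lifted (aeip _ sX) (aeip _ sY) ipC (aeip _ sV); congr (_ + _ * _).
apply: eq_bigr => k _; congr (_ * sup _).
by apply/seteqP; split => _ [V fV <-]; exists V => //; rewrite aeip//;
  apply: follows_sqint fV; exact/P2P.
Qed.

End LiftedProblem.

Theorem theorem3p8 (R : realType) (disp : measure_display)
    (Omega : measurableType disp) (P : probability Omega R)
    (hatomless : atomless P) (hseparable : separable_probability P)
    (d K : nat) (hK : (1 <= K)%N) (t : R) (ht : 1 < t)
    (lambda0 : 'I_K -> R) (hlambda_pos : forall k, 0 < lambda0 k)
    (hlambda_sum : \sum_(k < K) lambda0 k = 1)
    (nu1 : probability 'rV[R]_d R) (hnu1 : P2 nu1)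
    (nu0 : 'I_K -> probability 'rV[R]_d R) (hnu0 : forall k, P2 (nu0 k))
    (Y : {RV P >-> 'rV[R]_d}) (hY : L2 Y) (hYnu1 : has_law Y nu1) :
  (primal_value t lambda0 nu1 nu0
   = - dual_value P t lambda0 Y nu0
     + t%:E * (M2 nu1 / 2%:E)
     - (t - 1)%:E * \sum_(k < K) (lambda0 k)%:E * (M2 (nu0 k) / 2%:E))%E
  /\
  (forall X : {RV P >-> 'rV[R]_d}, L2 X ->
     (is_minimizer (@L2 _ _ _ d P) (lifted_objective t lambda0 Y nu0) X
      <->
      exists Z : 'I_K -> {RV P >-> 'rV[R]_d},
        is_minimizer (dual_feasible nu0) (dual_objective t lambda0 Y) Z /\
        (X : Omega -> 'rV[R]_d)
          = residual t lambda0 Y (fun k => Z k) %[ae P])).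
Proof.
have fY : follows P nu1 Y by split.
split=> [|X LX]; last exact: (lifted_minimizerP hatomless ht _ _ hnu1 hnu0 fY).
have [Z minZ] := dual_minimizer_exists hatomless t lambda0 hnu1 hnu0 fY.
have [hZ mZ] := (dual_minimizerP hatomless _ _ hnu1 hnu0 fY Z).1 minZ.
rewrite (primal_value_lifted_min hatomless ht hlambda_pos hlambda_sum hnu1 hnu0 fY hZ mZ).
rewrite (dual_value_minimizer minZ) (dual_objectiveE hatomless _ _ hnu1 hnu0 fY minZ.1).
rewrite (M2E hnu1) (eq_bigr (fun k => (lambda0 k * (\int[nu0 k]_y edot y y / 2))%:E)).
  rewrite sumEFin inver pnatr_eq0 /= -!EFinM -!EFinD; congr EFin.
  by rewrite /lifted_shift; lra.
by move=> k _; rewrite (M2E (hnu0 k)) inver pnatr_eq0.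
Qed.
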